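(* For every $\mu\in\mathbb{C}$ and $z\in\mathbb{C}\setminus(-\infty,0]$, the Bessel function of the second kind satisfies $$Y_\mu(z)=\mathcal{Y}_\mu(z)+S(\mu)\,\frac{\chi_{[-\mu\,\mathrm{sgn}(\mathrm{Re}\,\mu)]}(z)}{\sin\mu\pi},$$ where the integral term is $$\mathcal{Y}_\mu(z):=\frac{B_\mu(z)\cos\mu\pi-B_{-\mu}(z)}{\sin\mu\pi}=\frac{\mathrm{i}^\mu}{\pi\sin\mu\pi}\int_0^\pi e^{-\mathrm{i}z\cos\theta}\Big[\cos\mu\pi\,P\big(\{\mu\},-\mathrm{i}z(1+\cos\theta)\big)-e^{-\mathrm{i}\mu\pi}P\big(-\{\mu\},-\mathrm{i}z(1+\cos\theta)\big)\Big]\cos(\mu\theta)\,\mathrm{d}\theta,$$ and $S(\mu)=\cos\mu\pi$ if $\mathrm{Re}\,\mu<0$, $S(\mu)=-1$ if $\mathrm{Re}\,\mu\geq0$ (for $\mu\in\mathbb{Z}$ the right-hand sides are understood as limits). Moreover $\chi_{[-\mu\,\mathrm{sgn}(\mathrm{Re}\,\mu)]}(z)=0$ for $|\mathrm{Re}\,\mu|<\frac12$.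
   Context: Integral and fractional parts: for $\mu\in\mathbb{C}$, $\langle\mathrm{Re}\,\mu\rangle$ is the nearest integer to $\mathrm{Re}\,\mu$, with $\langle n+\frac12\rangle=n$ for $n\in\mathbb{Z}$; $\{\mu\}:=\mu-\langle\mathrm{Re}\,\mu\rangle$, so $-\frac12<\mathrm{Re}\{\mu\}\leq\frac12$. $\mathrm{sgn}$ is the sign function with $\mathrm{sgn}(0)=0$. $J_\mu(z)=(z/2)^\mu\sum_{k\ge0}\frac{(-1)^k(z/2)^{2k}}{k!\,\Gamma(\mu+k+1)}$; $Y_\mu(z)=\frac{J_\mu(z)\cos\mu\pi-J_{-\mu}(z)}{\sin\mu\pi}$ for $\mu\notin\mathbb{Z}$, and $Y_m=\lim_{\mu\to m}Y_\mu$ for $m\in\mathbb{Z}$. $P(a,w)=w^a\gamma^*(a,w)$ with $\gamma^*(a,w)=e^{-w}\sum_{k\ge0}\frac{w^k}{\Gamma(a+k+1)}$ (normalised lower incomplete gamma function). $z^a$ is the principal power, $\mathrm{i}^a=e^{\mathrm{i}\pi a/2}$, and for $c>0$ the power $(-\mathrm{i}cz)^a$ (including in $P(a,-\mathrm{i}cz)$) means $e^{-\mathrm{i}\pi a/2}c^az^a$. For $\mu\in\mathbb{C}$: $B_\mu(z):=\frac{\mathrm{i}^{\mu}}{\pi}\int_{0}^\pi e^{-\mathrm{i} z\cos\theta}P(\{\mu\},-\mathrm{i} z(1+\cos\theta))\cos(\mu\theta)\,\mathrm{d}\theta$; and $\chi_\mu(z):=\frac{\mathrm{i}^\mu}{\sqrt{\pi}}e^{\mathrm{i}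 z}\sum_{j=1}^{-\langle\mathrm{Re}\,\mu\rangle}\frac{\Gamma(j+\mu-\frac12)}{\Gamma(j)\Gamma(j+2\mu)}(-2\mathrm{i} z)^{j+\mu-1}$ if $\mathrm{Re}\,\mu\leq-\frac12$, $\chi_\mu(z):=0$ if $\mathrm{Re}\,\mu>-\frac12$. For $\mu=m+\frac12$ with $m$ a negative integer, $\Gamma(j+\mu-\frac12)/\Gamma(j+2\mu)$ is understood as its limit $2(-1)^{m+1}\Gamma(-j-2m)/\Gamma(-j-m+1)$.
   Formalization: The printed single-integral form with P(-{μ},·) is claimed only for Re{μ}≠1/2, since for Re μ a half-integer it is false (e.g. μ=1/2) or diverges; the same form with P({-μ},·), the first form of 𝒴_μ and the main identity are claimed for every μ. *)

(* Defs.v *)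
(* Stdlib reals and Coquelicot's complex numbers [C]. *)
From Stdlib Require Export Reals Lra ZArith.
From Stdlib Require Import ClassicalEpsilon.
From Coquelicot Require Export Coquelicot.

Open Scope R_scope.
Open Scope C_scope.

(** ** Limits, series and integrals of complex-valued functions *)

(* [iota P] is the unique element satisfying [P] (unspecified if there is
   none), as in Coquelicot's own [RInt] and [RInt_gen]. *)
Definition Clim {T : Type} (F : (T -> Prop) -> Prop) (f : T -> C) : C :=
  iota (fun l : C_CompleteNormedModule => filterlim f F (locally l)).

Definition ex_Clim {T : Type} (F : (T -> Prop) -> Prop) (f : T -> C) : Prop :=
  exists l : C, filterlim f F (locally l).

Definition CSeries (a : nat -> C) : C := Clim eventually (sum_n a).

(* Improper at the upper endpoint: the integrands below may be unbounded
   at theta = pi. *)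
Definition ex_Cint_0_pi (f : R -> C) : Prop :=
  ex_RInt_gen (V := C_R_CompleteNormedModule) f (at_point 0) (at_left PI).

Definition Cint_0_pi (f : R -> C) : C :=
  RInt_gen (V := C_R_CompleteNormedModule) f (at_point 0) (at_left PI).

(** ** Elementary functions *)

Definition Cexp (z : C) : C := exp (Re z) * (cos (Im z), sin (Im z)).

Definition Ccos (z : C) : C := (Cexp (Ci * z) + Cexp (- (Ci * z))) / 2.

Definition Csin (z : C) : C := (Cexp (Ci * z) - Cexp (- (Ci * z))) / (2 * Ci).

(* Principal argument, in (-pi, pi], for z <> 0. *)
Definition Carg (z : C) : R :=
  if Rle_dec 0 (Im z) then acos (Re z / Cmod z) else (- acos (Re z / Cmod z))%R.

Definition Clog (z : C) : C := (ln (Cmod z), Carg z).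

(* Principal power z^a, for z <> 0. *)
Definition Cpower (z a : C) : C := Cexp (a * Clog z).

Definition ipow (a : C) : C := Cexp (Ci * PI * a / 2).

(* The power (-icz)^a for c > 0, meaning e^(-i pi a/2) c^a z^a; in general it
   is not the principal power of the number -icz. *)
Definition mic_power (c : R) (z a : C) : C :=
  Cexp (- (Ci * PI * a / 2)) * Cpower c a * Cpower z a.

(** ** The Gamma function *)

(* z (z + 1) ... (z + n) *)
Fixpoint rising (z : C) (n : nat) : C :=
  match n with
  | O => z
  | S k => rising z k * (z + INR n)
  end.

(* The entire function 1/Gamma, by the Euler-Gauss limit
   1/Gamma(z) = lim z (z + 1) ... (z + n) / (n! n^z). It vanishes at
   0, -1, -2, ..., where [Gamma] below is meaningless. *)
Definition rGamma (z : C) : C :=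
  Clim eventually
    (fun n : nat => rising z n / (INR (fact n) * Cpower (INR n) z)).

Definition Gamma (z : C) : C := / rGamma z.

(** ** Nearest integer and fractional part *)

(* [Int_part] is the floor, so this is the ceiling of x - 1/2. *)
Definition nearest (x : R) : Z := (- Int_part (1 / 2 - x))%Z.

Lemma nearest_spec (x : R) :
  (- (1 / 2) < x - IZR (nearest x) <= 1 / 2)%R.
Proof.
unfold nearest; rewrite opp_IZR.
destruct (base_Int_part (1 / 2 - x)) as [H1 H2]; split; lra.
Qed.

Definition frac (mu : C) : C := mu - IZR (nearest (Re mu)).

(** ** Bessel functions *)

Definition is_integer (mu : C) : Prop := exists m : Z, mu = RtoC (IZR m).

(* The value at mu of an expression that is understood as a limit when mu is
   an integer. *)
Definition limit_at_integers (f : C -> C) (mu : C) : C :=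
  if excluded_middle_informative (is_integer mu)
  then Clim (locally' mu) f
  else f mu.

Definition ex_limit_at_integers (f : C -> C) (mu : C) : Prop :=
  is_integer mu -> ex_Clim (locally' mu) f.

Definition BesselJ (mu z : C) : C :=
  Cpower (z / 2) mu *
  CSeries (fun k : nat =>
    (- (1)) ^ k * (z / 2) ^ (2 * k) / INR (fact k) * rGamma (mu + INR k + 1)).

Definition BesselY_quotient (z mu : C) : C :=
  (BesselJ mu z * Ccos (mu * PI) - BesselJ (- mu) z) / Csin (mu * PI).

Definition BesselY (mu z : C) : C := limit_at_integers (BesselY_quotient z) mu.

(** ** The incomplete gamma function *)

Definition gamma_star (a w : C) : C :=
  Cexp (- w) * CSeries (fun k : nat => w ^ k * rGamma (a + INR k + 1)).

(* P(a, -icz) for c > 0. *)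
Definition P_mic (a : C) (c : R) (z : C) : C :=
  mic_power c z a * gamma_star a (- (Ci * c * z)).

(** ** The functions B and chi *)

Definition B_integrand (mu z : C) (theta : R) : C :=
  Cexp (- (Ci * z * cos theta)) *
  P_mic (frac mu) (1 + cos theta) z * Ccos (mu * theta).

Definition B (mu z : C) : C :=
  ipow mu / PI * Cint_0_pi (B_integrand mu z).

(* Gamma(j + mu - 1/2) / Gamma(j + 2 mu), for 1 <= j <= - nearest (Re mu).
   If mu = m + 1/2 with m an integer then m = nearest (Re mu), and m < 0 for
   these j: both Gamma functions have a pole and the ratio is the limit. *)
Definition Gamma_ratio (mu : C) (j : nat) : C :=
  let m := nearest (Re mu) in
  if Ceq_dec mu (IZR m + 1 / 2)
  then 2 * powerRZ (-1) (m + 1) *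
       Gamma (IZR (- Z.of_nat j - 2 * m)) / Gamma (IZR (- Z.of_nat j - m + 1))
  else Gamma (INR j + mu - 1 / 2) * rGamma (INR j + 2 * mu).

Definition chi (mu z : C) : C :=
  if Rle_dec (Re mu) (- (1 / 2)) then
    ipow mu / sqrt PI * Cexp (Ci * z) *
    sum_n_m (fun j : nat =>
        Gamma_ratio mu j / Gamma (INR j) * mic_power 2 z (INR j + mu - 1))
      1 (Z.to_nat (- nearest (Re mu)))
  else 0.

(** ** The terms of the representation of Y *)

Definition calY_quotient (z mu : C) : C :=
  (B mu z * Ccos (mu * PI) - B (- mu) z) / Csin (mu * PI).

Definition calY (mu z : C) : C := limit_at_integers (calY_quotient z) mu.

(* The single-integral form of calY. The second P has parameter [b mu], with b
   one of [fun mu => - frac mu] and [fun mu => frac (- mu)]: these differ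
   exactly when Re mu is a half-integer. *)
Definition calY_integral (b : C -> C) (z mu : C) : C :=
  ipow mu / (PI * Csin (mu * PI)) *
  Cint_0_pi (fun theta : R =>
    Cexp (- (Ci * z * cos theta)) *
    (Ccos (mu * PI) * P_mic (frac mu) (1 + cos theta) z -
     Cexp (- (Ci * mu * PI)) * P_mic (b mu) (1 + cos theta) z) *
    Ccos (mu * theta)).

Definition S_coef (mu : C) : C :=
  if Rlt_dec (Re mu) 0 then Ccos (mu * PI) else - (1).

Definition chi_index (mu : C) : C := - (mu * sign (Re mu)).

Definition chi_term (z mu : C) : C :=
  S_coef mu * (chi (chi_index mu) z / Csin (mu * PI)).

(* Main.v *)
Require Import Defs.
From Stdlib Require Import Lia Psatz FunctionalExtensionality.

(** Expanding the incomplete gamma function in powers reduces B_mu to the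
    integrals Beta(s, mu) of (1 + cos t)^s cos (mu t) with s - mu an integer.
    Integration by parts gives a contiguity relation in mu, which evaluates
    them in terms of Beta(s, s); moreover 2^s Beta(s, s) is 1-periodic in s, and
    Laplace's method applied to Beta(s + p, s) / Beta(p, 0) shows that it is
    constantly pi. The resulting series for B_mu is Kummer's form
    e^(iz) (z/2)^mu (sum of (-iz/2)^l kummer_coef mu l) of J_mu, deprived of its
    first -<Re mu> terms when <Re mu> is negative; by the duplication formula
    these terms add up to chi_mu. Hence J_mu = B_mu + chi_mu for every mu, and
    the formula for Y_mu follows away from the integers. At an integer all the
    limits exist because J_mu and the terms of Kummer's series are complex
    differentiable in mu there and the numerators vanish. *)

(** * Limits of complex-valued functions along a filter *)

(** The parameter {mu} has Re {mu} > -1/2, which is what makes (1 + cos t)^{mu} integrable at t =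
    pi, where 1 + cos t behaves like (pi - t)^2/2. Since its exponents start at {mu} and not at mu,
    the term k of B_mu faces the term l = k - <Re mu> of Kummer's series; this shift of index is the
    whole origin of chi_mu. Contiguity alone leaves Beta(s, s) undetermined up to a 1-periodic
    factor, and only an asymptotic argument removes that freedom. Gamma enters through the entire
    function 1/Gamma, so that most identities hold at the poles without case distinctions; the
    exception is the quotient in chi at negative half-integers. B_mu is never differentiated in mu:
    its limits at integers are deduced from those of J_mu and of the finite sums, whose length is
    constant near an integer because <Re mu> is. As division by zero gives zero in [C], the
    identities between quotients by sin(mu pi) hold at every mu, so limits are taken of functions
    that agree everywhere. *)

Definition tends {T : Type} (F : (T -> Prop) -> Prop) (f : T -> C) (l : C) : Prop :=
  forall eps : R, 0 < eps -> F (fun x => Cmod (f x - l) < eps).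

(** [locally] on [C] comes from the product uniform structure, [tends] from the modulus; the
    equivalence of the two lets every estimate below be stated with [Cmod]. *)
Lemma tends_filterlim {T : Type} (F : (T -> Prop) -> Prop) {FF : Filter F}
    (f : T -> C) (l : C) : tends F f l <-> filterlim f F (locally l).
Proof.
split.
- intros H. apply (filterlim_locally_ball_norm (K := C_AbsRing) (U := C_NormedModule)).
  intros eps. apply H, cond_pos.
- intros H eps He.
  apply (proj1 (filterlim_locally_ball_norm (K := C_AbsRing) (U := C_NormedModule) f l) H (mkposreal eps He)).
Qed.

Lemma locally'_C (m : C) (P : C -> Prop) :
  locally' m P <->
  exists d : R, 0 < d /\ forall y : C, y <> m -> Cmod (y - m) < d -> P y.
Proof.
split.
- intros H.
  destruct (locally_norm_le_locally (K := C_AbsRing) (V := C_NormedModule) m _ H) as [d Hd].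
  exists d; split; [apply cond_pos|].
  intros y Hy Hm. apply Hd; assumption.
- intros [d [Hd H]].
  apply (locally_le_locally_norm (K := C_AbsRing) (V := C_NormedModule) m).
  exists (mkposreal d Hd). intros y Hy Hym. apply H; assumption.
Qed.

Lemma locally'_0_of (m : C) (P : C -> Prop) :
  locally' (RtoC 0) (fun e => P (m + e)) <-> locally' m P.
Proof.
rewrite !locally'_C. split; intros [d [Hd H]]; exists d; split; try assumption.
- intros y Hy Hym. replace y with (m + (y - m)) by ring. apply H.
  + intros E. apply Hy. replace y with (m + (y - m)) by ring. rewrite E; ring.
  + replace (y - m - 0) with (y - m) by ring. assumption.
- intros y Hy Hy0. apply H.
  + intros E. apply Hy. replace y with (m + y - m) by ring. rewrite E; ring.
  + replace (m + y - m) with (y - 0) by ring. assumption.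
Qed.

#[export] Instance locally'_C_proper (m : C) : ProperFilter (locally' m).
Proof.
constructor.
- intros P [d [Hd H]]%locally'_C.
  exists (m + (d / 2)%R). apply H.
  + intros E. assert (E' : (RtoC (d / 2)) = 0).
    { replace (RtoC (d/2)) with (m + (d / 2)%R - m) by ring. rewrite E; ring. }
    apply RtoC_inj in E'. lra.
  + replace (m + (d / 2)%R - m) with (RtoC (d / 2)) by ring.
    rewrite Cmod_R, Rabs_pos_eq; lra.
- constructor.
  + apply locally'_C. exists 1%R. split; [lra|auto].
  + intros P Q [d [Hd H]]%locally'_C [d' [Hd' H']]%locally'_C.
    apply locally'_C. exists (Rmin d d').
    split; [apply Rmin_pos; assumption|].
    intros y Hy Hm. split; [apply H|apply H']; try assumption.
    * apply Rlt_le_trans with (1 := Hm), Rmin_l.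
    * apply Rlt_le_trans with (1 := Hm), Rmin_r.
  + intros P Q HPQ [d [Hd H]]%locally'_C. apply locally'_C. exists d; split; auto.
Qed.

Section Tends.

Context {T : Type} {F : (T -> Prop) -> Prop} {FF : Filter F}.

Lemma tends_ext_loc (f g : T -> C) (l : C) :
  F (fun x => f x = g x) -> tends F f l -> tends F g l.
Proof.
intros H Hf eps He.
generalize (filter_and _ _ H (Hf eps He)). apply filter_imp.
intros x [E Hx]. rewrite <- E. assumption.
Qed.

Lemma tends_ext (f g : T -> C) (l : C) :
  (forall x, f x = g x) -> tends F f l -> tends F g l.
Proof. intros H. apply tends_ext_loc, filter_forall, H. Qed.

Lemma tends_eq (f : T -> C) (l l' : C) : l = l' -> tends F f l -> tends F f l'.
Proof. intros ->. auto. Qed.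

Lemma tends_const (l : C) : tends F (fun _ => l) l.
Proof.
intros eps He. apply filter_forall. intros _.
replace (l - l) with (RtoC 0) by ring. rewrite Cmod_0; assumption.
Qed.

Lemma tends_plus (f g : T -> C) (l k : C) :
  tends F f l -> tends F g k -> tends F (fun x => f x + g x) (l + k).
Proof.
intros Hf Hg eps He.
assert (He2 : 0 < eps / 2) by lra.
generalize (filter_and _ _ (Hf _ He2) (Hg _ He2)). apply filter_imp.
intros x [H1 H2].
replace (f x + g x - (l + k)) with ((f x - l) + (g x - k)) by ring.
eapply Rle_lt_trans; [apply Cmod_triangle|lra].
Qed.

Lemma tends_scal (c : C) (f : T -> C) (l : C) :
  tends F f l -> tends F (fun x => c * f x) (c * l).
Proof.
intros Hf eps He.
assert (Hc : 0 < Cmod c + 1) by (generalize (Cmod_ge_0 c); lra).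
assert (He2 : 0 < eps / (Cmod c + 1)) by (apply Rdiv_lt_0_compat; lra).
generalize (Hf _ He2). apply filter_imp. intros x Hx.
replace (c * f x - c * l) with (c * (f x - l)) by ring.
rewrite Cmod_mult.
apply Rle_lt_trans with ((Cmod c + 1) * Cmod (f x - l))%R.
- apply Rmult_le_compat_r; [apply Cmod_ge_0|lra].
- apply Rmult_lt_compat_l with (1 := Hc) in Hx.
  replace ((Cmod c + 1) * (eps / (Cmod c + 1)))%R with eps in Hx by (field; lra).
  assumption.
Qed.

Lemma tends_opp (f : T -> C) (l : C) : tends F f l -> tends F (fun x => - f x) (- l).
Proof.
intros H. replace (- l) with (- (1) * l) by ring.
apply tends_ext with (fun x => - (1) * f x); [intros x; ring|].
apply tends_scal, H.
Qed.

Lemma tends_minus (f g : T -> C) (l k : C) :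
  tends F f l -> tends F g k -> tends F (fun x => f x - g x) (l - k).
Proof. intros Hf Hg. apply tends_plus; [assumption|apply tends_opp, Hg]. Qed.

Lemma tends_0_of_bound (f : T -> C) (g : T -> C) (M : R) :
  F (fun x => Cmod (f x) <= M) -> tends F g 0 -> tends F (fun x => f x * g x) 0.
Proof.
intros Hf Hg eps He.
assert (He2 : 0 < eps / (Rabs M + 1)).
{ apply Rdiv_lt_0_compat; [lra|generalize (Rabs_pos M); lra]. }
generalize (filter_and _ _ Hf (Hg _ He2)). apply filter_imp.
intros x [H1 H2].
replace (f x * g x - 0) with (f x * (g x - 0)) by ring. rewrite Cmod_mult.
assert (HM := Rle_abs M). assert (HM0 := Rabs_pos M).
apply Rle_lt_trans with ((Rabs M + 1) * Cmod (g x - 0))%R.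
- apply Rmult_le_compat_r; [apply Cmod_ge_0|lra].
- apply Rmult_lt_compat_l with (r := (Rabs M + 1)%R) in H2; [|lra].
  replace ((Rabs M + 1) * (eps / (Rabs M + 1)))%R with eps in H2 by (field; lra).
  assumption.
Qed.

Lemma tends_Cmod_near (f : T -> C) (l : C) :
  tends F f l -> F (fun x => Cmod (f x) <= Cmod l + 1).
Proof.
intros H. generalize (H 1%R Rlt_0_1). apply filter_imp. intros x Hx.
replace (f x) with (l + (f x - l)) by ring.
eapply Rle_trans; [apply Cmod_triangle|lra].
Qed.

Lemma tends_mult (f g : T -> C) (l k : C) :
  tends F f l -> tends F g k -> tends F (fun x => f x * g x) (l * k).
Proof.
intros Hf Hg.
apply tends_ext with (fun x => f x * (g x - k) + k * f x); [intros x; ring|].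
replace (l * k) with (0 + k * l) by ring.
apply tends_plus; [|apply tends_scal, Hf].
apply tends_0_of_bound with (Cmod l + 1)%R; [apply tends_Cmod_near, Hf|].
replace (RtoC 0) with (k - k) by ring.
apply tends_minus; [assumption|apply tends_const].
Qed.

Lemma tends_inv (f : T -> C) (l : C) :
  l <> 0 -> tends F f l -> tends F (fun x => / f x) (/ l).
Proof.
intros Hl Hf.
assert (Hl0 : 0 < Cmod l) by (apply Cmod_gt_0, Hl).
assert (Hnear : F (fun x => Cmod l / 2 <= Cmod (f x))).
{ assert (He : 0 < Cmod l / 2) by lra.
  generalize (Hf _ He). apply filter_imp. intros x Hx.
  assert (H := Cmod_triangle (f x) (- (f x - l))).
  replace (f x + - (f x - l)) with l in H by ring.
  rewrite Cmod_opp in H. lra. }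
replace (/ l) with (/ l + 0) by ring.
apply tends_ext_loc with (fun x => / l + (- (/ l) * / f x) * (f x - l)).
{ generalize Hnear. apply filter_imp. intros x Hx.
  assert (f x <> 0) by (intros E; rewrite E, Cmod_0 in Hx; lra).
  field. split; assumption. }
apply tends_plus; [apply tends_const|].
apply tends_0_of_bound with (/ Cmod l * (2 / Cmod l))%R.
- generalize Hnear. apply filter_imp. intros x Hx.
  assert (f x <> 0) by (intros E; rewrite E, Cmod_0 in Hx; lra).
  rewrite Cmod_mult, Cmod_opp, !Cmod_inv by assumption.
  apply Rmult_le_compat_l; [left; apply Rinv_0_lt_compat; lra|].
  replace (2 / Cmod l)%R with (/ (Cmod l / 2))%R by (field; lra).
  apply Rinv_le_contravar; lra.
- replace (RtoC 0) with (l - l) by ring.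
  apply tends_minus; [assumption|apply tends_const].
Qed.

Lemma tends_le (f : T -> C) (l : C) (h : T -> R) :
  F (fun x => Cmod (f x - l) <= h x) -> tends F (fun x => RtoC (h x)) 0 -> tends F f l.
Proof.
intros H Hh eps He.
generalize (filter_and _ _ H (Hh eps He)). apply filter_imp. intros x [H1 H2].
replace (RtoC (h x) - 0) with (RtoC (h x)) in H2 by ring. rewrite Cmod_R in H2.
generalize (Rle_abs (h x)); lra.
Qed.

Lemma tends_unique {PF : ProperFilter F} (f : T -> C) (l k : C) :
  tends F f l -> tends F f k -> l = k.
Proof.
intros Hl Hk.
destruct (Ceq_dec l k) as [E|N]; [assumption|exfalso].
assert (H0 : 0 < Cmod (l - k)).
{ apply Cmod_gt_0. intros E. apply N. replace l with (l - k + k) by ring. rewrite E; ring. }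
assert (He : 0 < Cmod (l - k) / 2) by lra.
destruct (filter_ex _ (filter_and _ _ (Hl _ He) (Hk _ He))) as [x [H1 H2]].
replace (l - k) with (- (f x - l) + (f x - k)) in H1, H2, H0 by ring.
assert (H := Cmod_triangle (- (f x - l)) (f x - k)). rewrite Cmod_opp in H. lra.
Qed.

Lemma Clim_eq {PF : ProperFilter F} (f : T -> C) (l : C) : tends F f l -> Clim F f = l.
Proof.
intros H. apply (iota_filterlim_locally (K := C_AbsRing) (V := C_CompleteNormedModule)).
apply tends_filterlim, H. typeclasses eauto.
Qed.

Lemma ex_Clim_tends (f : T -> C) : ex_Clim F f <-> exists l, tends F f l.
Proof.
split; intros [l Hl]; exists l; apply tends_filterlim; assumption.
Qed.

Lemma tends_Cmod_le {PF : ProperFilter F} (f : T -> C) (l : C) (M : R) :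
  F (fun x => Cmod (f x) <= M) -> tends F f l -> Cmod l <= M.
Proof.
intros H Hl. apply Rnot_lt_le. intros N.
assert (He : 0 < Cmod l - M) by lra.
destruct (filter_ex _ (filter_and _ _ H (Hl _ He))) as [x [H1 H2]].
assert (H3 := Cmod_triangle (f x) (- (f x - l))).
replace (f x + - (f x - l)) with l in H3 by ring. rewrite Cmod_opp in H3. lra.
Qed.

Lemma tends_cauchy {PF : ProperFilter F} (f : T -> C) :
  (forall eps : R, 0 < eps ->
     exists P, F P /\ forall x y, P x -> P y -> Cmod (f x - f y) < eps) ->
  exists l, tends F f l.
Proof.
intros H.
assert (E : exists l : C_CompleteNormedModule, filterlim f F (locally l)).
{ apply (filterlim_locally_cauchy (U := C_CompleteNormedModule)).
  intros eps. destruct (H eps (cond_pos eps)) as [P [HP HC]].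
  exists P. split; [assumption|]. intros u v Hu Hv.
  apply (norm_compat1 (K := C_AbsRing) (V := C_NormedModule)).
  apply HC; assumption. }
destruct E as [l Hl]. exists l. apply tends_filterlim; [typeclasses eauto|exact Hl].
Qed.

End Tends.

Lemma tends_comp {T U : Type} (F : (T -> Prop) -> Prop) (G : (U -> Prop) -> Prop)
    (g : T -> U) (f : U -> C) (l : C) :
  filterlim g F G -> tends G f l -> tends F (fun x => f (g x)) l.
Proof. intros H Hf eps He. apply (H _ (Hf eps He)). Qed.

Lemma eventually_incr (f : nat -> nat) :
  (forall n, (n <= f n)%nat) -> filterlim f eventually eventually.
Proof.
intros H P [N HN]. exists N. intros n Hn. apply HN. generalize (H n); lia.
Qed.

Lemma tends_RtoC {T : Type} (F : (T -> Prop) -> Prop) {FF : Filter F} (f : T -> R) (l : R) :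
  tends F (fun x => RtoC (f x)) l <-> filterlim f F (locally l).
Proof.
split.
- intros H. apply filterlim_locally. intros eps.
  generalize (H eps (cond_pos eps)). apply filter_imp. intros x Hx.
  rewrite <- RtoC_minus, Cmod_R in Hx. exact Hx.
- intros H eps He.
  generalize (proj1 (filterlim_locally f l) H (mkposreal eps He)).
  apply filter_imp. intros x Hx. rewrite <- RtoC_minus, Cmod_R. exact Hx.
Qed.

Lemma tends_Re {T : Type} (F : (T -> Prop) -> Prop) {FF : Filter F} (f : T -> C) (l : C) :
  tends F f l -> filterlim (fun x => Re (f x)) F (locally (Re l)).
Proof.
intros H. apply filterlim_locally. intros eps.
generalize (H eps (cond_pos eps)). apply filter_imp. intros x Hx.
assert (E := re_le_Cmod (f x - l)).
eapply Rle_lt_trans; [|apply Hx]. exact E.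
Qed.

(** * Complex series *)

(** The upper bound is excluded, unlike in [sum_n]: the empty sum is available and splitting at
    [n + m] causes no off-by-one. *)
Fixpoint psum (a : nat -> C) (n : nat) : C :=
  match n with O => 0 | S k => psum a k + a k end.

Fixpoint rsum (a : nat -> R) (n : nat) : R :=
  match n with O => 0%R | S k => (rsum a k + a k)%R end.

Definition csums (a : nat -> C) (l : C) : Prop := tends eventually (psum a) l.

Definition summable (M : nat -> R) : Prop := (forall k, 0 <= M k) /\ ex_series M.

Lemma sum_n_psum (a : nat -> C) (n : nat) : sum_n a n = psum a (S n).
Proof.
induction n as [|n IH].
- rewrite sum_O. simpl. ring.
- rewrite sum_Sn, IH. reflexivity.
Qed.

Lemma sum_n_rsum (a : nat -> R) (n : nat) : sum_n a n = rsum a (S n).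
Proof.
induction n as [|n IH].
- rewrite sum_O. simpl. ring.
- rewrite sum_Sn, IH. reflexivity.
Qed.

Lemma tends_S (f : nat -> C) (l : C) :
  tends eventually (fun n => f (S n)) l <-> tends eventually f l.
Proof.
split; intros H eps He; destruct (H eps He) as [N HN].
- exists (S N). intros [|n] Hn; [lia|]. apply HN. lia.
- exists N. intros n Hn. apply HN. lia.
Qed.

Lemma csums_CSeries (a : nat -> C) (l : C) : csums a l -> CSeries a = l.
Proof.
intros H. apply Clim_eq. apply tends_ext with (fun n => psum a (S n)).
- intros n. symmetry. apply sum_n_psum.
- apply tends_S, H.
Qed.

Lemma psum_ext (a b : nat -> C) (n : nat) :
  (forall k, (k < n)%nat -> a k = b k) -> psum a n = psum b n.
Proof.
intros H. induction n as [|n IH]; [reflexivity|]. simpl.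
rewrite IH, H; [reflexivity|lia|intros; apply H; lia].
Qed.

Lemma psum_plus (a b : nat -> C) (n : nat) :
  psum (fun k => a k + b k) n = psum a n + psum b n.
Proof. induction n as [|n IH]; simpl; [|rewrite IH]; ring. Qed.

Lemma psum_scal (c : C) (a : nat -> C) (n : nat) :
  psum (fun k => c * a k) n = c * psum a n.
Proof. induction n as [|n IH]; simpl; [|rewrite IH]; ring. Qed.

Lemma psum_0 (a : nat -> C) (n : nat) : (forall k, (k < n)%nat -> a k = 0) -> psum a n = 0.
Proof.
intros H. induction n as [|n IH]; [reflexivity|]. simpl.
rewrite IH, H; [ring|lia|intros; apply H; lia].
Qed.

Lemma psum_add (a : nat -> C) (n m : nat) :
  psum a (n + m) = psum a n + psum (fun k => a (n + k)%nat) m.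
Proof.
induction m as [|m IH]; simpl.
- rewrite Nat.add_0_r. ring.
- rewrite Nat.add_succ_r. simpl. rewrite IH. ring.
Qed.

Lemma csums_ext (a b : nat -> C) (l : C) : (forall k, a k = b k) -> csums a l -> csums b l.
Proof. intros H. apply tends_ext. intros n. apply psum_ext. intros k _; apply H. Qed.

Lemma csums_plus (a b : nat -> C) (l m : C) :
  csums a l -> csums b m -> csums (fun k => a k + b k) (l + m).
Proof.
intros Ha Hb. apply tends_ext with (fun n => psum a n + psum b n).
- intros n. symmetry. apply psum_plus.
- apply tends_plus; assumption.
Qed.

Lemma csums_scal (c : C) (a : nat -> C) (l : C) :
  csums a l -> csums (fun k => c * a k) (c * l).
Proof.
intros Ha. apply tends_ext with (fun n => c * psum a n).
- intros n. symmetry. apply psum_scal.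
- apply tends_scal; assumption.
Qed.

Lemma csums_unique (a : nat -> C) (l m : C) : csums a l -> csums a m -> l = m.
Proof. apply tends_unique. Qed.

Lemma csums_shift (a : nat -> C) (N : nat) (l : C) :
  csums (fun k => a (N + k)%nat) l <-> csums a (psum a N + l).
Proof.
split; intros H.
- assert (H' : tends eventually (fun n => psum a (N + n)) (psum a N + l)).
  { apply tends_ext with (fun n => psum a N + psum (fun k => a (N + k)%nat) n).
    - intros n. symmetry. apply psum_add.
    - apply tends_plus; [apply tends_const|exact H]. }
  intros eps He. destruct (H' eps He) as [N0 HN0].
  exists (N + N0)%nat. intros n Hn.
  replace n with (N + (n - N))%nat by lia. apply HN0. lia.
- unfold csums. apply tends_ext with (fun n => psum a (N + n) - psum a N).
  { intros n. rewrite psum_add. ring. }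
  replace l with (psum a N + l - psum a N) by ring.
  apply tends_minus; [|apply tends_const].
  apply (tends_comp eventually eventually (fun n => (N + n)%nat)); [|exact H].
  apply eventually_incr. intros; lia.
Qed.

Lemma im_le_Cmod (c : C) : Rabs (Im c) <= Cmod c.
Proof. apply Rle_trans with (2 := Rmax_Cmod c), Rmax_r. Qed.

(** Reduces complex series to pairs of real ones, where the Cauchy product of absolutely convergent
    series and the real exponential series are available. *)
Lemma csums_parts (a : nat -> C) (l : C) :
  csums a l <-> is_series (fun k => Re (a k)) (Re l) /\ is_series (fun k => Im (a k)) (Im l).
Proof.
assert (ER : forall n, sum_n (fun k => Re (a k)) n = Re (psum a (S n))).
{ intros n. rewrite sum_n_rsum. generalize (S n). clear n.
  induction n as [|n IH]; simpl; [reflexivity|]. rewrite IH. reflexivity. }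
assert (EI : forall n, sum_n (fun k => Im (a k)) n = Im (psum a (S n))).
{ intros n. rewrite sum_n_rsum. generalize (S n). clear n.
  induction n as [|n IH]; simpl; [reflexivity|]. rewrite IH. reflexivity. }
unfold csums. rewrite <- tends_S. split.
- intros H. split; apply filterlim_locally; intros eps;
  generalize (H eps (cond_pos eps)); apply filter_imp; intros n Hn.
  + rewrite ER. eapply Rle_lt_trans; [|exact Hn]. apply (re_le_Cmod (psum a (S n) - l)).
  + rewrite EI. eapply Rle_lt_trans; [|exact Hn]. apply (im_le_Cmod (psum a (S n) - l)).
- intros [HR HI].
  apply tends_ext with (fun n => RtoC (Re (psum a (S n))) + Ci * RtoC (Im (psum a (S n)))).
  { intros n. destruct (psum a (S n)) as [u v]. unfold Ci, RtoC, Cplus, Cmult. simpl.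
    f_equal; ring. }
  replace l with (RtoC (Re l) + Ci * RtoC (Im l)).
  2: { destruct l as [u v]. unfold Ci, RtoC, Cplus, Cmult. simpl. f_equal; ring. }
  apply tends_plus; [|apply tends_scal]; apply tends_RtoC; try typeclasses eauto.
  + eapply filterlim_ext; [|exact HR]. exact ER.
  + eapply filterlim_ext; [|exact HI]. exact EI.
Qed.

Lemma summable_le (M N : nat -> R) :
  (forall k, 0 <= M k <= N k) -> summable N -> summable M.
Proof.
intros H [H0 HN]. split; [intros k; apply H|].
apply (ex_series_le (K := R_AbsRing) (V := R_CompleteNormedModule) M N); [|assumption].
intros n. destruct (H n). change (Rabs (M n) <= N n). rewrite Rabs_pos_eq; assumption.
Qed.

Lemma summable_scal (c : R) (M : nat -> R) :
  0 <= c -> summable M -> summable (fun k => c * M k)%R.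
Proof.
intros Hc [H0 H]. split.
- intros k. apply Rmult_le_pos; auto.
- apply (ex_series_scal (K := R_AbsRing) (V := R_NormedModule) c M H).
Qed.

Lemma summable_exp (A : R) : 0 <= A -> summable (fun k => A ^ k / INR (fact k))%R.
Proof.
intros HA. split.
- intros k. apply Rmult_le_pos; [apply pow_le, HA|].
  left. apply Rinv_0_lt_compat, INR_fact_lt_0.
- exists (exp A). apply is_series_ext with (2 := is_exp_Reals A).
  intros n. rewrite pow_n_pow. reflexivity.
Qed.

Lemma rsum_mono (M : nat -> R) (n m : nat) :
  (forall k, 0 <= M k) -> (n <= m)%nat -> rsum M n <= rsum M m.
Proof.
intros H Hnm. induction Hnm; [lra|]. simpl. generalize (H m); lra.
Qed.

Lemma rsum_le_series (M : nat -> R) (l : R) (n : nat) :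
  (forall k, 0 <= M k) -> is_series M l -> rsum M n <= l.
Proof.
intros H0 Hl. apply Rnot_lt_le. intros N.
assert (He : 0 < rsum M n - l) by lra.
destruct (proj1 (filterlim_locally _ _) Hl (mkposreal _ He)) as [N0 HN0].
specialize (HN0 (n + N0)%nat ltac:(lia)). rewrite sum_n_rsum in HN0.
assert (Hm := rsum_mono M n (S (n + N0)) H0 ltac:(lia)).
change (Rabs (rsum M (S (n + N0)) - l) < rsum M n - l) in HN0.
apply Rabs_def2 in HN0. lra.
Qed.

Lemma summable_bounded (M : nat -> R) :
  summable M -> exists B, 0 <= B /\ forall n, rsum M n <= B.
Proof.
intros [H0 [l Hl]]. exists l.
assert (H : forall n, rsum M n <= l) by (intros n; apply rsum_le_series; assumption).
split; [|assumption]. apply (H 0%nat).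
Qed.

Lemma summable_tail (M : nat -> R) :
  summable M -> forall eps, 0 < eps ->
  exists N, forall n m, (N <= n)%nat -> (n <= m)%nat -> rsum M m - rsum M n < eps.
Proof.
intros [H0 [l Hl]] eps He.
assert (He2 : 0 < eps / 2) by lra.
destruct (proj1 (filterlim_locally _ _) Hl (mkposreal _ He2)) as [N HN].
exists (S N). intros [|n] [|m] Hn Hm; try lia.
assert (H1 := HN n ltac:(lia)). assert (H2 := HN m ltac:(lia)).
rewrite sum_n_rsum in H1, H2.
change (Rabs (rsum M (S n) - l) < eps / 2) in H1.
change (Rabs (rsum M (S m) - l) < eps / 2) in H2.
apply Rabs_def2 in H1. apply Rabs_def2 in H2. lra.
Qed.

Lemma Cmod_psum_diff (a : nat -> C) (M : nat -> R) (n m : nat) :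
  (forall k, Cmod (a k) <= M k) -> (n <= m)%nat ->
  Cmod (psum a m - psum a n) <= rsum M m - rsum M n.
Proof.
intros H Hnm. induction Hnm.
- replace (psum a n - psum a n) with (RtoC 0) by ring. rewrite Cmod_0; lra.
- simpl. replace (psum a m + a m - psum a n) with ((psum a m - psum a n) + a m) by ring.
  eapply Rle_trans; [apply Cmod_triangle|]. generalize (H m); lra.
Qed.

Lemma Cmod_psum (a : nat -> C) (M : nat -> R) (n : nat) :
  (forall k, Cmod (a k) <= M k) -> Cmod (psum a n) <= rsum M n.
Proof.
intros H. assert (E := Cmod_psum_diff a M 0 n H ltac:(lia)). simpl in E.
replace (psum a n - 0) with (psum a n) in E by ring. lra.
Qed.

Lemma csums_ex (a : nat -> C) (M : nat -> R) :
  (forall k, Cmod (a k) <= M k) -> summable M -> exists l, csums a l.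
Proof.
intros H HM. apply tends_cauchy. intros eps He.
destruct (summable_tail M HM (eps / 2)%R ltac:(lra)) as [N HN].
exists (fun n => (N <= n)%nat). split; [exists N; auto|].
intros n m Hn Hm.
replace (psum a n - psum a m) with ((psum a n - psum a N) + - (psum a m - psum a N)) by ring.
eapply Rle_lt_trans; [apply Cmod_triangle|]. rewrite Cmod_opp.
assert (H1 := Cmod_psum_diff a M N n H Hn). assert (H2 := Cmod_psum_diff a M N m H Hm).
generalize (HN N n ltac:(lia) Hn) (HN N m ltac:(lia) Hm). lra.
Qed.

Lemma csums_tail_le (a : nat -> C) (M : nat -> R) (l : C) (N : nat) (t : R) :
  (forall k, Cmod (a k) <= M k) ->
  (forall n, (N <= n)%nat -> rsum M n - rsum M N <= t) ->
  csums a l -> Cmod (l - psum a N) <= t.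
Proof.
intros H Ht Hl.
apply (tends_Cmod_le (F := eventually) (fun n => psum a n - psum a N)).
- exists N. intros n Hn. eapply Rle_trans; [apply Cmod_psum_diff; eassumption|auto].
- apply tends_minus; [exact Hl|apply tends_const].
Qed.

Lemma csums_Cmod_le (a : nat -> C) (M : nat -> R) (l : C) (t : R) :
  (forall k, Cmod (a k) <= M k) -> (forall n, rsum M n <= t) -> csums a l -> Cmod l <= t.
Proof.
intros H Ht Hl. replace l with (l - psum a 0) by (simpl; ring).
apply csums_tail_le with M; try assumption.
intros n _. simpl. generalize (Ht n); lra.
Qed.

Lemma tends_psum {T : Type} (F : (T -> Prop) -> Prop) {FF : Filter F}
    (a : T -> nat -> C) (A : nat -> C) (n : nat) :
  (forall k, tends F (fun x => a x k) (A k)) ->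
  tends F (fun x => psum (a x) n) (psum A n).
Proof.
intros H. induction n as [|n IH]; simpl.
- apply tends_const.
- apply tends_plus; auto.
Qed.

(** Dominated convergence for series: the common majorant makes both tails beyond N at most eps/4,
    and the N leading terms converge by finiteness. It serves twice, for an integration bound
    tending to pi and for an order tending to an integer. *)
Lemma tannery {T : Type} (F : (T -> Prop) -> Prop) {FF : Filter F}
    (a : T -> nat -> C) (s : T -> C) (A : nat -> C) (L : C) (M : nat -> R) :
  summable M ->
  F (fun x => (forall k, Cmod (a x k) <= M k) /\ csums (a x) (s x)) ->
  (forall k, Cmod (A k) <= M k) ->
  (forall k, tends F (fun x => a x k) (A k)) ->
  csums A L -> tends F s L.
Proof.
intros HM Ha HA Hk HL eps He.
destruct (summable_tail M HM (eps / 4)%R ltac:(lra)) as [N HN].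
assert (HN' : forall n, (N <= n)%nat -> rsum M n - rsum M N <= eps / 4).
{ intros n Hn. left. apply HN; auto. }
generalize (filter_and _ _ Ha (tends_psum F a A N Hk (eps / 2)%R ltac:(lra))).
apply filter_imp. intros x [[Hx Hs] Hd].
assert (H1 := csums_tail_le _ _ _ _ _ Hx HN' Hs).
assert (H2 := csums_tail_le _ _ _ _ _ HA HN' HL).
replace (s x - L) with ((s x - psum (a x) N) + ((psum (a x) N - psum A N) + - (L - psum A N))) by ring.
eapply Rle_lt_trans; [apply Cmod_triangle|].
eapply Rle_lt_trans; [apply Rplus_le_compat_l, Cmod_triangle|].
rewrite Cmod_opp. lra.
Qed.

Lemma Re_psum (a : nat -> C) (n : nat) : Re (psum a n) = rsum (fun k => Re (a k)) n.
Proof. induction n as [|n IH]; simpl; [reflexivity|]. rewrite <- IH. reflexivity. Qed.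

Lemma Im_psum (a : nat -> C) (n : nat) : Im (psum a n) = rsum (fun k => Im (a k)) n.
Proof. induction n as [|n IH]; simpl; [reflexivity|]. rewrite <- IH. reflexivity. Qed.

Lemma rsum_sum_f_R0 (a : nat -> R) (n : nat) : rsum a (S n) = sum_f_R0 a n.
Proof. induction n as [|n IH]; [simpl; ring|]. simpl in *. rewrite IH. reflexivity. Qed.

Lemma csums_mult (a b : nat -> C) (la lb : C) (M N : nat -> R) :
  (forall k, Cmod (a k) <= M k) -> summable M ->
  (forall k, Cmod (b k) <= N k) -> summable N ->
  csums a la -> csums b lb ->
  csums (fun n => psum (fun k => a k * b (n - k)%nat) (S n)) (la * lb).
Proof.
intros Ha HM Hb HN [RA IA]%csums_parts [RB IB]%csums_parts.
assert (X : forall (c : nat -> R) K, (forall k, Rabs (c k) <= K k) -> summable K ->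
  ex_series (fun n => Rabs (c n))).
{ intros c K Hc HK. apply (summable_le _ K); [|assumption].
  intros k. split; [apply Rabs_pos|apply Hc]. }
assert (XRA := X (fun k => Re (a k)) M ltac:(intros k; eapply Rle_trans; [apply re_le_Cmod|apply Ha]) HM).
assert (XIA := X (fun k => Im (a k)) M ltac:(intros k; eapply Rle_trans; [apply im_le_Cmod|apply Ha]) HM).
assert (XRB := X (fun k => Re (b k)) N ltac:(intros k; eapply Rle_trans; [apply re_le_Cmod|apply Hb]) HN).
assert (XIB := X (fun k => Im (b k)) N ltac:(intros k; eapply Rle_trans; [apply im_le_Cmod|apply Hb]) HN).
assert (P1 := is_series_mult _ _ _ _ RA RB XRA XRB).
assert (P2 := is_series_mult _ _ _ _ IA IB XIA XIB).
assert (P3 := is_series_mult _ _ _ _ RA IB XRA XIB).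
assert (P4 := is_series_mult _ _ _ _ IA RB XIA XRB).
apply csums_parts. split.
- apply (is_series_minus (K := R_AbsRing) (V := R_NormedModule) _ _ _ _ P1) in P2.
  apply is_series_ext with (2 := P2). intros n.
  rewrite Re_psum, rsum_sum_f_R0.
  change (sum_f_R0 (fun k => Re (a k) * Re (b (n - k)%nat))%R n -
    sum_f_R0 (fun k => Im (a k) * Im (b (n - k)%nat))%R n =
    sum_f_R0 (fun k => Re (a k * b (n - k)%nat)) n)%R.
  rewrite <- minus_sum. apply sum_eq. intros i _. reflexivity.
- apply (is_series_plus (K := R_AbsRing) (V := R_NormedModule) _ _ _ _ P3) in P4.
  apply is_series_ext with (2 := P4). intros n.
  rewrite Im_psum, rsum_sum_f_R0.
  change (sum_f_R0 (fun k => Re (a k) * Im (b (n - k)%nat))%R n +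
    sum_f_R0 (fun k => Im (a k) * Re (b (n - k)%nat))%R n =
    sum_f_R0 (fun k => Im (a k * b (n - k)%nat)) n)%R.
  rewrite <- sum_plus. apply sum_eq. intros i _. reflexivity.
Qed.

(** * The complex exponential and logarithm *)

Lemma Cexp_plus (a b : C) : Cexp (a + b) = Cexp a * Cexp b.
Proof.
destruct a as [a1 a2], b as [b1 b2]. unfold Cexp. simpl.
rewrite exp_plus, cos_plus, sin_plus.
unfold Cmult, RtoC. simpl. f_equal; ring.
Qed.

Lemma Cexp_RtoC (x : R) : Cexp x = RtoC (exp x).
Proof.
unfold Cexp. simpl. rewrite cos_0, sin_0. unfold Cmult, RtoC. simpl. f_equal; ring.
Qed.

Lemma Cexp_0 : Cexp 0 = 1.
Proof. rewrite Cexp_RtoC, exp_0. reflexivity. Qed.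

Lemma Cmod_Cexp (z : C) : Cmod (Cexp z) = exp (Re z).
Proof.
unfold Cexp. rewrite Cmod_mult, Cmod_R, Rabs_pos_eq by (left; apply exp_pos).
unfold Cmod. simpl.
replace (cos (Im z) * (cos (Im z) * 1) + sin (Im z) * (sin (Im z) * 1))%R with 1%R.
- rewrite sqrt_1. ring.
- generalize (sin2_cos2 (Im z)). unfold Rsqr. lra.
Qed.

Lemma Cexp_neq_0 (z : C) : Cexp z <> 0.
Proof.
intros E. assert (H := Cmod_Cexp z). rewrite E, Cmod_0 in H.
generalize (exp_pos (Re z)). lra.
Qed.

Lemma Cexp_opp (z : C) : Cexp (- z) = / Cexp z.
Proof.
assert (H := Cexp_neq_0 z).
replace (Cexp (- z)) with (Cexp (z + - z) / Cexp z).
- replace (z + - z) with (RtoC 0) by ring. rewrite Cexp_0. field; assumption.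
- rewrite Cexp_plus. field; assumption.
Qed.

Lemma Cexp_minus (a b : C) : Cexp (a - b) = Cexp a / Cexp b.
Proof. unfold Cminus. rewrite Cexp_plus, Cexp_opp. reflexivity. Qed.

Lemma Cexp_pow (n : nat) (w : C) : Cexp (INR n * w) = Cexp w ^ n.
Proof.
induction n as [|n IH].
- simpl. replace (0 * w) with (RtoC 0) by ring. apply Cexp_0.
- rewrite S_INR, RtoC_plus, Cpow_S, <- IH, <- Cexp_plus. f_equal; ring.
Qed.

Lemma RtoC_INR_neq_0 (n : nat) : n <> 0%nat -> RtoC (INR n) <> 0.
Proof. intros H E. apply RtoC_inj in E. apply (not_0_INR n H E). Qed.

Lemma Cfact_neq_0 (n : nat) : RtoC (INR (fact n)) <> 0.
Proof. apply RtoC_INR_neq_0, fact_neq_0. Qed.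

Definition expterm (z : C) (k : nat) : C := z ^ k / INR (fact k).

Lemma Cmod_expterm (z : C) (k : nat) : Cmod (expterm z k) = (Cmod z ^ k / INR (fact k))%R.
Proof.
unfold expterm. rewrite Cmod_div by apply Cfact_neq_0.
rewrite Cmod_pow, Cmod_R, Rabs_pos_eq by apply pos_INR. reflexivity.
Qed.

Lemma expterm_RtoC (x : R) (k : nat) : expterm x k = RtoC (x ^ k / INR (fact k)).
Proof.
unfold expterm. rewrite RtoC_div, RtoC_pow by apply INR_fact_neq_0. reflexivity.
Qed.

Lemma csums_exp_real (x : R) : csums (expterm x) (Cexp x).
Proof.
rewrite Cexp_RtoC. apply csums_parts.
assert (H : is_series (fun k => x ^ k / INR (fact k))%R (exp x)).
{ apply is_series_ext with (2 := is_exp_Reals x).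
  intros n. rewrite pow_n_pow. reflexivity. }
split.
- apply is_series_ext with (2 := H). intros n. rewrite expterm_RtoC. reflexivity.
- apply is_series_ext with (fun n : nat => 0%R).
  + intros n. rewrite expterm_RtoC. reflexivity.
  + apply filterlim_ext with (fun _ : nat => 0%R); [|apply filterlim_const].
    intros n. rewrite sum_n_const, Rmult_0_r. reflexivity.
Qed.

Lemma expterm_imag_pair (y : R) (i : nat) :
  expterm (Ci * y) (2 * i) + expterm (Ci * y) (S (2 * i))
  = RtoC (cos_n i * (Rsqr y) ^ i) + Ci * RtoC (y * (sin_n i * (Rsqr y) ^ i)).
Proof.
unfold expterm.
assert (E : (Ci * y) ^ (2 * i) = RtoC ((-1) ^ i * (Rsqr y) ^ i)).
{ rewrite Cpow_mult_r. replace ((Ci * y) ^ 2) with (RtoC (-1 * Rsqr y)).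
  - rewrite <- RtoC_pow. f_equal. rewrite Rpow_mult_distr. reflexivity.
  - simpl. unfold Ci, RtoC, Cmult, Rsqr. simpl. f_equal; ring. }
rewrite Cpow_S, E. unfold cos_n, sin_n.
replace (2 * i + 1)%nat with (S (2 * i)) by lia.
rewrite !RtoC_mult, !RtoC_div by apply INR_fact_neq_0. field.
split; apply Cfact_neq_0.
Qed.

Lemma psum_exp_imag (y : R) (n : nat) :
  psum (expterm (Ci * y)) (2 * n) =
  RtoC (rsum (fun i => cos_n i * (Rsqr y) ^ i)%R n) +
  Ci * RtoC (y * rsum (fun i => sin_n i * (Rsqr y) ^ i)%R n).
Proof.
induction n as [|n IH].
- simpl. rewrite Rmult_0_r. ring.
- replace (2 * S n)%nat with (S (S (2 * n))) by lia. cbn [psum rsum].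
  rewrite IH, Rmult_plus_distr_l, !RtoC_plus.
  assert (E := expterm_imag_pair y n). rewrite <- Cplus_assoc, E. ring.
Qed.

(* Absolute convergence is known, so the even partial sums determine the limit. *)
Lemma csums_exp_imag (y : R) : csums (expterm (Ci * y)) (Cexp (Ci * y)).
Proof.
destruct (csums_ex (expterm (Ci * y)) _ ltac:(intros k; right; apply Cmod_expterm)
  (summable_exp _ (Cmod_ge_0 (Ci * y)))) as [l Hl].
replace (Cexp (Ci * y)) with l; [exact Hl|].
assert (H1 : tends eventually (fun n => psum (expterm (Ci * y)) (2 * S n)) l).
{ apply (tends_comp eventually eventually (fun n => (2 * S n)%nat)); [|exact Hl].
  apply eventually_incr. intros; lia. }
apply (tends_unique (F := eventually) _ _ _ H1).
replace (Cexp (Ci * y)) with (RtoC (cos y) + Ci * RtoC (sin y)).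
2: { unfold Cexp, Ci, RtoC, Cmult, Cplus. simpl.
  replace (0 * y - 1 * 0)%R with 0%R by ring. replace (0 * 0 + 1 * y)%R with y by ring.
  rewrite exp_0. f_equal; ring. }
assert (Hc : filterlim (fun n => sum_f_R0 (fun i => cos_n i * (Rsqr y) ^ i)%R n) eventually (locally (cos y))).
{ unfold cos. destruct (exist_cos (Rsqr y)) as [a Ha]. simpl.
  apply is_lim_seq_Reals in Ha. exact Ha. }
assert (Hs : filterlim (fun n => y * sum_f_R0 (fun i => sin_n i * (Rsqr y) ^ i)%R n)%R eventually (locally (sin y))).
{ unfold sin. destruct (exist_sin (Rsqr y)) as [a Ha].
  apply (is_lim_seq_scal_l _ y a). apply is_lim_seq_Reals in Ha. exact Ha. }
apply tends_RtoC in Hc; [|typeclasses eauto]. apply tends_RtoC in Hs; [|typeclasses eauto].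
eapply tends_ext; [|exact (tends_plus _ _ _ _ Hc (tends_scal Ci _ _ Hs))].
intros n. rewrite psum_exp_imag, !rsum_sum_f_R0. reflexivity.
Qed.

Lemma expterm_S (a : C) (n : nat) : RtoC (INR (S n)) * expterm a (S n) = a * expterm a n.
Proof.
unfold expterm. rewrite fact_simpl, mult_INR, RtoC_mult, Cpow_S. field.
split; [apply Cfact_neq_0|apply RtoC_INR_neq_0; lia].
Qed.

(** * Cauchy products of coefficient sequences *)

Definition conv (a b : nat -> C) (n : nat) : C := psum (fun k => a k * b (n - k)%nat) (S n).

(* Formal differentiation of a Cauchy product, which turns identities between
   such products into recurrences. *)
Lemma conv_deriv (a b : nat -> C) (n : nat) :
  RtoC (INR (S n)) * conv a b (S n) =
  conv (fun k => RtoC (INR (S k)) * a (S k)) b n + conv a (fun k => RtoC (INR (S k)) * b (S k)) n.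
Proof.
unfold conv.
assert (E : RtoC (INR (S n)) * psum (fun k => a k * b (S n - k)%nat) (S (S n)) =
  psum (fun k => RtoC (INR k) * a k * b (S n - k)%nat) (S (S n)) +
  psum (fun k => a k * (RtoC (INR (S n - k)) * b (S n - k)%nat)) (S (S n))).
{ rewrite <- psum_plus, <- psum_scal. apply psum_ext. intros k Hk.
  replace (INR (S n)) with (INR k + INR (S n - k))%R.
  - rewrite RtoC_plus. ring.
  - rewrite <- plus_INR. f_equal. lia. }
rewrite E. f_equal.
- change (S (S n)) with (1 + S n)%nat. rewrite psum_add.
  simpl (psum _ 1). replace (RtoC (INR 0)) with (RtoC 0) by reflexivity.
  match goal with |- _ + ?X = ?Y => assert (X = Y) as -> end; [|ring].
  apply psum_ext. intros k Hk. reflexivity.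
- cbn [psum]. rewrite Nat.sub_diag. replace (RtoC (INR 0)) with (RtoC 0) by reflexivity.
  match goal with |- ?X + ?Y + _ = ?X' + ?Y' => assert (X = X') as -> end.
  + apply psum_ext. intros k Hk. replace (S n - k)%nat with (S (n - k)) by lia. reflexivity.
  + replace (S n - n)%nat with (S (n - n)) by lia. ring.
Qed.

Lemma conv_ext (a a' b b' : nat -> C) (n : nat) :
  (forall k, (k <= n)%nat -> a k = a' k) -> (forall k, (k <= n)%nat -> b k = b' k) ->
  conv a b n = conv a' b' n.
Proof.
intros Ha Hb. apply psum_ext. intros k Hk. rewrite Ha, Hb; [reflexivity|lia|lia].
Qed.

Lemma conv_scal_l (c : C) (a b : nat -> C) (n : nat) :
  conv (fun k => c * a k) b n = c * conv a b n.
Proof.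
unfold conv. rewrite <- psum_scal. apply psum_ext. intros k _. ring.
Qed.

Lemma conv_scal_r (c : C) (a b : nat -> C) (n : nat) :
  conv a (fun k => c * b k) n = c * conv a b n.
Proof.
unfold conv. rewrite <- psum_scal. apply psum_ext. intros k _. ring.
Qed.

(** The binomial theorem divided by n!. Both sides satisfy (n + 1) c(n+1) = (a + b) c(n), which
    avoids manipulating binomial coefficients. *)
Lemma conv_expterm (a b : C) (n : nat) :
  conv (expterm a) (expterm b) n = expterm (a + b) n.
Proof.
induction n as [|n IH].
- unfold conv, expterm. simpl. field.
- assert (HN : RtoC (INR (S n)) <> 0) by (apply RtoC_INR_neq_0; lia).
  assert (E : RtoC (INR (S n)) * conv (expterm a) (expterm b) (S n) =
    RtoC (INR (S n)) * expterm (a + b) (S n)).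
  { rewrite conv_deriv, expterm_S.
    rewrite (conv_ext _ (fun k => a * expterm a k) _ (expterm b)) by (intros; try apply expterm_S; reflexivity).
    rewrite (conv_ext (expterm a) (expterm a) _ (fun k => b * expterm b k)) by (intros; try apply expterm_S; reflexivity).
    rewrite conv_scal_l, conv_scal_r, IH. ring. }
  replace (conv (expterm a) (expterm b) (S n)) with
    (RtoC (INR (S n)) * conv (expterm a) (expterm b) (S n) / RtoC (INR (S n))) by (field; assumption).
  rewrite E. field. assumption.
Qed.

Lemma csums_exp (z : C) : csums (expterm z) (Cexp z).
Proof.
replace z with (RtoC (Re z) + Ci * RtoC (Im z)).
2: { destruct z as [u v]. unfold Ci, RtoC, Cplus, Cmult. simpl. f_equal; ring. }
rewrite Cexp_plus. apply csums_ext with (conv (expterm (Re z)) (expterm (Ci * Im z))).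
- intros k. apply conv_expterm.
- apply (csums_mult _ _ _ _ _ _ ltac:(intros k; right; apply Cmod_expterm)
    (summable_exp _ (Cmod_ge_0 _)) ltac:(intros k; right; apply Cmod_expterm)
    (summable_exp _ (Cmod_ge_0 _))).
  + apply csums_exp_real.
  + apply csums_exp_imag.
Qed.

Lemma rsum_exp_le (A : R) (n : nat) : 0 <= A -> rsum (fun k => A ^ k / INR (fact k))%R n <= exp A.
Proof.
intros HA. apply rsum_le_series; [apply (summable_exp A HA)|].
apply is_series_ext with (2 := is_exp_Reals A).
intros k. rewrite pow_n_pow. reflexivity.
Qed.

Lemma Cmod_Cexp_le (z : C) : Cmod (Cexp z) <= exp (Cmod z).
Proof.
rewrite Cmod_Cexp. assert (H : Re z <= Cmod z).
{ eapply Rle_trans; [apply Rle_abs|apply re_le_Cmod]. }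
destruct H as [H|H]; [left; apply exp_increasing, H|rewrite H; lra].
Qed.

Lemma exp_tail_le (j k : nat) (A : R) : 0 <= A ->
  A ^ (j + k) / INR (fact (j + k)) <= A ^ j * (A ^ k / INR (fact k)).
Proof.
intros HA. rewrite pow_add. unfold Rdiv. rewrite Rmult_assoc.
apply Rmult_le_compat_l; [apply pow_le, HA|].
apply Rmult_le_compat_l; [apply pow_le, HA|].
apply Rinv_le_contravar; [apply INR_fact_lt_0|].
apply le_INR, fact_le. lia.
Qed.

(** As (j + k)! is at least k!, the tail from j on is dominated by |z|^j times a full exponential
    series. *)
Lemma Cexp_tail (j : nat) (z : C) :
  Cmod (Cexp z - psum (expterm z) j) <= Cmod z ^ j * exp (Cmod z).
Proof.
assert (H : csums (fun k => expterm z (j + k)) (Cexp z - psum (expterm z) j)).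
{ apply csums_shift.
  replace (psum (expterm z) j + (Cexp z - psum (expterm z) j)) with (Cexp z) by ring.
  apply csums_exp. }
apply (csums_Cmod_le _ (fun k => Cmod z ^ j * (Cmod z ^ k / INR (fact k)))%R) with (3 := H).
- intros k. rewrite Cmod_expterm. apply exp_tail_le, Cmod_ge_0.
- intros n. apply Rle_trans with (Cmod z ^ j * rsum (fun k => Cmod z ^ k / INR (fact k)) n)%R.
  + right. induction n as [|n IH]; simpl; [ring|]. rewrite IH. ring.
  + apply Rmult_le_compat_l; [apply pow_le, Cmod_ge_0|apply rsum_exp_le, Cmod_ge_0].
Qed.

Lemma Cexp_m1_bound (z : C) : Cmod (Cexp z - 1) <= Cmod z * exp (Cmod z).
Proof.
assert (H := Cexp_tail 1 z). simpl in H.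
replace (Cexp z - (0 + expterm z 0)) with (Cexp z - 1) in H.
- rewrite Rmult_1_r in H. exact H.
- unfold expterm. simpl. field.
Qed.

Lemma Cexp_m1_m_bound (z : C) : Cmod (Cexp z - 1 - z) <= Cmod z ^ 2 * exp (Cmod z).
Proof.
assert (H := Cexp_tail 2 z). cbn [psum] in H.
replace (Cexp z - (0 + expterm z 0 + expterm z 1)) with (Cexp z - 1 - z) in H.
- exact H.
- unfold expterm. simpl. field.
Qed.

Lemma Ccos_opp (w : C) : Ccos (- w) = Ccos w.
Proof.
unfold Ccos. replace (Ci * - w) with (- (Ci * w)) by ring.
replace (- - (Ci * w)) with (Ci * w) by ring. unfold Cdiv. ring.
Qed.

Lemma Cmod_Ci_mult (w : C) : Cmod (Ci * w) = Cmod w.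
Proof.
rewrite Cmod_mult. replace (Cmod Ci) with 1%R; [ring|].
unfold Cmod, Ci. simpl. replace (0 * (0 * 1) + 1 * (1 * 1))%R with 1%R by ring.
rewrite sqrt_1. reflexivity.
Qed.

Lemma C2_neq_0 : RtoC 2 <> 0.
Proof. intros E. apply RtoC_inj in E. lra. Qed.

Lemma Cmod_half (a b : C) (M : R) : Cmod a <= M -> Cmod b <= M -> Cmod ((a + b) / 2) <= M.
Proof.
intros Ha Hb. rewrite Cmod_div by apply C2_neq_0.
rewrite Cmod_R, Rabs_pos_eq by lra.
assert (H := Cmod_triangle a b). lra.
Qed.

Lemma Cmod_Ccos_le (w : C) : Cmod (Ccos w) <= exp (Cmod w).
Proof.
apply Cmod_half; eapply Rle_trans; try apply Cmod_Cexp_le;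
rewrite ?Cmod_opp, Cmod_Ci_mult; lra.
Qed.

Lemma Ccos_m1_bound (w : C) : Cmod (Ccos w - 1) <= Cmod w ^ 2 * exp (Cmod w).
Proof.
replace (Ccos w - 1) with (((Cexp (Ci * w) - 1 - Ci * w) + (Cexp (- (Ci * w)) - 1 - - (Ci * w))) / 2).
2: { unfold Ccos. field. }
apply Cmod_half; eapply Rle_trans; try apply Cexp_m1_m_bound;
rewrite ?Cmod_opp, Cmod_Ci_mult; lra.
Qed.

(** The sine of the [acos] is |Im z|/|z|; the case distinction in [Carg] restores the sign of Im
    z. *)
Lemma cos_sin_Carg (z : C) : z <> 0 ->
  (cos (Carg z), sin (Carg z)) = (Re z / Cmod z, Im z / Cmod z)%R.
Proof.
intros Hz. assert (H0 : 0 < Cmod z) by (apply Cmod_gt_0, Hz).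
assert (Hn : Cmod z <> 0%R) by lra.
assert (HR := re_le_Cmod z). apply Rabs_le_between in HR.
assert (Hb : -1 <= Re z / Cmod z <= 1).
{ split; apply Rmult_le_reg_r with (Cmod z); try assumption;
  replace (Re z / Cmod z * Cmod z)%R with (Re z) by (field; exact Hn); lra. }
assert (E2 : (Cmod z ^ 2 = Re z ^ 2 + Im z ^ 2)%R) by apply Cmod2_alt.
assert (Hs : sqrt (1 - (Re z / Cmod z)²) = (Rabs (Im z) / Cmod z)%R).
{ apply sqrt_lem_1.
  - unfold Rsqr. set (t := (Re z / Cmod z)%R) in *.
    replace (1 - t * t)%R with ((1 - t) * (1 + t))%R by ring. apply Rmult_le_pos; lra.
  - apply Rmult_le_pos; [apply Rabs_pos|left; apply Rinv_0_lt_compat, H0].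
  - unfold Rsqr. replace (Rabs (Im z) / Cmod z * (Rabs (Im z) / Cmod z))%R
      with (Rabs (Im z) ^ 2 / Cmod z ^ 2)%R by (field; lra).
    rewrite pow2_abs. replace (Im z ^ 2)%R with (Cmod z ^ 2 - Re z ^ 2)%R by lra.
    field. lra. }
unfold Carg. destruct (Rle_dec 0 (Im z)) as [H|H].
- rewrite cos_acos, sin_acos, Hs, Rabs_pos_eq by assumption. reflexivity.
- rewrite cos_neg, sin_neg, cos_acos, sin_acos, Hs, Rabs_left by lra.
  f_equal. field. lra.
Qed.

Lemma Cexp_Clog (z : C) : z <> 0 -> Cexp (Clog z) = z.
Proof.
intros Hz. assert (H0 : 0 < Cmod z) by (apply Cmod_gt_0, Hz).
assert (E := cos_sin_Carg z Hz).
unfold Cexp, Clog. simpl. rewrite E, exp_ln by assumption.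
destruct z as [u v]. unfold Cmult, RtoC. simpl in *. f_equal; field; lra.
Qed.

Lemma Clog_pos (x : R) : 0 < x -> Clog x = RtoC (ln x).
Proof.
intros Hx. unfold Clog, Carg. rewrite Cmod_R, Rabs_pos_eq by lra. simpl.
destruct (Rle_dec 0 0) as [_|H]; [|lra].
replace (x / x)%R with 1%R by (field; lra). rewrite acos_1. reflexivity.
Qed.

(** Division by a positive real changes neither Re z/|z| nor the sign of Im z, so both sides use the
    same branch of the argument and no multiple of 2 pi can appear. *)
Lemma Clog_div_pos (z : C) (x : R) : z <> 0 -> 0 < x -> Clog (z / x) = Clog z - RtoC (ln x).
Proof.
intros Hz Hx. assert (H0 : 0 < Cmod z) by (apply Cmod_gt_0, Hz).
assert (Hx' : RtoC x <> 0) by (intros E; apply RtoC_inj in E; lra).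
assert (Ez : z / x = (Re z / x, Im z / x)%R).
{ destruct z as [u v]. unfold Cdiv, Cinv, RtoC, Cmult. simpl. f_equal; field; lra. }
assert (Em : Cmod (z / x) = (Cmod z / x)%R).
{ rewrite Cmod_div by assumption. rewrite Cmod_R, Rabs_pos_eq by lra. reflexivity. }
unfold Clog, Carg. rewrite Em, Ez. simpl.
replace (Re z / x / (Cmod z / x))%R with (Re z / Cmod z)%R by (field; lra).
rewrite ln_div by assumption.
assert (Hi : 0 <= Im z <-> 0 <= Im z / x).
{ split; intros H.
  - apply Rmult_le_pos; [assumption|left; apply Rinv_0_lt_compat, Hx].
  - replace (Im z) with (Im z / x * x)%R by (field; lra). apply Rmult_le_pos; lra. }
unfold Cminus, Cplus, Copp, RtoC. simpl.
destruct (Rle_dec 0 (Im z)), (Rle_dec 0 (Im z / x)); try tauto; f_equal; ring.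
Qed.

(** * The reciprocal Gamma function *)

Lemma Cmult_integral (a b : C) : a * b = 0 -> a = 0 \/ b = 0.
Proof.
intros E. destruct (Ceq_dec a 0) as [Ha|Ha]; [left; exact Ha|].
destruct (Ceq_dec b 0) as [Hb|Hb]; [right; exact Hb|].
destruct (Cmult_neq_0 a b Ha Hb E).
Qed.

(** * Infinite products *)

Fixpoint cprod (u : nat -> C) (n : nat) : C :=
  match n with O => 1 | S k => cprod u k * (1 + u k) end.

Lemma exp_ge_1p (x : R) : (1 + x)%R <= exp x.
Proof. apply exp_ineq1_le. Qed.

Lemma rsum_nonneg (U : nat -> R) (n : nat) : (forall k, 0 <= U k) -> 0 <= rsum U n.
Proof. intros H. apply (rsum_mono U 0 n H). lia. Qed.

Section Products.

Variables (u : nat -> C) (U : nat -> R).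
Hypothesis HU : forall k, Cmod (u k) <= U k.

(** Expanding the product, each u is replaced by its majorant; the induction closes through 1 + U <=
    e^U, which turns a product of majorants into the exponential of their sum. *)
Lemma Cmod_cprod_m1 (n : nat) : Cmod (cprod u n - 1) <= exp (rsum U n) - 1.
Proof.
induction n as [|n IH]; simpl.
- replace (1 - 1) with (RtoC 0) by ring. rewrite Cmod_0, exp_0; lra.
- replace (cprod u n * (1 + u n) - 1) with ((cprod u n - 1) + ((cprod u n - 1) * u n + u n)) by ring.
  eapply Rle_trans; [apply Cmod_triangle|].
  eapply Rle_trans; [apply Rplus_le_compat_l, Cmod_triangle|].
  rewrite Cmod_mult, exp_plus.
  assert (H1 := Cmod_ge_0 (cprod u n - 1)). assert (H2 := Cmod_ge_0 (u n)).
  assert (H3 := HU n). assert (H4 := exp_ge_1p (U n)). assert (H5 := exp_pos (rsum U n)).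
  assert (Cmod (cprod u n - 1) * Cmod (u n) <= (exp (rsum U n) - 1) * U n).
  { apply Rmult_le_compat; assumption. }
  nra.
Qed.

Lemma Cmod_cprod (n : nat) : Cmod (cprod u n) <= exp (rsum U n).
Proof.
replace (cprod u n) with ((cprod u n - 1) + 1) by ring.
eapply Rle_trans; [apply Cmod_triangle|]. rewrite Cmod_1.
generalize (Cmod_cprod_m1 n). lra.
Qed.

(** Second-order companion of [Cmod_cprod_m1]: it isolates the linear part of the product, from
    which the derivative of 1/Gamma at 1 is read. *)
Lemma Cmod_cprod_m1_m_sum (n : nat) :
  Cmod (cprod u n - 1 - psum u n) <= exp (rsum U n) - 1 - rsum U n.
Proof.
induction n as [|n IH]; simpl.
- replace (1 - 1 - 0) with (RtoC 0) by ring. rewrite Cmod_0, exp_0; lra.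
- replace (cprod u n * (1 + u n) - 1 - (psum u n + u n)) with
    ((cprod u n - 1 - psum u n) + (cprod u n - 1) * u n) by ring.
  eapply Rle_trans; [apply Cmod_triangle|]. rewrite Cmod_mult, exp_plus.
  assert (H1 := Cmod_ge_0 (cprod u n - 1)). assert (H2 := Cmod_ge_0 (u n)).
  assert (H3 := HU n). assert (H4 := exp_ge_1p (U n)). assert (H5 := exp_pos (rsum U n)).
  assert (H6 := Cmod_cprod_m1 n).
  assert (Cmod (cprod u n - 1) * Cmod (u n) <= (exp (rsum U n) - 1) * U n).
  { apply Rmult_le_compat; assumption. }
  nra.
Qed.

Lemma cprod_psum (n : nat) : cprod u n = 1 + psum (fun k => cprod u k * u k) n.
Proof. induction n as [|n IH]; simpl; [ring|].
remember (psum (fun k => cprod u k * u k) n) as P. rewrite IH. ring.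
Qed.

(** Telescoping turns the product into a series with terms [cprod u k * u k], dominated by a
    multiple of U. No logarithm is taken, so vanishing factors are allowed. *)
Lemma cprod_tends (HS : summable U) : exists L, tends eventually (cprod u) L.
Proof.
destruct (summable_bounded U HS) as [B [HB0 HB]].
destruct (csums_ex (fun k => cprod u k * u k) (fun k => exp B * U k)%R) as [l Hl].
- intros k. rewrite Cmod_mult. apply Rmult_le_compat; try apply Cmod_ge_0; [|apply HU].
  eapply Rle_trans; [apply Cmod_cprod|]. destruct (HB k) as [H|H].
  + left. apply exp_increasing, H.
  + rewrite H. lra.
- apply summable_scal; [left; apply exp_pos|assumption].
- exists (1 + l).
  apply tends_ext with (fun n => 1 + psum (fun k => cprod u k * u k) n).
  + intros n. symmetry. apply cprod_psum.
  + apply tends_plus; [apply tends_const|exact Hl].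
Qed.

End Products.

Lemma cprod_add (u : nat -> C) (n m : nat) :
  cprod u (n + m) = cprod u n * cprod (fun k => u (n + k)%nat) m.
Proof.
induction m as [|m IH]; simpl.
- rewrite Nat.add_0_r. ring.
- rewrite Nat.add_succ_r. simpl. rewrite IH. ring.
Qed.

Lemma rsum_add (a : nat -> R) (n m : nat) :
  rsum a (n + m) = (rsum a n + rsum (fun k => a (n + k)%nat) m)%R.
Proof.
induction m as [|m IH]; simpl.
- rewrite Nat.add_0_r. ring.
- rewrite Nat.add_succ_r. simpl. rewrite IH. ring.
Qed.

Lemma cprod_0 (u : nat -> C) (n : nat) : cprod u n = 0 -> exists k, 1 + u k = 0.
Proof.
induction n as [|n IH]; simpl.
- intros E. apply RtoC_inj in E. lra.
- intros E. apply Cmult_integral in E. destruct E as [E|E]; [auto|exists n; exact E].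
Qed.

(** Past an index N where the remaining U sum to less than 1/2, the tail product stays within
    e^(1/2) - 1 < 1 of 1; a zero limit must come from one of the first N factors. *)
Lemma cprod_lim_0 (u : nat -> C) (U : nat -> R) :
  (forall k, Cmod (u k) <= U k) -> summable U ->
  tends eventually (cprod u) 0 -> exists k, 1 + u k = 0.
Proof.
intros HU HS H.
destruct (summable_tail U HS (1 / 2)%R ltac:(lra)) as [N HN].
destruct (Ceq_dec (cprod u N) 0) as [E|E]; [apply cprod_0 with N, E|exfalso].
assert (H1 : tends eventually (fun n => cprod (fun k => u (N + k)%nat) n) 0).
{ replace (RtoC 0) with (/ cprod u N * 0) by ring.
  apply tends_ext with (fun n => / cprod u N * cprod u (N + n)).
  - intros n. rewrite cprod_add. field. exact E.
  - apply tends_scal.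
    apply (tends_comp eventually eventually (fun n => (N + n)%nat)); [|exact H].
    apply eventually_incr. intros; lia. }
assert (H2 : Cmod (0 - 1) <= exp (1 / 2) - 1).
{ apply (tends_Cmod_le (F := eventually) (fun n => cprod (fun k => u (N + k)%nat) n - 1)).
  - exists 0%nat. intros n _.
    eapply Rle_trans; [apply (Cmod_cprod_m1 _ (fun k => U (N + k)%nat)); auto|].
    apply Rplus_le_compat_r. left. apply exp_increasing.
    generalize (HN N (N + n)%nat ltac:(lia) ltac:(lia)). rewrite rsum_add. lra.
  - apply tends_minus; [exact H1|apply tends_const]. }
replace (0 - 1) with (- (1)) in H2 by ring. rewrite Cmod_opp, Cmod_1 in H2.
(* e <= 3 < 4 gives e^(1/2) < 2, against 1 <= e^(1/2) - 1. *)
assert (H3 : exp (1 / 2) * exp (1 / 2) <= 3).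
{ rewrite <- exp_plus. replace (1 / 2 + 1 / 2)%R with 1%R by field. apply exp_le_3. }
nra.
Qed.

(** * Gauss's product for 1/Gamma *)

Definition gauss (z : C) (n : nat) : C := rising z n / (INR (fact n) * Cpower (INR n) z).

Definition log_step (k : nat) : R := (ln (INR (k + 2)) - ln (INR (k + 1)))%R.

(** The ratio of the Gauss approximants of indices k + 2 and k + 1, minus 1. The product starts at
    index 1, since index 0 would involve ln 0. *)
Definition gauss_factor (z : C) (k : nat) : C :=
  (1 + z / INR (k + 2)) * Cexp (- (z * log_step k)) - 1.

Lemma Cpower_pos (x : R) (z : C) : 0 < x -> Cpower x z = Cexp (z * ln x).
Proof. intros H. unfold Cpower. rewrite Clog_pos by assumption. reflexivity. Qed.

Lemma INR_pos (n : nat) : n <> 0%nat -> 0 < INR n.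
Proof. intros H. apply lt_0_INR. lia. Qed.

Lemma gauss_S (z : C) (k : nat) : gauss z (k + 2) = gauss z (k + 1) * (1 + gauss_factor z k).
Proof.
unfold gauss, gauss_factor, log_step.
rewrite !Cpower_pos by (apply INR_pos; lia).
replace (k + 2)%nat with (S (k + 1)) by lia.
cbn [rising]. rewrite fact_simpl, mult_INR, RtoC_mult, RtoC_minus.
replace (- (z * (ln (INR (S (k + 1))) - ln (INR (k + 1))))) with
  (z * ln (INR (k + 1)) - z * ln (INR (S (k + 1)))) by ring.
rewrite Cexp_minus. field.
repeat split; try apply Cexp_neq_0; try apply Cfact_neq_0; apply RtoC_INR_neq_0; lia.
Qed.

Lemma gauss_cprod (z : C) (n : nat) :
  gauss z (n + 1) = z * (z + 1) * cprod (gauss_factor z) n.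
Proof.
induction n as [|n IH].
- unfold gauss. simpl. rewrite Cpower_pos by lra. rewrite ln_1.
  replace (z * 0) with (RtoC 0) by ring. rewrite Cexp_0. field.
- replace (S n + 1)%nat with (n + 2)%nat by lia. rewrite gauss_S, IH. simpl. ring.
Qed.

(** A majorant of inverse-square type that telescopes: its partial sums are known exactly and stay
    below 2. *)
Definition sq_majorant (k : nat) : R := (2 / (INR (k + 1) * INR (k + 2)))%R.

Lemma rsum_sq_majorant (n : nat) : rsum sq_majorant n = (2 - 2 / INR (n + 1))%R.
Proof.
induction n as [|n IH].
- simpl. field.
- cbn [rsum]. rewrite IH. unfold sq_majorant.
  replace (S n + 1)%nat with (n + 2)%nat by lia.
  rewrite !plus_INR. change (INR 2) with 2%R. change (INR 1) with 1%R.
  generalize (pos_INR n). intros. field. lra.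
Qed.

Lemma sq_majorant_pos (k : nat) : 0 <= sq_majorant k.
Proof.
unfold sq_majorant. apply Rmult_le_pos; [lra|]. left. apply Rinv_0_lt_compat.
apply Rmult_lt_0_compat; apply INR_pos; lia.
Qed.

Lemma rsum_sq_majorant_le (n : nat) : rsum sq_majorant n <= 2.
Proof.
rewrite rsum_sq_majorant. assert (0 < INR (n + 1)) by (apply INR_pos; lia).
assert (0 < 2 / INR (n + 1)) by (apply Rdiv_lt_0_compat; lra). lra.
Qed.

Lemma summable_of_bounded (M : nat -> R) (B : R) :
  (forall k, 0 <= M k) -> (forall n, rsum M n <= B) -> summable M.
Proof.
intros H0 HB. split; [assumption|].
destruct (ex_finite_lim_seq_incr (fun n => rsum M (S n)) B) as [l Hl].
- intros n. apply rsum_mono; [assumption|lia].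
- intros n. apply HB.
- exists l. apply is_lim_seq_ext with (2 := Hl).
  intros n. symmetry. apply sum_n_rsum.
Qed.

Lemma summable_sq_majorant : summable sq_majorant.
Proof. apply summable_of_bounded with 2%R; [apply sq_majorant_pos|apply rsum_sq_majorant_le]. Qed.

Lemma log_step_bounds (k : nat) : (/ INR (k + 2) <= log_step k <= / INR (k + 1))%R.
Proof.
unfold log_step.
assert (H1 : 0 < INR (k + 1)) by (apply INR_pos; lia).
assert (H2 : 0 < INR (k + 2)) by (apply INR_pos; lia).
assert (E : INR (k + 2) = (INR (k + 1) + 1)%R).
{ rewrite !plus_INR. simpl. ring. }
assert (L : forall x, 0 < x -> ln x <= x - 1).
{ intros x Hx. generalize (exp_ge_1p (ln x)). rewrite exp_ln by assumption. lra. }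
split.
- assert (H := L (INR (k + 1) / INR (k + 2))%R ltac:(apply Rdiv_lt_0_compat; assumption)).
  rewrite ln_div in H by assumption.
  replace (INR (k + 1) / INR (k + 2))%R with (1 - / INR (k + 2))%R in H; [lra|].
  rewrite E. field. lra.
- assert (H := L (INR (k + 2) / INR (k + 1))%R ltac:(apply Rdiv_lt_0_compat; assumption)).
  rewrite ln_div in H by assumption.
  replace (INR (k + 2) / INR (k + 1))%R with (1 + / INR (k + 1))%R in H; [lra|].
  rewrite E. field. lra.
Qed.

(** The coefficient of z in the expansion of [gauss_factor z k]. These slopes add up to Euler's
    constant minus 1. *)
Definition gauss_slope (k : nat) : R := (/ INR (k + 2) - log_step k)%R.

Lemma gauss_slope_bound (k : nat) : Rabs (gauss_slope k) <= sq_majorant k.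
Proof.
unfold gauss_slope, sq_majorant.
assert (H1 : 0 < INR (k + 1)) by (apply INR_pos; lia).
assert (H2 : 0 < INR (k + 2)) by (apply INR_pos; lia).
destruct (log_step_bounds k) as [Ha Hb].
assert (E : (/ INR (k + 1) - / INR (k + 2) = 1 / (INR (k + 1) * INR (k + 2)))%R).
{ rewrite !plus_INR. simpl. field. generalize (pos_INR k). lra. }
assert (0 < 1 / (INR (k + 1) * INR (k + 2))).
{ apply Rdiv_lt_0_compat; [lra|]. apply Rmult_lt_0_compat; assumption. }
apply Rabs_le.
replace (2 / (INR (k + 1) * INR (k + 2)))%R with (2 * (1 / (INR (k + 1) * INR (k + 2))))%R by (field; lra).
lra.
Qed.

Lemma gauss_factor_quad (A : R) (z : C) (k : nat) : Cmod z <= A ->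
  Cmod (gauss_factor z k - z * gauss_slope k) <= (1 + (1 + A) * exp A) * Cmod z ^ 2 * sq_majorant k.
Proof.
intros HA. unfold gauss_factor, gauss_slope.
destruct (log_step_bounds k) as [Hl1 Hl2].
assert (H1 : 0 < INR (k + 1)) by (apply INR_pos; lia).
assert (H2 : 0 < INR (k + 2)) by (apply INR_pos; lia).
assert (H1' : 1 <= INR (k + 1)) by (rewrite plus_INR; simpl; generalize (pos_INR k); lra).
assert (H21 : INR (k + 2) = (INR (k + 1) + 1)%R) by (rewrite !plus_INR; simpl; ring).
assert (HN : RtoC (INR (k + 2)) <> 0) by (apply RtoC_INR_neq_0; lia).
assert (Hz := Cmod_ge_0 z).
assert (Hi1 : 0 < / INR (k + 1) <= 1).
{ split; [apply Rinv_0_lt_compat, H1|]. rewrite <- Rinv_1. apply Rinv_le_contravar; lra. }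
assert (Hi2 : 0 < / INR (k + 2)) by apply Rinv_0_lt_compat, H2.
set (l := log_step k) in *.
set (w := - (z * l)).
assert (Hw : Cmod w = (Cmod z * l)%R).
{ unfold w. rewrite Cmod_opp, Cmod_mult, Cmod_R, Rabs_pos_eq by lra. reflexivity. }
(* Writing [Cexp w] as 1 + w plus a remainder cancels the linear terms: an explicit quadratic term
   and a remainder of order |w|^2 are left. *)
replace ((1 + z / INR (k + 2)) * Cexp w - 1 - z * (/ INR (k + 2) - l)%R) with
  (- (z * z * l / INR (k + 2)) + (1 + z / INR (k + 2)) * (Cexp w - 1 - w)).
2: { unfold w. rewrite RtoC_minus, RtoC_inv by lra. field. exact HN. }
assert (HR := Cexp_m1_m_bound w). rewrite Hw in HR.
assert (Hq : (/ INR (k + 1) * / INR (k + 2) <= sq_majorant k)%R).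
{ unfold sq_majorant. unfold Rdiv. rewrite Rinv_mult.
  assert (0 < / INR (k + 1) * / INR (k + 2)) by (apply Rmult_lt_0_compat; lra). lra. }
assert (Hq2 : (/ INR (k + 1) * / INR (k + 1) <= sq_majorant k)%R).
{ unfold sq_majorant. unfold Rdiv. rewrite Rinv_mult.
  assert (/ INR (k + 1) <= 2 * / INR (k + 2)).
  { apply Rmult_le_reg_r with (INR (k + 1) * INR (k + 2))%R; [apply Rmult_lt_0_compat; assumption|].
    field_simplify; [lra|lra|lra]. }
  nra. }
eapply Rle_trans; [apply Cmod_triangle|].
rewrite Cmod_opp, !Cmod_mult. rewrite Cmod_div by assumption. rewrite !Cmod_mult.
rewrite !Cmod_R. rewrite (Rabs_pos_eq l) by lra. rewrite (Rabs_pos_eq (INR (k + 2))) by lra.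
assert (T1 : Cmod z * Cmod z * l / INR (k + 2) <= Cmod z ^ 2 * sq_majorant k).
{ replace (Cmod z * Cmod z * l / INR (k + 2))%R with (Cmod z ^ 2 * (l * / INR (k + 2)))%R by (field; lra).
  apply Rmult_le_compat_l; [apply pow_le, Hz|].
  apply Rle_trans with (2 := Hq). apply Rmult_le_compat_r; lra. }
assert (T2 : Cmod (1 + z / INR (k + 2)) <= 1 + A).
{ eapply Rle_trans; [apply Cmod_triangle|]. rewrite Cmod_1. rewrite Cmod_div by assumption.
  rewrite Cmod_R, (Rabs_pos_eq (INR (k + 2))) by lra.
  apply Rplus_le_compat_l. apply Rle_trans with (2 := HA). unfold Rdiv.
  rewrite <- (Rmult_1_r (Cmod z)) at 2. apply Rmult_le_compat_l; [lra|]. lra. }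
assert (T3 : Cmod (Cexp w - 1 - w) <= Cmod z ^ 2 * sq_majorant k * exp A).
{ eapply Rle_trans; [apply HR|]. apply Rmult_le_compat.
  - apply pow_le, Rmult_le_pos; lra.
  - left; apply exp_pos.
  - rewrite Rpow_mult_distr. apply Rmult_le_compat_l; [apply pow_le; lra|].
    apply Rle_trans with (2 := Hq2). simpl. rewrite Rmult_1_r. apply Rmult_le_compat; lra.
  - assert (Hle : Cmod z * l <= A) by nra.
    destruct Hle as [Hle|Hle]; [left; apply exp_increasing, Hle|rewrite Hle; lra]. }
assert (T4 : Cmod (1 + z / INR (k + 2)) * Cmod (Cexp w - 1 - w)
  <= (1 + A) * (Cmod z ^ 2 * sq_majorant k * exp A)).
{ apply Rmult_le_compat; try apply Cmod_ge_0; assumption. }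
replace ((1 + (1 + A) * exp A) * Cmod z ^ 2 * sq_majorant k)%R with
  (Cmod z ^ 2 * sq_majorant k + (1 + A) * (Cmod z ^ 2 * sq_majorant k * exp A))%R by ring.
apply Rplus_le_compat; assumption.
Qed.

Lemma gauss_factor_bound (A : R) : 0 <= A -> exists K, 0 <= K /\
  forall (z : C) (k : nat), Cmod z <= A -> Cmod (gauss_factor z k) <= K * Cmod z * sq_majorant k.
Proof.
intros HA0. exists (1 + A * (1 + (1 + A) * exp A))%R.
assert (He := exp_pos A).
assert (HK : 0 <= 1 + (1 + A) * exp A) by nra.
split; [nra|].
intros z k HA. assert (H := gauss_factor_quad A z k HA).
replace (gauss_factor z k) with ((gauss_factor z k - z * gauss_slope k) + z * gauss_slope k) by ring.
eapply Rle_trans; [apply Cmod_triangle|].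
rewrite (Cmod_mult z), Cmod_R.
assert (Hs := gauss_slope_bound k). assert (Hz := Cmod_ge_0 z). assert (Hq := sq_majorant_pos k).
assert (H1 : Cmod z * Rabs (gauss_slope k) <= Cmod z * sq_majorant k) by (apply Rmult_le_compat_l; assumption).
assert (H2 : (1 + (1 + A) * exp A) * Cmod z ^ 2 * sq_majorant k <=
  A * (1 + (1 + A) * exp A) * (Cmod z * sq_majorant k)).
{ replace ((1 + (1 + A) * exp A) * Cmod z ^ 2 * sq_majorant k)%R with
   (Cmod z * ((1 + (1 + A) * exp A) * (Cmod z * sq_majorant k)))%R by ring.
  rewrite Rmult_assoc. apply Rmult_le_compat_r; [|assumption].
  apply Rmult_le_pos; [assumption|]. apply Rmult_le_pos; assumption. }
nra.
Qed.

(** A zero of the limit is a zero of some factor, and exponentials do not vanish. The zeros of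
    1/Gamma at 0 and -1 are carried by the prefactor z (z + 1) of [gauss_cprod]. *)
Lemma gauss_prod_tends (z : C) :
  exists L, tends eventually (cprod (gauss_factor z)) L /\
    (L = 0 -> exists k, z = - INR (k + 2)).
Proof.
destruct (gauss_factor_bound (Cmod z) (Cmod_ge_0 z)) as [K [HK HB]].
assert (HS : summable (fun k => K * Cmod z * sq_majorant k)%R).
{ apply summable_scal; [apply Rmult_le_pos; [assumption|apply Cmod_ge_0]|apply summable_sq_majorant]. }
destruct (cprod_tends (gauss_factor z) _ ltac:(intros k; apply HB; lra) HS) as [L HL].
exists L. split; [assumption|]. intros E. rewrite E in HL.
destruct (cprod_lim_0 (gauss_factor z) _ ltac:(intros k; apply HB; lra) HS HL) as [k Hk].
exists k. unfold gauss_factor in Hk.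
assert (HN : RtoC (INR (k + 2)) <> 0) by (apply RtoC_INR_neq_0; lia).
replace (1 + ((1 + z / INR (k + 2)) * Cexp (- (z * log_step k)) - 1)) with
  ((1 + z / INR (k + 2)) * Cexp (- (z * log_step k))) in Hk by ring.
apply Cmult_integral in Hk. destruct Hk as [Hk|Hk]; [|destruct (Cexp_neq_0 _ Hk)].
replace z with ((1 + z / INR (k + 2)) * INR (k + 2) - INR (k + 2)) by (field; assumption).
rewrite Hk. ring.
Qed.

Lemma tends_shift (f : nat -> C) (N : nat) (l : C) :
  tends eventually (fun n => f (n + N)%nat) l -> tends eventually f l.
Proof.
intros H eps He. destruct (H eps He) as [N0 HN0].
exists (N + N0)%nat. intros n Hn. replace n with (n - N + N)%nat by lia. apply HN0. lia.
Qed.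

Lemma gauss_tends (z : C) : tends eventually (gauss z) (rGamma z).
Proof.
destruct (gauss_prod_tends z) as [L [HL _]].
assert (H : tends eventually (gauss z) (z * (z + 1) * L)).
{ apply tends_shift with 1%nat.
  apply tends_ext with (fun n => z * (z + 1) * cprod (gauss_factor z) n).
  - intros n. symmetry. apply gauss_cprod.
  - apply tends_scal, HL. }
unfold rGamma. change (tends eventually (gauss z) (Clim eventually (gauss z))).
rewrite (Clim_eq _ _ H). exact H.
Qed.

Lemma rGamma_cprod (z L : C) :
  tends eventually (cprod (gauss_factor z)) L -> rGamma z = z * (z + 1) * L.
Proof.
intros H. apply (tends_unique (F := eventually) (fun n => gauss z (n + 1))).
- apply (tends_comp eventually eventually (fun n => (n + 1)%nat)); [|apply gauss_tends].
  apply eventually_incr. intros; lia.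
- apply tends_ext with (fun n => z * (z + 1) * cprod (gauss_factor z) n).
  + intros n. symmetry. apply gauss_cprod.
  + apply tends_scal, H.
Qed.

Lemma rGamma_neq_0 (z : C) : (forall n : nat, z <> - INR n) -> rGamma z <> 0.
Proof.
intros Hz. destruct (gauss_prod_tends z) as [L [HL HL0]].
rewrite (rGamma_cprod z L HL). intros E.
apply Cmult_integral in E. destruct E as [E|E].
- apply Cmult_integral in E. destruct E as [E|E].
  + apply (Hz 0%nat). rewrite E. simpl. ring.
  + apply (Hz 1%nat). replace z with (z + 1 - 1) by ring. rewrite E. simpl. ring.
- destruct (HL0 E) as [k Hk]. apply (Hz _ Hk).
Qed.

Lemma tends_inv_INR : tends eventually (fun n => / RtoC (INR n)) 0.
Proof.
apply tends_ext_loc with (fun n => RtoC (/ INR n)).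
- exists 1%nat. intros n Hn. apply RtoC_inv. apply not_0_INR. lia.
- apply tends_RtoC; [typeclasses eauto|].
  assert (H := is_lim_seq_inv (fun n => INR n) p_infty is_lim_seq_INR ltac:(discriminate)).
  exact H.
Qed.

Lemma rising_S_l (z : C) (n : nat) : rising z (S n) = z * rising (z + 1) n.
Proof.
induction n as [|n IH].
- simpl. ring.
- change (rising z (S (S n))) with (rising z (S n) * (z + INR (S (S n)))).
  change (rising (z + 1) (S n)) with (rising (z + 1) n * (z + 1 + INR (S n))).
  rewrite IH, (S_INR (S n)), RtoC_plus. ring.
Qed.

(** The Gauss approximants satisfy this equation up to the factor 1 + (z + 1)/n, which tends to 1.
    For 1/Gamma the functional equation has no exceptional points. *)
Lemma rGamma_S (z : C) : rGamma z = z * rGamma (z + 1).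
Proof.
apply (tends_unique (F := eventually) (fun n => z * gauss (z + 1) n)).
2: apply tends_scal, gauss_tends.
apply tends_ext_loc with (fun n => gauss z n * (1 + (z + 1) * / INR n)).
- exists 1%nat. intros n Hn. unfold gauss.
  assert (Hp : 0 < INR n) by (apply INR_pos; lia).
  rewrite !Cpower_pos by assumption.
  assert (E := rising_S_l z n). simpl rising in E at 1.
  replace ((z + 1) * ln (INR n)) with (z * ln (INR n) + ln (INR n)) by ring.
  rewrite Cexp_plus, (Cexp_RtoC (ln (INR n))), exp_ln by assumption.
  assert (Hn0 : RtoC (INR n) <> 0) by (apply RtoC_INR_neq_0; lia).
  transitivity (z * rising (z + 1) n / (INR (fact n) * (Cexp (z * ln (INR n)) * INR n))).
  2: { field. repeat split; try assumption; [apply Cexp_neq_0|apply Cfact_neq_0]. }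
  rewrite <- rising_S_l. change (rising z (S n)) with (rising z n * (z + INR (S n))).
  rewrite S_INR, RtoC_plus. field.
  repeat split; try assumption; [apply Cexp_neq_0|apply Cfact_neq_0].
- replace (rGamma z) with (rGamma z * (1 + (z + 1) * 0)) by ring.
  apply tends_mult; [apply gauss_tends|].
  apply tends_plus; [apply tends_const|apply tends_scal, tends_inv_INR].
Qed.

Lemma rGamma_1 : rGamma 1 = 1.
Proof.
apply (tends_unique (F := eventually) (gauss 1)); [apply gauss_tends|].
apply tends_ext_loc with (fun n => 1 + / INR n).
- exists 1%nat. intros n Hn. unfold gauss.
  rewrite Cpower_pos by (apply INR_pos; lia).
  replace (1 * ln (INR n)) with (RtoC (ln (INR n))) by ring.
  rewrite Cexp_RtoC, exp_ln by (apply INR_pos; lia).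
  assert (Hn0 : RtoC (INR n) <> 0) by (apply RtoC_INR_neq_0; lia).
  assert (E : forall m, rising 1 m = RtoC (INR (fact (S m)))).
  { intros m. induction m as [|m IH]; [reflexivity|].
    change (rising 1 (S m)) with (rising 1 m * (1 + INR (S m))). rewrite IH.
    rewrite (fact_simpl (S m)), mult_INR, (S_INR (S m)), RtoC_mult, RtoC_plus. ring. }
  rewrite E, fact_simpl, mult_INR, RtoC_mult, S_INR, RtoC_plus. field.
  split; [assumption|apply Cfact_neq_0].
- assert (H := tends_plus (F := eventually) _ _ _ _ (tends_const 1) tends_inv_INR).
  rewrite Cplus_0_r in H. exact H.
Qed.

Lemma rGamma_INR (n : nat) : rGamma (INR n + 1) = / INR (fact n).
Proof.
induction n as [|n IH].
- simpl. replace (0 + 1) with (RtoC 1) by ring. rewrite rGamma_1. field.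
- rewrite rGamma_S in IH.
  assert (HN : RtoC (INR (S n)) <> 0) by (apply RtoC_INR_neq_0; lia).
  rewrite S_INR, RtoC_plus in *.
  rewrite fact_simpl, mult_INR, RtoC_mult, S_INR, RtoC_plus.
  replace (rGamma (INR n + 1 + 1)) with ((INR n + 1) * rGamma (INR n + 1 + 1) / (INR n + 1))
    by (field; assumption).
  rewrite IH. field. split; [apply Cfact_neq_0|assumption].
Qed.

Lemma rGamma_opp_INR (n : nat) : rGamma (- INR n) = 0.
Proof.
induction n as [|n IH].
- rewrite rGamma_S. simpl. ring.
- rewrite rGamma_S, S_INR, RtoC_plus.
  replace (- (INR n + 1) + 1) with (- INR n) by ring. rewrite IH. ring.
Qed.

(** The finitely many exceptional indices are absorbed one at a time, from N downwards, by enlarging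
    the constant. *)
Lemma eventual_bound (x b : nat -> R) (C0 : R) (N : nat) :
  (forall k, 0 < b k) -> (forall k, (N <= k)%nat -> x k <= C0 * b k) ->
  exists C1, 0 <= C1 /\ forall k, x k <= C1 * b k.
Proof.
intros Hb. revert C0. induction N as [|N IH]; intros C0 H.
- exists (Rmax 0 C0). split; [apply Rmax_l|]. intros k.
  eapply Rle_trans; [apply H; lia|]. apply Rmult_le_compat_r; [left; apply Hb|apply Rmax_r].
- apply (IH (Rmax C0 (x N / b N))). intros k Hk.
  destruct (Nat.eq_dec k N) as [->|Hne].
  + apply Rle_trans with (x N / b N * b N)%R.
    * right. field. apply Rgt_not_eq, Hb.
    * apply Rmult_le_compat_r; [left; apply Hb|apply Rmax_r].
  + eapply Rle_trans; [apply H; lia|].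
    apply Rmult_le_compat_r; [left; apply Hb|apply Rmax_l].
Qed.

Lemma exp_coef_pos (A : R) (k : nat) : 0 < A -> 0 < A ^ k / INR (fact k).
Proof. intros H. apply Rdiv_lt_0_compat; [apply pow_lt, H|apply INR_fact_lt_0]. Qed.

(** Each use of the functional equation divides by a + k + 1, whose modulus is at least (k + 1)/2
    once k >= 2|a|: this produces the factorial and the factor 2^k. *)
Lemma rGamma_growth (a : C) :
  exists C0, 0 <= C0 /\ forall k, Cmod (rGamma (a + INR k + 1)) <= C0 * (2 ^ k / INR (fact k)).
Proof.
destruct (INR_unbounded (2 * Cmod a)) as [N HN].
apply eventual_bound with (Cmod (rGamma (a + INR N + 1)) / (2 ^ N / INR (fact N)))%R N.
- intros k. apply exp_coef_pos. lra.
- intros k Hk. induction Hk as [|k Hk IH].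
  + right. field. split; [apply INR_fact_neq_0|apply pow_nonzero; lra].
  + rewrite rGamma_S, Cmod_mult in IH.
    assert (HkN : INR N <= INR k) by (apply le_INR, Hk).
    assert (Hlow : INR (S k) / 2 <= Cmod (a + INR k + 1)).
    { assert (H := Cmod_triangle (a + INR k + 1) (- a)).
      replace (a + INR k + 1 + - a) with (RtoC (INR (S k))) in H by (rewrite S_INR, RtoC_plus; ring).
      rewrite Cmod_R, Rabs_pos_eq, Cmod_opp in H by apply pos_INR.
      rewrite S_INR in *. lra. }
    rewrite S_INR, RtoC_plus.
    replace (a + (INR k + 1) + 1) with (a + INR k + 1 + 1) by ring.
    set (g := Cmod (rGamma (a + INR k + 1 + 1))) in *.
    assert (Hg : 0 <= g) by apply Cmod_ge_0.
    assert (Hp : 0 < INR (S k)) by (apply INR_pos; lia).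
    set (Q := (Cmod (rGamma (a + INR N + 1)) / (2 ^ N / INR (fact N)))%R) in *.
    apply Rmult_le_reg_l with (INR (S k) / 2)%R; [lra|].
    apply Rle_trans with (Cmod (a + INR k + 1) * g)%R; [apply Rmult_le_compat_r; assumption|].
    apply Rle_trans with (1 := IH). right.
    rewrite fact_simpl, mult_INR. simpl (2 ^ S k)%R. field.
    split; [apply INR_fact_neq_0|lra].
Qed.

(** * Derivatives and integrals of complex-valued functions of a real variable *)

Definition CR_derive (f : R -> C) (t : R) (d : C) : Prop :=
  is_derive (K := R_AbsRing) (V := C_R_NormedModule) f t d.

Definition CR_int (f : R -> C) (a b : R) (l : C) : Prop :=
  is_RInt (V := C_R_CompleteNormedModule) f a b l.

Lemma norm_CR (x : C) : norm (V := C_R_NormedModule) x = Cmod x.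
Proof.
change (sqrt (Rabs (fst x) ^ 2 + Rabs (snd x) ^ 2) = sqrt (fst x ^ 2 + snd x ^ 2)).
rewrite !pow2_abs. reflexivity.
Qed.

Lemma CR_derive_of_parts (f : R -> C) (t : R) (d : C) :
  is_derive (fun x => Re (f x)) t (Re d) -> is_derive (fun x => Im (f x)) t (Im d) ->
  CR_derive f t d.
Proof.
intros HR HI.
apply (is_derive_scal_l (K := R_AbsRing) (V := C_R_NormedModule) _ _ _ (RtoC 1)) in HR.
apply (is_derive_scal_l (K := R_AbsRing) (V := C_R_NormedModule) _ _ _ Ci) in HI.
assert (H := is_derive_plus (K := R_AbsRing) (V := C_R_NormedModule) _ _ _ _ _ HR HI).
assert (E : forall c : C, plus (G := C_R_NormedModule) (scal (V := C_R_NormedModule) (Re c) (RtoC 1))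
   (scal (V := C_R_NormedModule) (Im c) Ci) = c).
{ intros [u v]. unfold Ci, RtoC. change ((u * 1 + v * 0, u * 0 + v * 1)%R = (u, v)). f_equal; ring. }
unfold CR_derive. rewrite <- (E d).
apply is_derive_ext with (2 := H). intros x. apply E.
Qed.

Lemma CR_derive_Re (f : R -> C) (t : R) (d : C) :
  CR_derive f t d -> is_derive (fun x => Re (f x)) t (Re d).
Proof.
intros H.
apply (filterdiff_comp' (K := R_AbsRing) (U := R_NormedModule) (V := C_R_NormedModule) (W := R_NormedModule)
  f fst t _ fst H).
apply filterdiff_linear, is_linear_fst.
Qed.

Lemma CR_derive_Im (f : R -> C) (t : R) (d : C) :
  CR_derive f t d -> is_derive (fun x => Im (f x)) t (Im d).
Proof.
intros H.
apply (filterdiff_comp' (K := R_AbsRing) (U := R_NormedModule) (V := C_R_NormedModule) (W := R_NormedModule)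
  f snd t _ snd H).
apply filterdiff_linear, is_linear_snd.
Qed.

Lemma CR_derive_eq (f : R -> C) (t : R) (d d' : C) : d = d' -> CR_derive f t d -> CR_derive f t d'.
Proof. intros ->. auto. Qed.

Lemma CR_derive_plus (f g : R -> C) (t : R) (df dg : C) :
  CR_derive f t df -> CR_derive g t dg -> CR_derive (fun x => f x + g x) t (df + dg).
Proof. intros Hf Hg. exact (is_derive_plus (K := R_AbsRing) (V := C_R_NormedModule) _ _ _ _ _ Hf Hg). Qed.

Lemma CR_derive_mult (f g : R -> C) (t : R) (df dg : C) :
  CR_derive f t df -> CR_derive g t dg ->
  CR_derive (fun x => f x * g x) t (df * g t + f t * dg).
Proof.
intros Hf Hg.
assert (FR := CR_derive_Re _ _ _ Hf). assert (FI := CR_derive_Im _ _ _ Hf).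
assert (GR := CR_derive_Re _ _ _ Hg). assert (GI := CR_derive_Im _ _ _ Hg).
assert (X : forall a b : R -> R, forall da db, is_derive a t da -> is_derive b t db ->
  is_derive (fun x => a x * b x)%R t (da * b t + a t * db)%R).
{ intros a b da db Ha Hb.
  exact (is_derive_mult (K := R_AbsRing) a b t da db Ha Hb Rmult_comm). }
apply CR_derive_of_parts.
- assert (H := is_derive_minus (K := R_AbsRing) (V := R_NormedModule) _ _ _ _ _ (X _ _ _ _ FR GR) (X _ _ _ _ FI GI)).
  eapply is_derive_ext; [|eapply (fun e => eq_ind _ (fun d => is_derive _ _ d) H _ e)].
  + intros x. reflexivity.
  + unfold minus, plus, opp, Cplus, Cmult, Re, Im. simpl. unfold Re, Im. ring.
- assert (H := is_derive_plus (K := R_AbsRing) (V := R_NormedModule) _ _ _ _ _ (X _ _ _ _ FR GI) (X _ _ _ _ FI GR)).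
  eapply is_derive_ext; [|eapply (fun e => eq_ind _ (fun d => is_derive _ _ d) H _ e)].
  + intros x. reflexivity.
  + unfold plus, Cplus, Cmult, Re, Im. simpl. unfold Re, Im. ring.
Qed.

Lemma CR_derive_const (c : C) (t : R) : CR_derive (fun _ => c) t 0.
Proof. exact (is_derive_const (K := R_AbsRing) (V := C_R_NormedModule) c t). Qed.

Lemma CR_derive_scal (c : C) (f : R -> C) (t : R) (df : C) :
  CR_derive f t df -> CR_derive (fun x => c * f x) t (c * df).
Proof.
intros H. apply CR_derive_eq with (0 * f t + c * df); [ring|].
apply (CR_derive_mult (fun _ => c) f); [apply CR_derive_const|assumption].
Qed.

Lemma CR_derive_RtoC (f : R -> R) (t d : R) : is_derive f t d -> CR_derive (fun x => RtoC (f x)) t (RtoC d).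
Proof.
intros H. apply CR_derive_of_parts; [exact H|].
exact (is_derive_const (K := R_AbsRing) (V := R_NormedModule) 0%R t).
Qed.

Lemma CR_derive_Cexp (f : R -> C) (t : R) (d : C) :
  CR_derive f t d -> CR_derive (fun x => Cexp (f x)) t (d * Cexp (f t)).
Proof.
intros H. assert (HR := CR_derive_Re _ _ _ H). assert (HI := CR_derive_Im _ _ _ H).
assert (X : forall a b : R -> R, forall da db, is_derive a t da -> is_derive b t db ->
  is_derive (fun x => exp (a x) * cos (b x))%R t (exp (a t) * (da * cos (b t) - db * sin (b t)))%R /\
  is_derive (fun x => exp (a x) * sin (b x))%R t (exp (a t) * (da * sin (b t) + db * cos (b t)))%R).
{ intros a b da db Ha Hb. split; auto_derive; (split; [exists da; exact Ha|split; [exists db; exact Hb|exact I]])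
    || (assert (Ea : Derive a t = da) by (apply is_derive_unique; exact Ha);
        assert (Eb : Derive b t = db) by (apply is_derive_unique; exact Hb);
        change (fun x => a x) with a; change (fun x => b x) with b; rewrite Ea, Eb; ring). }
destruct (X _ _ _ _ HR HI) as [X1 X2].
apply CR_derive_of_parts.
- eapply is_derive_ext; [|eapply (fun e => eq_ind _ (fun d => is_derive _ _ d) X1 _ e)].
  + intros x. unfold Cexp, Cmult, RtoC, Re, Im. simpl. ring.
  + unfold Cexp, Cmult, RtoC, Re, Im. simpl. ring.
- eapply is_derive_ext; [|eapply (fun e => eq_ind _ (fun d => is_derive _ _ d) X2 _ e)].
  + intros x. unfold Cexp, Cmult, RtoC, Re, Im. simpl. ring.
  + unfold Cexp, Cmult, RtoC, Re, Im. simpl. ring.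
Qed.

Lemma CR_derive_linear (c : C) (t : R) : CR_derive (fun x => c * x) t c.
Proof.
apply CR_derive_eq with (c * 1); [ring|]. apply CR_derive_scal.
apply (CR_derive_RtoC (fun x => x)). apply (is_derive_id (K := R_AbsRing)).
Qed.

Lemma CR_derive_Cexp_linear (c : C) (t : R) :
  CR_derive (fun x => Cexp (c * x)) t (c * Cexp (c * t)).
Proof. apply CR_derive_Cexp, CR_derive_linear. Qed.

Lemma Ccos_alt (c : C) (x : R) :
  Ccos (c * x) = / 2 * (Cexp (Ci * c * x) + Cexp (- (Ci * c) * x)).
Proof.
unfold Ccos. replace (- (Ci * c) * x) with (- (Ci * (c * x))) by ring.
replace (Ci * c * x) with (Ci * (c * x)) by ring. unfold Cdiv. ring.
Qed.

Lemma Ci_neq_0 : Ci <> 0.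
Proof. intros E. injection E. lra. Qed.

Lemma Ci2 : Ci * Ci = - (1).
Proof. unfold Ci, Cmult, Copp, RtoC. simpl. f_equal; ring. Qed.

Lemma Ci_inv : / Ci = - Ci.
Proof. unfold Ci, Cinv, Copp. simpl. f_equal; field. Qed.

Lemma Csin_alt (c : C) (x : R) :
  Csin (c * x) = / (2 * Ci) * (Cexp (Ci * c * x) + - (1) * Cexp (- (Ci * c) * x)).
Proof.
unfold Csin. replace (- (Ci * c) * x) with (- (Ci * (c * x))) by ring.
replace (Ci * c * x) with (Ci * (c * x)) by ring. unfold Cdiv. ring.
Qed.

Lemma CR_derive_ext (f g : R -> C) (t : R) (d : C) :
  (forall x, f x = g x) -> CR_derive f t d -> CR_derive g t d.
Proof. intros E. apply is_derive_ext, E. Qed.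

Lemma CR_derive_Ccos (c : C) (t : R) :
  CR_derive (fun x => Ccos (c * x)) t (- c * Csin (c * t)).
Proof.
apply CR_derive_ext with (fun x : R => / 2 * (Cexp (Ci * c * x) + Cexp (- (Ci * c) * x))).
{ intros x. symmetry. apply Ccos_alt. }
eapply CR_derive_eq.
2: { apply CR_derive_scal. apply CR_derive_plus; apply CR_derive_Cexp_linear. }
rewrite Csin_alt.
assert (H2 := C2_neq_0). assert (Hi := Ci_neq_0).
assert (E : / (2 * Ci) = - (/ 2 * Ci)).
{ replace (/ (2 * Ci)) with (/ 2 * / Ci) by (field; assumption).
  rewrite Ci_inv. ring. }
rewrite E. ring.
Qed.

Lemma CR_derive_Csin (c : C) (t : R) :
  CR_derive (fun x => Csin (c * x)) t (c * Ccos (c * t)).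
Proof.
apply CR_derive_ext with (fun x : R => / (2 * Ci) * (Cexp (Ci * c * x) + - (1) * Cexp (- (Ci * c) * x))).
{ intros x. symmetry. apply Csin_alt. }
eapply CR_derive_eq.
2: { apply CR_derive_scal. apply CR_derive_plus; [|apply CR_derive_scal]; apply CR_derive_Cexp_linear. }
rewrite Ccos_alt. field. apply Ci_neq_0.
Qed.

Lemma CR_derive_continuous (f : R -> C) (t : R) (d : C) :
  CR_derive f t d -> continuous (U := C_R_CompleteNormedModule) f t.
Proof. intros H. apply (ex_derive_continuous (K := R_AbsRing) (V := C_R_NormedModule)). exists d. exact H. Qed.

Lemma CR_int_FTC (f df : R -> C) (a b : R) : a <= b ->
  (forall x, a <= x <= b -> CR_derive f x (df x)) ->
  (forall x, a <= x <= b -> exists d, CR_derive df x d) ->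
  CR_int df a b (f b - f a).
Proof.
intros Hab H1 H2.
apply (is_RInt_derive (V := C_R_CompleteNormedModule) f df);
rewrite Rmin_left, Rmax_right by assumption.
- exact H1.
- intros x Hx. destruct (H2 x Hx) as [d Hd]. apply CR_derive_continuous with d, Hd.
Qed.

Lemma CR_int_ex (f : R -> C) (a b : R) : a <= b ->
  (forall x, a <= x <= b -> exists d, CR_derive f x d) -> exists l, CR_int f a b l.
Proof.
intros Hab H. apply (ex_RInt_continuous (V := C_R_CompleteNormedModule)).
rewrite Rmin_left, Rmax_right by assumption.
intros x Hx. destruct (H x Hx) as [d Hd]. apply CR_derive_continuous with d, Hd.
Qed.

Lemma CR_int_plus (f g : R -> C) (a b : R) (l m : C) :
  CR_int f a b l -> CR_int g a b m -> CR_int (fun x => f x + g x) a b (l + m).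
Proof. intros Hf Hg. exact (is_RInt_plus (V := C_R_CompleteNormedModule) _ _ _ _ _ _ Hf Hg). Qed.

Lemma CR_int_parts (f : R -> C) (a b : R) (l : C) :
  CR_int f a b l <->
  is_RInt (fun x => Re (f x)) a b (Re l) /\ is_RInt (fun x => Im (f x)) a b (Im l).
Proof.
split.
- intros H. split.
  + exact (is_RInt_fct_extend_fst (U := R_NormedModule) (V := R_NormedModule) f a b l H).
  + exact (is_RInt_fct_extend_snd (U := R_NormedModule) (V := R_NormedModule) f a b l H).
- intros [H1 H2]. destruct l as [u v].
  exact (is_RInt_fct_extend_pair (U := R_NormedModule) (V := R_NormedModule) f a b u v H1 H2).
Qed.

Lemma CR_int_zero (a b : R) : CR_int (fun _ => 0) a b 0.
Proof.
apply CR_int_parts.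
assert (X := is_RInt_const (V := R_NormedModule) a b 0%R).
change (is_RInt (fun _ => 0%R) a b ((b - a) * 0)%R) in X. rewrite Rmult_0_r in X.
split; exact X.
Qed.

Lemma CR_int_scal (c : C) (f : R -> C) (a b : R) (l : C) :
  CR_int f a b l -> CR_int (fun x => c * f x) a b (c * l).
Proof.
intros [HR HI]%CR_int_parts. apply CR_int_parts.
assert (S : forall (k : R) g v, is_RInt g a b v -> is_RInt (fun x => k * g x)%R a b (k * v)%R).
{ intros k g v H. exact (is_RInt_scal (V := R_NormedModule) g a b k v H). }
split.
- exact (is_RInt_minus (V := R_NormedModule) _ _ _ _ _ _ (S (Re c) _ _ HR) (S (Im c) _ _ HI)).
- exact (is_RInt_plus (V := R_NormedModule) _ _ _ _ _ _ (S (Re c) _ _ HI) (S (Im c) _ _ HR)).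
Qed.

Lemma CR_int_unique (f : R -> C) (a b : R) (l m : C) : CR_int f a b l -> CR_int f a b m -> l = m.
Proof.
intros Hl Hm. rewrite <- (is_RInt_unique (V := C_R_CompleteNormedModule) _ _ _ _ Hl).
apply (is_RInt_unique (V := C_R_CompleteNormedModule) _ _ _ _ Hm).
Qed.

Lemma CR_int_ext (f g : R -> C) (a b : R) (l : C) : a <= b ->
  (forall x, a < x < b -> f x = g x) -> CR_int f a b l -> CR_int g a b l.
Proof.
intros Hab H. apply (is_RInt_ext (V := C_R_CompleteNormedModule)).
rewrite Rmin_left, Rmax_right by assumption. exact H.
Qed.

Lemma CR_int_bound (f : R -> C) (g : R -> R) (a b : R) (l : C) (m : R) : a <= b ->
  (forall x, a <= x <= b -> Cmod (f x) <= g x) ->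
  CR_int f a b l -> is_RInt g a b m -> Cmod l <= m.
Proof.
intros Hab H Hf Hg. rewrite <- norm_CR.
apply (norm_RInt_le (V := C_R_NormedModule) f g a b l m Hab); [|exact Hf|exact Hg].
intros x Hx. rewrite norm_CR. apply H, Hx.
Qed.

(** * Improper integrals on [0, pi) *)

Definition imp_int (f : R -> C) (l : C) : Prop :=
  exists Phi : R -> C, (forall b, 0 <= b < PI -> CR_int f 0 b (Phi b)) /\ tends (at_left PI) Phi l.

Lemma at_left_PI (P : R -> Prop) :
  (exists d, 0 < d /\ forall b, PI - d < b < PI -> P b) <-> at_left PI P.
Proof.
split.
- intros [d [Hd H]]. exists (mkposreal d Hd). intros b Hb HbP. apply H.
  change (Rabs (b - PI) < d) in Hb. apply Rabs_def2 in Hb. lra.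
- intros [d H]. exists d. split; [apply cond_pos|]. intros b Hb. apply H; [|lra].
  change (Rabs (b - PI) < d). apply Rabs_def1; lra.
Qed.

Lemma at_left_PI_pos (P : R -> Prop) : (forall b, 0 <= b < PI -> P b) -> at_left PI P.
Proof.
intros H. apply at_left_PI. exists PI. split; [apply PI_RGT_0|]. intros b Hb. apply H. lra.
Qed.

(** [imp_int] follows an explicit primitive as a single bound tends to pi; the product filter of
    [is_RInt_gen] is entered only here, its first component being concentrated at the point 0. *)
Lemma imp_int_is_RInt_gen (f : R -> C) (l : C) : imp_int f l ->
  is_RInt_gen (V := C_R_CompleteNormedModule) f (at_point 0) (at_left PI) l.
Proof.
intros [Phi [H1 H2]] P HP.
apply tends_filterlim in H2; [|typeclasses eauto].
assert (H3 := H2 P HP).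
apply Filter_prod with (fun a => a = 0%R) (fun b => 0 <= b < PI /\ P (Phi b)).
- reflexivity.
- apply filter_and; [|exact H3]. apply at_left_PI_pos. auto.
- intros a b -> [Hb HPb]. exists (Phi b). split; [apply H1, Hb|exact HPb].
Qed.

Lemma imp_int_ex (f : R -> C) (l : C) : imp_int f l -> ex_Cint_0_pi f.
Proof. intros H. exists l. apply imp_int_is_RInt_gen, H. Qed.

Lemma imp_int_eq (f : R -> C) (l : C) : imp_int f l -> Cint_0_pi f = l.
Proof.
intros H.
exact (is_RInt_gen_unique (V := C_R_CompleteNormedModule) (Fa := at_point 0) (Fb := at_left PI)
  (FFa := _) (FFb := _) f l (imp_int_is_RInt_gen f l H)).
Qed.

Lemma imp_int_unique (f : R -> C) (l m : C) : imp_int f l -> imp_int f m -> l = m.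
Proof. intros Hl Hm. rewrite <- (imp_int_eq f l Hl). apply imp_int_eq, Hm. Qed.

Lemma imp_int_ext (f g : R -> C) (l : C) :
  (forall x, 0 < x < PI -> f x = g x) -> imp_int f l -> imp_int g l.
Proof.
intros H [Phi [H1 H2]]. exists Phi. split; [|assumption].
intros b Hb. apply CR_int_ext with f; [lra| |apply H1, Hb]. intros x Hx. apply H. lra.
Qed.

Lemma imp_int_plus (f g : R -> C) (l m : C) :
  imp_int f l -> imp_int g m -> imp_int (fun x => f x + g x) (l + m).
Proof.
intros [F [F1 F2]] [G [G1 G2]]. exists (fun b => F b + G b). split.
- intros b Hb. apply CR_int_plus; auto.
- apply tends_plus; assumption.
Qed.

Lemma imp_int_scal (c : C) (f : R -> C) (l : C) : imp_int f l -> imp_int (fun x => c * f x) (c * l).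
Proof.
intros [F [F1 F2]]. exists (fun b => c * F b). split.
- intros b Hb. apply CR_int_scal; auto.
- apply tends_scal; assumption.
Qed.

Lemma is_RInt_majorant (p a b : R) : -1 < p -> a <= b < PI ->
  is_RInt (fun t => Rpower (PI - t) p) a b
    ((Rpower (PI - a) (p + 1) - Rpower (PI - b) (p + 1)) / (p + 1))%R.
Proof.
intros Hp Hab.
replace ((Rpower (PI - a) (p + 1) - Rpower (PI - b) (p + 1)) / (p + 1))%R
  with (minus (- Rpower (PI - b) (p + 1) / (p + 1)) (- Rpower (PI - a) (p + 1) / (p + 1)))%R.
2: { unfold minus, plus, opp. simpl. field. lra. }
assert (Hpow : forall t, t < PI -> Rpower (PI - t) (p + 1) = ((PI - t) * Rpower (PI - t) p)%R).
{ intros t Ht. rewrite Rpower_plus, Rpower_1 by lra. ring. }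
apply (is_RInt_derive (V := R_CompleteNormedModule) (fun t => - Rpower (PI - t) (p + 1) / (p + 1))%R);
rewrite Rmin_left, Rmax_right by lra.
- intros x Hx. unfold Rpower. auto_derive; [lra|].
  fold (Rpower (PI - x) (p + 1)). fold (Rpower (PI - x) p). replace (PI + - x)%R with (PI - x)%R by ring.
  assert (E := Hpow x ltac:(lra)). unfold Rpower in *. rewrite E. field. lra.
- intros x Hx. apply (ex_derive_continuous (K := R_AbsRing) (V := R_NormedModule)).
  unfold Rpower. auto_derive. lra.
Qed.

Lemma Rpower_pos (x p : R) : 0 < Rpower x p.
Proof. apply exp_pos. Qed.

Lemma Rpower_tends_0 (q : R) : 0 < q -> tends (at_left PI) (fun b => RtoC (Rpower (PI - b) q)) 0.
Proof.
intros Hq eps He. apply at_left_PI. exists (Rpower eps (/ q)).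
split; [apply Rpower_pos|]. intros b Hb.
replace (RtoC (Rpower (PI - b) q) - 0) with (RtoC (Rpower (PI - b) q)) by ring.
rewrite Cmod_R, Rabs_pos_eq by (left; apply Rpower_pos).
replace eps with (Rpower (Rpower eps (/ q)) q).
- apply Rlt_Rpower_l; [assumption|]. lra.
- rewrite Rpower_mult, Rinv_l, Rpower_1 by lra. reflexivity.
Qed.

Lemma CR_int_majorant_bound (f : R -> C) (K p a b : R) (l : C) : -1 < p -> 0 <= K -> 0 <= a <= b -> b < PI ->
  (forall t, 0 <= t < PI -> Cmod (f t) <= K * Rpower (PI - t) p) ->
  CR_int f a b l -> Cmod l <= K * (Rpower (PI - a) (p + 1) / (p + 1)).
Proof.
intros Hp HK Hab HbP Hf Hl.
assert (HI := is_RInt_majorant p a b Hp ltac:(lra)).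
apply (is_RInt_scal (V := R_NormedModule) _ _ _ K) in HI.
eapply Rle_trans; [apply (CR_int_bound f _ a b l _ ltac:(lra) ltac:(intros x Hx; apply Hf; lra) Hl HI)|].
change (K * ((Rpower (PI - a) (p + 1) - Rpower (PI - b) (p + 1)) / (p + 1)) <=
  K * (Rpower (PI - a) (p + 1) / (p + 1))).
apply Rmult_le_compat_l; [assumption|]. apply Rmult_le_compat_r.
- left. apply Rinv_0_lt_compat. lra.
- generalize (Rpower_pos (PI - b) (p + 1)). lra.
Qed.

(** Cauchy's criterion as the bound tends to pi: increments of the primitive beyond a are at most K
    (pi - a)^(p+1)/(p+1), which tends to 0 because p > -1. *)
Lemma imp_int_ex_majorant (f : R -> C) (K p : R) : -1 < p -> 0 <= K ->
  (forall t, 0 <= t < PI -> exists d, CR_derive f t d) ->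
  (forall t, 0 <= t < PI -> Cmod (f t) <= K * Rpower (PI - t) p) ->
  exists l, imp_int f l.
Proof.
intros Hp HK Hd Hf.
assert (Hex : forall a b, 0 <= a <= b -> b < PI -> exists l, CR_int f a b l).
{ intros a b Hab HbP. apply CR_int_ex; [lra|]. intros x Hx. apply Hd. lra. }
set (Phi := fun b => RInt (V := C_R_CompleteNormedModule) f 0 b).
assert (HPhi : forall b, 0 <= b < PI -> CR_int f 0 b (Phi b)).
{ intros b Hb. apply (RInt_correct (V := C_R_CompleteNormedModule)). apply Hex; lra. }
assert (Hdiff : forall a b, 0 <= a <= b -> b < PI ->
  Cmod (Phi b - Phi a) <= K * (Rpower (PI - a) (p + 1) / (p + 1))).
{ intros a b Hab HbP. destruct (Hex a b Hab HbP) as [l Hl].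
  replace (Phi b - Phi a) with l.
  - apply (CR_int_majorant_bound f K p a b l); assumption.
  - assert (H := is_RInt_Chasles (V := C_R_CompleteNormedModule) _ _ _ _ _ _ (HPhi a ltac:(lra)) Hl).
    rewrite (CR_int_unique _ _ _ _ _ (HPhi b ltac:(lra)) H).
    change (l = Phi a + l - Phi a). ring. }
destruct (tends_cauchy (F := at_left PI) Phi) as [l Hl].
- intros eps He.
  assert (Hp1 : 0 < p + 1) by lra.
  assert (HT := tends_scal (F := at_left PI) (RtoC (K / (p + 1))) _ _ (Rpower_tends_0 (p + 1)%R Hp1)).
  specialize (HT eps He).
  destruct (proj2 (at_left_PI _) HT) as [d [Hd0 HTd]].
  exists (fun b => Rmax 0 (PI - d) < b < PI). split.
  + apply at_left_PI. exists (Rmin PI d). split; [apply Rmin_pos; [apply PI_RGT_0|assumption]|].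
    intros b Hb. split; [|lra]. apply Rmax_lub_lt.
    * generalize (Rmin_l PI d). lra.
    * generalize (Rmin_r PI d). lra.
  + assert (W : forall x y, Rmax 0 (PI - d) < x < PI -> Rmax 0 (PI - d) < y < PI -> x <= y ->
      Cmod (Phi y - Phi x) < eps).
    { intros x y Hx Hy Hxy.
      generalize (Rmax_l 0 (PI - d)) (Rmax_r 0 (PI - d)). intros M1 M2.
      eapply Rle_lt_trans; [apply Hdiff; lra|].
      assert (H := HTd x ltac:(lra)).
      replace (RtoC (K / (p + 1)) * RtoC (Rpower (PI - x) (p + 1)) - RtoC (K / (p + 1)) * 0)
        with (RtoC (K * (Rpower (PI - x) (p + 1) / (p + 1)))) in H.
      2: { rewrite <- RtoC_mult. replace (RtoC (K / (p + 1)) * 0) with (RtoC 0) by ring.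
        rewrite <- RtoC_minus. f_equal. field. lra. }
      rewrite Cmod_R in H. generalize (Rle_abs (K * (Rpower (PI - x) (p + 1) / (p + 1)))). lra. }
    intros x y Hx Hy. destruct (Rle_dec x y) as [H|H].
    * replace (Phi x - Phi y) with (- (Phi y - Phi x)) by ring. rewrite Cmod_opp. auto.
    * apply W; try assumption. lra.
- exists l, Phi. split; assumption.
Qed.

(** The power is monotone in t, in a direction given by the sign of p, so its maximum over [0, b] is
    at an endpoint; the sum of both endpoint values covers both signs. *)
Lemma Rpower_majorant_le (p b t : R) : 0 <= t <= b -> b < PI ->
  Rpower (PI - t) p <= Rpower PI p + Rpower (PI - b) p.
Proof.
intros Ht Hb.
assert (H1 := Rpower_pos PI p). assert (H2 := Rpower_pos (PI - b) p).
assert (E : forall x y, 0 < x <= y -> ln x <= ln y).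
{ intros x y [Hx [Hy|Hy]]; [left; apply ln_increasing; assumption|rewrite Hy; lra]. }
assert (X : forall x y, x <= y -> exp x <= exp y).
{ intros x y [Hx|Hx]; [left; apply exp_increasing, Hx|rewrite Hx; lra]. }
destruct (Rle_dec 0 p) as [Hp|Hp].
- assert (Rpower (PI - t) p <= Rpower PI p); [|lra].
  apply X. apply Rmult_le_compat_l; [assumption|]. apply E. lra.
- assert (Rpower (PI - t) p <= Rpower (PI - b) p); [|lra].
  apply X. assert (ln (PI - b) <= ln (PI - t)) by (apply E; lra). nra.
Qed.

(** On [0, b] with b < pi the majorant is bounded, so the convergence is uniform and integration is
    termwise. Letting b tend to pi is then an exchange of limit and sum, under a majorant
    independent of b. *)
Lemma imp_int_series (f : nat -> R -> C) (g : R -> C) (L : nat -> C) (M : nat -> R) (p : R) :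
  -1 < p -> summable M ->
  (forall k t, 0 <= t < PI -> Cmod (f k t) <= M k * Rpower (PI - t) p) ->
  (forall k, imp_int (f k) (L k)) ->
  (forall t, 0 <= t < PI -> csums (fun k => f k t) (g t)) ->
  exists l, csums L l /\ imp_int g l.
Proof.
intros Hp HM Hf HL Hg.
assert (HM0 : forall k, 0 <= M k) by apply HM.
set (Phi := fun k b => RInt (V := C_R_CompleteNormedModule) (f k) 0 b).
assert (HPhi : forall k b, 0 <= b < PI -> CR_int (f k) 0 b (Phi k b)).
{ intros k b Hb. apply (RInt_correct (V := C_R_CompleteNormedModule)).
  destruct (HL k) as [Psi [H _]]. exists (Psi b). apply H, Hb. }
assert (HPhiL : forall k, tends (at_left PI) (Phi k) (L k)).
{ intros k. destruct (HL k) as [Psi [H1 H2]].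
  apply tends_ext_loc with Psi; [|assumption]. apply at_left_PI_pos.
  intros b Hb. apply (CR_int_unique (f k) 0 b); auto. }
set (H := (Rpower PI (p + 1) / (p + 1))%R).
assert (HH : 0 <= H).
{ apply Rmult_le_pos; [left; apply Rpower_pos|left; apply Rinv_0_lt_compat; lra]. }
assert (Hbd : forall k b, 0 <= b < PI -> Cmod (Phi k b) <= H * M k).
{ intros k b Hb. rewrite Rmult_comm.
  assert (X := CR_int_majorant_bound (f k) (M k) p 0 b (Phi k b) Hp (HM0 k) ltac:(lra) ltac:(lra)
    (Hf k) (HPhi k b Hb)).
  rewrite Rminus_0_r in X. exact X. }
assert (HMH : summable (fun k => H * M k)%R) by (apply summable_scal; assumption).
assert (HLb : forall k, Cmod (L k) <= H * M k).
{ intros k. apply (tends_Cmod_le (F := at_left PI) (Phi k)); [|apply HPhiL].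
  apply at_left_PI_pos. intros b Hb. apply Hbd, Hb. }
destruct (csums_ex L _ HLb HMH) as [l Hl].
exists l. split; [assumption|].
assert (Hint : forall b, 0 <= b < PI -> exists I, csums (fun k => Phi k b) I /\ CR_int g 0 b I).
{ intros b Hb.
  (* [filterlim_RInt] asks for uniform convergence on the whole line, hence the truncation to
     [0, b]. *)
  set (clip := fun (h : R -> C) (t : R) => if Rle_dec 0 t then if Rle_dec t b then h t else 0 else 0).
  assert (Hclip : forall h t, 0 <= t <= b -> clip h t = h t).
  { intros h t Ht. unfold clip. destruct (Rle_dec 0 t); [|lra]. destruct (Rle_dec t b); [|lra]. reflexivity. }
  destruct (csums_ex (fun k => Phi k b) _ (fun k => Hbd k b Hb) HMH) as [I HI].
  exists I. split; [assumption|].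
  set (K := (Rpower PI p + Rpower (PI - b) p)%R).
  assert (HK : 0 < K) by (apply Rplus_lt_0_compat; apply Rpower_pos).
  destruct (filterlim_RInt (V := C_R_CompleteNormedModule)
    (fun n => clip (fun t => psum (fun k => f k t) n)) 0 b eventually _ (clip g)
    (fun n => psum (fun k => Phi k b) n)) as [I' [HI1 HI2]].
  - intros n. apply CR_int_ext with (fun t => psum (fun k => f k t) n); [lra| |].
    + intros t Ht. symmetry. apply Hclip. lra.
    + induction n as [|n IH]; simpl.
      * apply CR_int_zero.
      * apply CR_int_plus; [exact IH|]. apply HPhi, Hb.
  - apply filterlim_locally. intros eps.
    destruct (summable_tail M HM (eps / (2 * K))%R) as [N HN].
    { apply Rdiv_lt_0_compat; [apply cond_pos|lra]. }
    exists N. intros n Hn t.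
    assert (Hpos := cond_pos eps).
    assert (HC : Cmod (clip (fun t => psum (fun k => f k t) n) t - clip g t) < eps).
    { unfold clip. destruct (Rle_dec 0 t) as [H0t|H0t].
      2: { replace (0 - 0) with (RtoC 0) by ring. rewrite Cmod_0. apply cond_pos. }
      destruct (Rle_dec t b) as [Htb|Htb].
      2: { replace (0 - 0) with (RtoC 0) by ring. rewrite Cmod_0. apply cond_pos. }
      replace (psum (fun k => f k t) n - g t) with (- (g t - psum (fun k => f k t) n)) by ring.
      rewrite Cmod_opp.
      apply Rle_lt_trans with (eps / 2)%R; [|lra].
      apply (csums_tail_le (fun k => f k t) (fun k => M k * K)%R); [| |apply Hg; lra].
      - intros k. eapply Rle_trans; [apply Hf; lra|]. apply Rmult_le_compat_l; [apply HM0|].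
        apply Rpower_majorant_le; lra.
      - intros m Hm.
        assert (E : forall j, rsum (fun k => M k * K)%R j = (rsum M j * K)%R).
        { intros j. induction j as [|j IH]; simpl; [ring|]. rewrite IH. ring. }
        rewrite !E, <- Rmult_minus_distr_r.
        apply Rle_trans with (eps / (2 * K) * K)%R.
        + apply Rmult_le_compat_r; [lra|]. left. apply HN; lia.
        + right. field. lra. }
    apply (norm_compat1 (K := R_AbsRing) (V := C_R_NormedModule)).
    rewrite norm_CR. exact HC.
  - replace I with I'.
    + apply CR_int_ext with (clip g); [lra| |exact HI2]. intros t Ht. apply Hclip. lra.
    + apply (tends_unique (F := eventually) (psum (fun k => Phi k b))); [|exact HI].
      apply tends_filterlim; [typeclasses eauto|exact HI1]. }
exists (fun b => RInt (V := C_R_CompleteNormedModule) g 0 b).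
assert (HG : forall b, 0 <= b < PI -> CR_int g 0 b (RInt (V := C_R_CompleteNormedModule) g 0 b)).
{ intros b Hb. apply (RInt_correct (V := C_R_CompleteNormedModule)).
  destruct (Hint b Hb) as [I [_ HI]]. exists I. exact HI. }
split; [exact HG|].
apply (tannery (at_left PI) (fun b k => Phi k b) _ L l _ HMH); try assumption.
apply at_left_PI_pos. intros b Hb. split; [intros k; apply Hbd, Hb|].
destruct (Hint b Hb) as [I [HI1 HI2]].
rewrite (CR_int_unique _ _ _ _ _ (HG b Hb) HI2). exact HI1.
Qed.

(** * The integrals of (1 + cos t)^s cos (mu t) *)

Definition pw (s : C) (t : R) : C := Cexp (s * ln (1 + cos t)).

Definition kern (s mu : C) (t : R) : C := pw s t * Ccos (mu * t).

Lemma one_plus_cos (t : R) : (1 + cos t = 2 * (cos (t / 2)) ^ 2)%R.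
Proof.
replace t with (2 * (t / 2))%R at 1 by field. rewrite cos_2a_cos. ring.
Qed.

Lemma one_minus_cos (t : R) : (1 - cos t = 2 * (sin (t / 2)) ^ 2)%R.
Proof.
replace t with (2 * (t / 2))%R at 1 by field. rewrite cos_2a_sin. ring.
Qed.

Lemma cos_half_pos (t : R) : 0 <= t < PI -> 0 < cos (t / 2).
Proof. intros Ht. assert (H := PI_RGT_0). apply cos_gt_0; lra. Qed.

Lemma one_plus_cos_pos (t : R) : 0 <= t < PI -> 0 < 1 + cos t.
Proof.
intros Ht. rewrite one_plus_cos. generalize (pow_lt _ 2 (cos_half_pos t Ht)). lra.
Qed.

(** For y >= 0 the Taylor polynomial y - y^3/6 is at least y/3 exactly as long as y <= 2. *)
Lemma sin_ge_third (y : R) : 0 <= y <= 2 -> y / 3 <= sin y.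
Proof.
intros Hy. destruct (pre_sin_bound y 0 ltac:(lra) ltac:(lra)) as [H _].
eapply Rle_trans; [|exact H]. unfold sin_approx, sin_term. simpl.
assert (H2 : y * y <= 4) by nra.
assert (E : (y / 3 <= y - y * (y * y) / 6)) by nra.
lra.
Qed.

Lemma CR_derive_pw (s : C) (t : R) : 0 <= t < PI ->
  CR_derive (pw s) t (s * RtoC (- sin t / (1 + cos t)) * pw s t).
Proof.
intros Ht. assert (Hp := one_plus_cos_pos t Ht).
apply CR_derive_Cexp, CR_derive_scal, CR_derive_RtoC.
auto_derive; [exact Hp|]. field. lra.
Qed.

Lemma kern_derivable (s mu : C) (t : R) : 0 <= t < PI -> exists d, CR_derive (kern s mu) t d.
Proof.
intros Ht. eexists. apply CR_derive_mult; [apply CR_derive_pw, Ht|apply CR_derive_Ccos].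
Qed.

Lemma Cmod_pw (s : C) (t : R) : Cmod (pw s t) = exp (Re s * ln (1 + cos t)).
Proof. unfold pw. rewrite Cmod_Cexp. f_equal. unfold Re, Cmult, RtoC. simpl. ring. Qed.

Lemma exp_le_compat (x y : R) : x <= y -> exp x <= exp y.
Proof. intros [H|H]; [left; apply exp_increasing, H|rewrite H; lra]. Qed.

Lemma ln_le_compat (x y : R) : 0 < x -> x <= y -> ln x <= ln y.
Proof. intros Hx [H|H]; [left; apply ln_increasing; assumption|rewrite H; lra]. Qed.

Lemma cos_half_bounds (t : R) : 0 <= t < PI ->
  (PI - t) / 6 <= cos (t / 2) <= (PI - t) / 2.
Proof.
intros Ht. assert (HP := PI_4).
(* A cosine near pi/2 becomes a sine near 0; its argument (pi - t)/2 is at most 2 because pi <=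
   4. *)
replace (cos (t / 2)) with (sin ((PI - t) / 2)).
2: { rewrite <- (sin_shift (t / 2)). f_equal. field. }
split.
- assert (H := sin_ge_third ((PI - t) / 2) ltac:(lra)). lra.
- left. apply sin_lt_x. lra.
Qed.

(** With x = pi - t, the bounds x/6 <= cos (t/2) <= x/2 place 1 + cos t = 2 cos^2 (t/2) between
    x^2/18 and x^2; the sign of Re s decides which side is used. The exponent 2 Re s is the source
    of the condition Re s > -1/2 below. *)
Lemma Cmod_pw_majorant (s : C) (t : R) : 0 <= t < PI ->
  Cmod (pw s t) <= exp (Rabs (Re s) * ln 18) * Rpower (PI - t) (2 * Re s).
Proof.
intros Ht. rewrite Cmod_pw. unfold Rpower. rewrite <- exp_plus. apply exp_le_compat.
destruct (cos_half_bounds t Ht) as [H1 H2].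
set (x := (PI - t)%R) in *. assert (Hx : 0 < x) by (unfold x; lra).
rewrite one_plus_cos. set (c := cos (t / 2)) in *.
assert (Hc : 0 < c) by lra.
assert (Hl : ln (2 * c ^ 2) <= 2 * ln x).
{ replace (2 * ln x)%R with (ln (x ^ 2)) by (rewrite ln_pow by assumption; simpl; ring).
  apply ln_le_compat; nra. }
assert (Hu : 2 * ln x <= ln (2 * c ^ 2) + ln 18).
{ replace (2 * ln x)%R with (ln (x ^ 2)) by (rewrite ln_pow by assumption; simpl; ring).
  rewrite <- ln_mult by nra. apply ln_le_compat; nra. }
destruct (Rle_dec 0 (Re s)) as [Hs|Hs].
- rewrite Rabs_pos_eq by assumption.
  assert (0 <= ln 18) by (rewrite <- ln_1; apply ln_le_compat; lra). nra.
- rewrite Rabs_left by lra. nra.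
Qed.

Lemma Cmod_Ccos_mult_le (mu : C) (t : R) : 0 <= t < PI ->
  Cmod (Ccos (mu * t)) <= exp (Cmod mu * PI).
Proof.
intros Ht. eapply Rle_trans; [apply Cmod_Ccos_le|]. apply exp_le_compat.
rewrite Cmod_mult, Cmod_R, Rabs_pos_eq by lra.
apply Rmult_le_compat_l; [apply Cmod_ge_0|lra].
Qed.

Lemma Cmod_kern_majorant (s mu : C) (t : R) : 0 <= t < PI ->
  Cmod (kern s mu t) <= exp (Rabs (Re s) * ln 18) * exp (Cmod mu * PI) * Rpower (PI - t) (2 * Re s).
Proof.
intros Ht. unfold kern. rewrite Cmod_mult.
assert (H1 := Cmod_pw_majorant s t Ht). assert (H2 := Cmod_Ccos_mult_le mu t Ht).
assert (H := Rmult_le_compat _ _ _ _ (Cmod_ge_0 _) (Cmod_ge_0 _) H1 H2). lra.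
Qed.

(** For Re s > -1/2 this is Cauchy's integral, with closed form pi Gamma(2s + 1) / (2^s Gamma(1 + s
    + mu) Gamma(1 + s - mu)). The evaluations below concern s - mu integral. *)
Definition Beta (s mu : C) : C := Cint_0_pi (kern s mu).

Lemma Beta_int (s mu : C) : - (1 / 2) < Re s -> imp_int (kern s mu) (Beta s mu).
Proof.
intros Hs.
destruct (imp_int_ex_majorant (kern s mu) (exp (Rabs (Re s) * ln 18) * exp (Cmod mu * PI)) (2 * Re s))
  as [l Hl].
- lra.
- left. apply Rmult_lt_0_compat; apply exp_pos.
- intros t Ht. apply kern_derivable, Ht.
- intros t Ht. apply Cmod_kern_majorant, Ht.
- unfold Beta. rewrite (imp_int_eq _ _ Hl). exact Hl.
Qed.

Lemma Beta_opp (s mu : C) : Beta s (- mu) = Beta s mu.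
Proof.
unfold Beta. f_equal. apply functional_extensionality. intros t. unfold kern. f_equal.
replace (- mu * t) with (- (mu * t)) by ring. apply Ccos_opp.
Qed.

Lemma Cexp_Ci (w : C) : Cexp (Ci * w) = Ccos w + Ci * Csin w.
Proof. unfold Ccos, Csin. field. apply Ci_neq_0. Qed.

Lemma Cexp_Ci_opp (w : C) : Cexp (- (Ci * w)) = Ccos w - Ci * Csin w.
Proof. unfold Ccos, Csin. field. apply Ci_neq_0. Qed.

Lemma Ccos_plus (a b : C) : Ccos (a + b) = Ccos a * Ccos b - Csin a * Csin b.
Proof.
unfold Ccos at 1. replace (- (Ci * (a + b))) with (- (Ci * a) + - (Ci * b)) by ring.
replace (Ci * (a + b)) with (Ci * a + Ci * b) by ring.
rewrite !Cexp_plus, !Cexp_Ci, !Cexp_Ci_opp.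
replace (Ccos a * Ccos b - Csin a * Csin b) with
  (Ccos a * Ccos b + (Ci * Ci) * (Csin a * Csin b)) by (rewrite Ci2; ring).
field.
Qed.

Lemma Csin_opp (w : C) : Csin (- w) = - Csin w.
Proof.
unfold Csin. replace (- (Ci * - w)) with (Ci * w) by ring.
replace (Ci * - w) with (- (Ci * w)) by ring. unfold Cdiv. ring.
Qed.

Lemma Ccos_minus (a b : C) : Ccos (a - b) = Ccos a * Ccos b + Csin a * Csin b.
Proof. unfold Cminus. rewrite Ccos_plus, Ccos_opp, Csin_opp. ring. Qed.

Lemma Cexp_Ci_RtoC (x : R) : Cexp (Ci * x) = RtoC (cos x) + Ci * RtoC (sin x).
Proof.
unfold Cexp, Ci, RtoC, Cmult, Cplus, Re, Im. simpl.
replace (0 * x - 1 * 0)%R with 0%R by ring. replace (0 * 0 + 1 * x)%R with x by ring.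
rewrite exp_0. f_equal; ring.
Qed.

Lemma Cexp_Ci_RtoC_opp (x : R) : Cexp (- (Ci * x)) = RtoC (cos x) - Ci * RtoC (sin x).
Proof.
replace (- (Ci * x)) with (Ci * RtoC (- x)) by (rewrite RtoC_opp; ring).
rewrite Cexp_Ci_RtoC, cos_neg, sin_neg, RtoC_opp. ring.
Qed.

Lemma Ccos_RtoC (x : R) : Ccos x = RtoC (cos x).
Proof. unfold Ccos. rewrite Cexp_Ci_RtoC, Cexp_Ci_RtoC_opp. field. Qed.

Lemma Csin_RtoC (x : R) : Csin x = RtoC (sin x).
Proof. unfold Csin. rewrite Cexp_Ci_RtoC, Cexp_Ci_RtoC_opp. field. apply Ci_neq_0. Qed.

(** mu t and (mu - 1) t are (mu - 1/2) t plus and minus t/2, so differentiating this half-angle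
    expression yields only the two kernels. The factor cos (t/2) cancels the pole at pi of the
    logarithmic derivative -s tan (t/2) of (1 + cos t)^s. *)
Lemma CR_derive_contiguity (s mu : C) (t : R) : 0 <= t < PI ->
  CR_derive (fun t : R => pw s t * RtoC (cos (t / 2)) * Csin ((mu - / 2) * t)) t
    ((mu + s) / 2 * kern s mu t + (mu - 1 - s) / 2 * kern s (mu - 1) t).
Proof.
intros Ht.
assert (Hp := one_plus_cos_pos t Ht). assert (Hc := cos_half_pos t Ht).
eapply CR_derive_eq.
2: { apply CR_derive_mult; [|apply CR_derive_Csin].
  apply CR_derive_mult; [apply CR_derive_pw, Ht|].
  apply (CR_derive_RtoC (fun x => cos (x / 2)) t (- sin (t / 2) / 2)%R).
  auto_derive; [exact I|]. unfold Rdiv. ring. }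
unfold kern.
replace (mu * t) with ((mu - / 2) * t + RtoC (t / 2)).
2: { rewrite RtoC_div by lra. field. }
replace ((mu - 1) * t) with ((mu - / 2) * t - RtoC (t / 2)).
2: { rewrite RtoC_div by lra. field. }
rewrite Ccos_plus, Ccos_minus, Ccos_RtoC, Csin_RtoC.
replace (- sin t / (1 + cos t))%R with (- (sin (t / 2) / cos (t / 2)))%R.
2: { rewrite one_plus_cos. replace (sin t) with (2 * sin (t / 2) * cos (t / 2))%R.
  - field. lra.
  - rewrite <- sin_2a. f_equal. field. }
assert (Hc' : RtoC (cos (t / 2)) <> 0) by (intros E; apply RtoC_inj in E; lra).
rewrite RtoC_opp, !RtoC_div, RtoC_opp by lra. field. exact Hc'.
Qed.

Lemma tends_0_le {T : Type} (F : (T -> Prop) -> Prop) {FF : Filter F} (f : T -> C) (g : T -> R) :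
  F (fun x => Cmod (f x) <= g x) -> tends F (fun x => RtoC (g x)) 0 -> tends F f 0.
Proof.
intros H Hg. apply tends_le with g; [|assumption].
generalize H. apply filter_imp. intros x Hx.
cbn beta in Hx. replace (f x - 0) with (f x) by ring. exact Hx.
Qed.

Lemma Cmod_Csin_le (w : C) : Cmod (Csin w) <= exp (Cmod w).
Proof.
unfold Csin. replace ((Cexp (Ci * w) - Cexp (- (Ci * w))) / (2 * Ci)) with
  (- Ci * ((Cexp (Ci * w) + - Cexp (- (Ci * w))) / 2)).
2: { rewrite <- Ci_inv. field. apply Ci_neq_0. }
replace (- Ci * ((Cexp (Ci * w) + - Cexp (- (Ci * w))) / 2)) with
  (Ci * - ((Cexp (Ci * w) + - Cexp (- (Ci * w))) / 2)) by ring.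
rewrite Cmod_Ci_mult, Cmod_opp.
apply Cmod_half; rewrite ?Cmod_opp; eapply Rle_trans; try apply Cmod_Cexp_le;
rewrite ?Cmod_opp, Cmod_Ci_mult; lra.
Qed.

Lemma Csin_0 : Csin 0 = 0.
Proof. rewrite Csin_RtoC, sin_0. reflexivity. Qed.

(** The primitive of [CR_derive_contiguity] has no boundary terms: its sine vanishes at 0, and near
    pi it is O((pi - b)^(2 Re s + 1)), cos (t/2) gaining the missing power. *)
Lemma Beta_contiguous (s mu : C) : - (1 / 2) < Re s ->
  (s + 1 - mu) * Beta s (mu - 1) = (s + mu) * Beta s mu.
Proof.
intros Hs.
set (F := fun t : R => pw s t * RtoC (cos (t / 2)) * Csin ((mu - / 2) * t)).
assert (H0 : imp_int (fun t => (mu + s) / 2 * kern s mu t + (mu - 1 - s) / 2 * kern s (mu - 1) t) 0).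
{ exists F. split.
  - intros b Hb. replace (F b) with (F b - F 0%R).
    + apply CR_int_FTC; [lra| |].
      * intros x Hx. exact (CR_derive_contiguity s mu x (conj (proj1 Hx) (Rle_lt_trans _ _ _ (proj2 Hx) (proj2 Hb)))).
      * intros x Hx.
        destruct (kern_derivable s mu x ltac:(lra)) as [d1 H1].
        destruct (kern_derivable s (mu - 1) x ltac:(lra)) as [d2 H2].
        eexists. apply CR_derive_plus; apply CR_derive_scal; eassumption.
    + unfold F at 2. replace ((mu - / 2) * 0%R) with (RtoC 0) by ring. rewrite Csin_0. ring.
  - set (K := (exp (Rabs (Re s) * ln 18) * exp (Cmod (mu - / 2) * PI))%R).
    apply (tends_0_le (at_left PI) F (fun b => K * Rpower (PI - b) (2 * Re s + 1))%R).
    + apply at_left_PI_pos. intros b Hb. unfold F. rewrite !Cmod_mult.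
      destruct (cos_half_bounds b Hb) as [_ Hc]. assert (Hc0 := cos_half_pos b Hb).
      rewrite Cmod_R, Rabs_pos_eq by lra.
      assert (H1 := Cmod_pw_majorant s b Hb).
      assert (H2 : Cmod (Csin ((mu - / 2) * b)) <= exp (Cmod (mu - / 2) * PI)).
      { eapply Rle_trans; [apply Cmod_Csin_le|]. apply exp_le_compat.
        rewrite Cmod_mult, Cmod_R, Rabs_pos_eq by lra.
        apply Rmult_le_compat_l; [apply Cmod_ge_0|lra]. }
      rewrite Rpower_plus, Rpower_1 by lra.
      assert (H3 : Cmod (pw s b) * cos (b / 2) <= exp (Rabs (Re s) * ln 18) * Rpower (PI - b) (2 * Re s) * (PI - b)).
      { apply Rmult_le_compat; [apply Cmod_ge_0|lra|assumption|lra]. }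
      assert (H4 := Rmult_le_compat _ _ _ _
        (Rmult_le_pos _ _ (Cmod_ge_0 (pw s b)) (Rlt_le _ _ Hc0)) (Cmod_ge_0 _) H3 H2).
      unfold K. lra.
    + apply tends_ext with (fun b => RtoC K * RtoC (Rpower (PI - b) (2 * Re s + 1))).
      { intros b. symmetry. apply RtoC_mult. }
      replace (RtoC 0) with (RtoC K * 0) by ring.
      apply tends_scal, Rpower_tends_0. lra. }
assert (E := imp_int_unique _ _ _ H0 (imp_int_plus _ _ _ _
  (imp_int_scal ((mu + s) / 2) _ _ (Beta_int s mu Hs))
  (imp_int_scal ((mu - 1 - s) / 2) _ _ (Beta_int s (mu - 1) Hs)))).
replace ((s + 1 - mu) * Beta s (mu - 1)) with
  ((s + mu) * Beta s mu - 2 * ((mu + s) / 2 * Beta s mu + (mu - 1 - s) / 2 * Beta s (mu - 1))) by field.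
rewrite <- E. ring.
Qed.

Lemma pw_plus (s s' : C) (t : R) : pw (s + s') t = pw s t * pw s' t.
Proof.
unfold pw. rewrite <- Cexp_plus. f_equal. ring.
Qed.

Lemma pw_1 (t : R) : 0 <= t < PI -> pw 1 t = RtoC (1 + cos t).
Proof.
intros Ht. unfold pw. replace (1 * ln (1 + cos t)) with (RtoC (ln (1 + cos t))) by ring.
rewrite Cexp_RtoC, exp_ln by (apply one_plus_cos_pos, Ht). reflexivity.
Qed.

Lemma Re_plus_1 (s : C) : Re (s + 1) = (Re s + 1)%R.
Proof. reflexivity. Qed.

Lemma Beta_S (s mu : C) : - (1 / 2) < Re s ->
  Beta (s + 1) mu = Beta s mu + / 2 * (Beta s (mu + 1) + Beta s (mu - 1)).
Proof.
intros Hs.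
apply (imp_int_unique (kern (s + 1) mu)).
- apply Beta_int. rewrite Re_plus_1. lra.
- apply imp_int_ext with (fun t => kern s mu t + / 2 * (kern s (mu + 1) t + kern s (mu - 1) t)).
  + intros t Ht. unfold kern. rewrite pw_plus, pw_1 by lra.
    replace ((mu + 1) * t) with (mu * t + t) by ring.
    replace ((mu - 1) * t) with (mu * t - t) by ring.
    rewrite Ccos_plus, Ccos_minus, Ccos_RtoC, RtoC_plus. field.
  + apply imp_int_plus; [|apply imp_int_scal, imp_int_plus]; apply Beta_int; assumption.
Qed.

Lemma Re_neq_0 (w : C) : Re w <> 0%R -> w <> 0.
Proof. intros H E. apply H. rewrite E. reflexivity. Qed.

(** At mu = s + 1 the left coefficient of the contiguity relation vanishes while the right one has
    real part 2 Re s + 1 > 0; the zero then propagates upwards. *)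
Lemma Beta_above (s : C) (q : nat) : - (1 / 2) < Re s -> Beta s (s + 1 + INR q) = 0.
Proof.
intros Hs. induction q as [|q IH].
- assert (E := Beta_contiguous s (s + 1) Hs).
  replace (s + 1 - (s + 1)) with (RtoC 0) in E by ring. rewrite Cmult_0_l in E.
  symmetry in E. apply Cmult_integral in E. destruct E as [E|E].
  + exfalso. revert E. apply Re_neq_0, Rgt_not_eq. unfold Re, Cplus, RtoC in *. simpl fst in *. lra.
  + simpl (INR 0). replace (s + 1 + 0) with (s + 1) by ring. exact E.
- assert (E := Beta_contiguous s (s + 1 + INR (S q)) Hs).
  replace (s + 1 + INR (S q) - 1) with (s + 1 + INR q) in E by (rewrite S_INR, RtoC_plus; ring).
  rewrite IH, Cmult_0_r in E. symmetry in E. apply Cmult_integral in E.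
  destruct E as [E|E]; [|exact E]. exfalso. revert E. apply Re_neq_0, Rgt_not_eq.
  assert (Hq := pos_INR (S q)).
  change (Re s + (Re s + 1 + INR (S q)) > 0). lra.
Qed.

Fixpoint ffact (x : C) (p : nat) : C :=
  match p with O => 1 | S j => ffact x j * (x - INR j) end.

(** Contiguity read downwards from the diagonal; the coefficients accumulate to the generalised
    binomial coefficient of 2s over p. *)
Lemma Beta_below (s : C) (p : nat) : - (1 / 2) < Re s ->
  Beta s (s - INR p) = ffact (2 * s) p / INR (fact p) * Beta s s.
Proof.
intros Hs. induction p as [|p IH].
- simpl. replace (s - 0) with s by ring. field.
- assert (E := Beta_contiguous s (s - INR p) Hs).
  replace (s - INR p - 1) with (s - INR (S p)) in E by (rewrite S_INR, RtoC_plus; ring).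
  replace (s + 1 - (s - INR p)) with (RtoC (INR (S p))) in E by (rewrite S_INR, RtoC_plus; ring).
  assert (HN : RtoC (INR (S p)) <> 0) by (apply RtoC_INR_neq_0; lia).
  replace (Beta s (s - INR (S p))) with (INR (S p) * Beta s (s - INR (S p)) / INR (S p)) by (field; assumption).
  rewrite E, IH, fact_simpl, mult_INR, RtoC_mult. simpl ffact. field.
  split; [apply Cfact_neq_0|assumption].
Qed.

Lemma Beta_diag_S (s : C) : - (1 / 2) < Re s -> Beta (s + 1) (s + 1) = / 2 * Beta s s.
Proof.
intros Hs. rewrite Beta_S by assumption.
replace (s + 1 - 1) with s by ring.
assert (E0 := Beta_above s 0 Hs). assert (E1 := Beta_above s 1 Hs). simpl in E0, E1.
replace (s + 1 + 0) with (s + 1) in E0 by ring. rewrite E0, E1. ring.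
Qed.

(** Evenness in mu identifies the two neighbours of mu = 0, so contiguity closes up into Wallis's
    recurrence. *)
Lemma Beta_mu_0 (s : C) : - (1 / 2) < Re s -> (s + 1) * Beta (s + 1) 0 = (2 * s + 1) * Beta s 0.
Proof.
intros Hs. rewrite Beta_S by assumption.
assert (E := Beta_contiguous s 0 Hs).
replace (0 - 1) with (- (1)) in * by ring. replace (0 + 1) with (RtoC 1) by ring.
rewrite Beta_opp in *.
replace (s + 1 - 0) with (s + 1) in E by ring.
replace ((s + 1) * (Beta s 0 + / 2 * (Beta s 1 + Beta s 1))) with
  ((s + 1) * Beta s 0 + (s + 1) * Beta s 1) by field.
rewrite E. ring.
Qed.

Lemma imp_int_le (f : R -> C) (g : R -> R) (l : C) (m : R) :
  (forall t, 0 <= t < PI -> Cmod (f t) <= g t) ->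
  imp_int f l -> imp_int (fun t => RtoC (g t)) (RtoC m) -> Cmod l <= m.
Proof.
intros H [F [F1 F2]] [G [G1 G2]].
apply Rnot_lt_le. intros N.
assert (He : 0 < (Cmod l - m) / 2) by lra.
destruct (filter_ex (F := at_left PI) _ (filter_and _ _ (at_left_PI_pos (fun b => 0 <= b < PI) ltac:(auto))
  (filter_and _ _ (F2 _ He) (G2 _ He)))) as [b [Hb [H1 H2]]].
assert (H3 : Cmod (F b) <= Re (G b)).
{ destruct (proj1 (CR_int_parts _ _ _ _) (G1 b Hb)) as [HG _].
  apply (CR_int_bound f g 0 b (F b) (Re (G b)) ltac:(lra)); [|apply F1, Hb|exact HG].
  intros x Hx. apply H. lra. }
assert (H4 := Cmod_triangle (F b) (- (F b - l))). rewrite Cmod_opp in H4.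
replace (F b + - (F b - l)) with l in H4 by ring.
assert (H5 : Re (G b) - m <= Cmod (G b - m)).
{ eapply Rle_trans; [apply Rle_abs|]. apply (re_le_Cmod (G b - m)). }
lra.
Qed.

(** * Laplace's method *)

Lemma sq_le_one_minus_cos (t : R) : 0 <= t < PI -> t ^ 2 <= 18 * (1 - cos t).
Proof.
intros Ht. assert (HP := PI_4). rewrite one_minus_cos.
assert (H := sin_ge_third (t / 2) ltac:(lra)). nra.
Qed.

(** Where cos t <= 0 one has 1 - cos t >= 1 and the trivial bound by twice 2^(Re s) suffices;
    elsewhere ln ((1 + cos t)/2) lies between -(1 - cos t) and 0. The constant adds those of the two
    cases. *)
Lemma pw_near_2 (s : C) (t : R) : 0 <= Re s -> 0 <= t < PI ->
  Cmod (pw s t - Cexp (s * ln 2)) <=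
  exp (Re s * ln 2) * (2 + Cmod s * exp (Cmod s)) * (1 - cos t).
Proof.
intros Hs Ht. assert (Hp := one_plus_cos_pos t Ht). assert (Hc := COS_bound t).
assert (HE : 0 < exp (Re s * ln 2)) by apply exp_pos.
assert (HsE : 0 <= Cmod s * exp (Cmod s)).
{ apply Rmult_le_pos; [apply Cmod_ge_0|left; apply exp_pos]. }
assert (HM2 : Cmod (Cexp (s * ln 2)) = exp (Re s * ln 2)).
{ rewrite Cmod_Cexp. f_equal. unfold Re, Cmult, RtoC. simpl. ring. }
destruct (Rle_dec (cos t) 0) as [Hneg|Hpos].
- apply Rle_trans with (exp (Re s * ln 2) * 2)%R.
  + unfold Cminus. eapply Rle_trans; [apply Cmod_triangle|]. rewrite Cmod_opp, HM2, Cmod_pw.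
    assert (exp (Re s * ln (1 + cos t)) <= exp (Re s * ln 2)).
    { apply exp_le_compat. apply Rmult_le_compat_l; [assumption|]. apply ln_le_compat; lra. }
    lra.
  + rewrite Rmult_assoc. apply Rmult_le_compat_l; [lra|]. nra.
- set (w := s * RtoC (ln ((1 + cos t) / 2))).
  replace (pw s t - Cexp (s * ln 2)) with (Cexp (s * ln 2) * (Cexp w - 1)).
  2: { unfold pw, w. rewrite ln_div, RtoC_minus by lra.
    replace (s * ln (1 + cos t)) with (s * ln 2 + s * (ln (1 + cos t) - ln 2)) by ring.
    rewrite Cexp_plus. ring. }
  rewrite Cmod_mult, HM2, Rmult_assoc. apply Rmult_le_compat_l; [lra|].
  assert (Hl : - (1 - cos t) <= ln ((1 + cos t) / 2) <= 0).
  { split.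
    - assert (H := exp_ge_1p (- ln ((1 + cos t) / 2))).
      rewrite exp_Ropp, exp_ln in H by lra.
      assert (E : (/ ((1 + cos t) / 2) = 1 + (1 - cos t) / (1 + cos t))%R) by (field; lra).
      rewrite E in H.
      assert ((1 - cos t) / (1 + cos t) <= 1 - cos t).
      { apply Rmult_le_reg_r with (1 + cos t)%R; [lra|].
        replace ((1 - cos t) / (1 + cos t) * (1 + cos t))%R with (1 - cos t)%R by (field; lra). nra. }
      lra.
    - rewrite <- ln_1. apply ln_le_compat; lra. }
  assert (Hw : Cmod w <= Cmod s * (1 - cos t)).
  { unfold w. rewrite Cmod_mult, Cmod_R. apply Rmult_le_compat_l; [apply Cmod_ge_0|].
    apply Rabs_le. lra. }
  eapply Rle_trans; [apply Cexp_m1_bound|].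
  apply Rle_trans with (Cmod s * (1 - cos t) * exp (Cmod s))%R.
  + apply Rmult_le_compat; [apply Cmod_ge_0|left; apply exp_pos|assumption|].
    apply exp_le_compat. assert (H := Cmod_ge_0 s). nra.
  + nra.
Qed.

(** The error is a multiple of 1 - cos t rather than of t^2, because 1 - cos t = 2 - (1 + cos t)
    integrates against (1 + cos t)^p to a combination of two Wallis integrals. *)
Lemma kern_near_2 (s mu : C) : 0 <= Re s -> exists K, 0 <= K /\
  forall t, 0 <= t < PI -> Cmod (kern s mu t - Cexp (s * ln 2)) <= K * (1 - cos t).
Proof.
intros Hs.
set (K1 := (exp (Re s * ln 2) * (2 + Cmod s * exp (Cmod s)))%R).
set (K2 := (exp (Re s * ln 2) * (Cmod mu ^ 2 * exp (Cmod mu * PI) * 18))%R).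
assert (HsE : 0 <= Cmod s * exp (Cmod s)).
{ apply Rmult_le_pos; [apply Cmod_ge_0|left; apply exp_pos]. }
assert (HK1 : 0 <= K1) by (apply Rmult_le_pos; [left; apply exp_pos|lra]).
assert (Hmu : 0 <= Cmod mu ^ 2) by apply pow_le, Cmod_ge_0.
assert (HK2 : 0 <= K2).
{ apply Rmult_le_pos; [left; apply exp_pos|]. apply Rmult_le_pos; [|lra].
  apply Rmult_le_pos; [assumption|left; apply exp_pos]. }
exists (K1 + K2)%R. split; [lra|]. intros t Ht.
assert (Hc := COS_bound t). assert (Hp := one_plus_cos_pos t Ht).
unfold kern.
replace (pw s t * Ccos (mu * t) - Cexp (s * ln 2)) with
  ((pw s t - Cexp (s * ln 2)) + pw s t * (Ccos (mu * t) - 1)) by ring.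
eapply Rle_trans; [apply Cmod_triangle|]. rewrite Rmult_plus_distr_r.
apply Rplus_le_compat; [apply pw_near_2; assumption|].
rewrite Cmod_mult. unfold K2. rewrite Rmult_assoc.
apply Rmult_le_compat; try apply Cmod_ge_0.
- rewrite Cmod_pw. apply exp_le_compat, Rmult_le_compat_l; [assumption|]. apply ln_le_compat; lra.
- eapply Rle_trans; [apply Ccos_m1_bound|].
  rewrite Cmod_mult, Cmod_R, Rabs_pos_eq by lra. rewrite Rpow_mult_distr.
  assert (H1 := sq_le_one_minus_cos t Ht).
  assert (H2 : exp (Cmod mu * t) <= exp (Cmod mu * PI)).
  { apply exp_le_compat, Rmult_le_compat_l; [apply Cmod_ge_0|lra]. }
  replace (Cmod mu ^ 2 * exp (Cmod mu * PI) * 18 * (1 - cos t))%R with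
    (Cmod mu ^ 2 * (18 * (1 - cos t)) * exp (Cmod mu * PI))%R by ring.
  apply Rmult_le_compat; [|left; apply exp_pos| |assumption].
  + apply Rmult_le_pos; [assumption|apply pow2_ge_0].
  + apply Rmult_le_compat_l; assumption.
Qed.

(** Equals pi times the central binomial coefficient of 2p over p, divided by 2^p: the integral of
    (1 + cos t)^p over [0, pi]. *)
Fixpoint wallis (p : nat) : R :=
  match p with O => PI | S k => ((2 * INR k + 1) / (INR k + 1) * wallis k)%R end.

Lemma wallis_pos (p : nat) : 0 < wallis p.
Proof.
induction p as [|p IH]; simpl; [apply PI_RGT_0|]. assert (H := pos_INR p).
apply Rmult_lt_0_compat; [apply Rdiv_lt_0_compat; lra|assumption].
Qed.

Lemma Re_INR (p : nat) : Re (RtoC (INR p)) = INR p.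
Proof. reflexivity. Qed.

Lemma Beta_0_0 : Beta 0 0 = RtoC PI.
Proof.
apply (imp_int_unique (kern 0 0)).
- apply Beta_int. simpl. lra.
- apply imp_int_ext with (fun _ : R => RtoC 1).
  + intros t Ht. unfold kern, pw. replace (0 * ln (1 + cos t)) with (RtoC 0) by ring.
    replace (0 * t) with (RtoC 0) by ring. rewrite Cexp_0, Ccos_RtoC, cos_0. ring.
  + exists (fun b => RtoC b). split.
    * intros b Hb. apply CR_int_parts. split.
      -- assert (X := is_RInt_const (V := R_NormedModule) 0 b 1%R).
         change (is_RInt (fun _ => 1%R) 0 b ((b - 0) * 1)%R) in X.
         replace ((b - 0) * 1)%R with b in X by ring. exact X.
      -- assert (X := CR_int_zero 0 b). apply CR_int_parts in X. apply X.
    * intros eps He. apply at_left_PI. exists eps. split; [assumption|].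
      intros b Hb. rewrite <- RtoC_minus, Cmod_R, Rabs_left; lra.
Qed.

Lemma Beta_wallis (p : nat) : Beta (INR p) 0 = RtoC (wallis p).
Proof.
induction p as [|p IH].
- apply Beta_0_0.
- assert (Hp := pos_INR p).
  assert (E := Beta_mu_0 (INR p) ltac:(rewrite Re_INR; lra)).
  assert (HN : RtoC (INR p) + 1 <> 0).
  { rewrite <- RtoC_plus. intros X. apply RtoC_inj in X. lra. }
  rewrite S_INR, RtoC_plus.
  replace (Beta (INR p + 1) 0) with ((INR p + 1) * Beta (INR p + 1) 0 / (INR p + 1)) by (field; assumption).
  rewrite E, IH. cbn [wallis]. rewrite RtoC_mult, RtoC_div, !RtoC_plus, RtoC_mult by lra.
  field. assumption.
Qed.

Lemma pw_INR (p : nat) (t : R) : 0 <= t < PI -> pw (INR p) t = RtoC ((1 + cos t) ^ p).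
Proof.
intros Ht. unfold pw. rewrite Cexp_pow, Cexp_RtoC, exp_ln by (apply one_plus_cos_pos, Ht).
symmetry. apply RtoC_pow.
Qed.

(* Laplace's method: (1 + cos t)^p concentrates at t = 0, and the error is
   measured exactly by wallis (p + 1) / wallis p. *)
Lemma Beta_laplace (s mu : C) : 0 <= Re s ->
  tends eventually (fun p => Beta (s + INR p) mu / RtoC (wallis p)) (Cexp (s * ln 2)).
Proof.
intros Hs. destruct (kern_near_2 s mu Hs) as [K [HK HB]].
apply tends_le with (fun p => K * / INR (S p))%R.
- exists 0%nat. intros p _.
  assert (Hw := wallis_pos p). assert (Hp := pos_INR p).
  assert (Hw' : RtoC (wallis p) <> 0) by (intros E; apply RtoC_inj in E; lra).
  replace (Beta (s + INR p) mu / wallis p - Cexp (s * ln 2)) with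
    ((Beta (s + INR p) mu + - Cexp (s * ln 2) * wallis p) / wallis p) by (field; assumption).
  rewrite Cmod_div, Cmod_R, Rabs_pos_eq by (assumption || lra).
  apply Rmult_le_reg_r with (wallis p); [assumption|].
  unfold Rdiv. rewrite Rmult_assoc, Rinv_l, Rmult_1_r by lra.
  (* By the recurrence, 2 wallis(p) - wallis(p + 1) is wallis(p)/(p + 1), so the relative error is
     K/(p + 1). *)
  replace (K * / INR (S p) * wallis p)%R with (K * (2 * wallis p - wallis (S p)))%R.
  2: { cbn [wallis]. rewrite S_INR. field. lra. }
  apply (imp_int_le (fun t => kern (s + INR p) mu t + - Cexp (s * ln 2) * kern (INR p) 0 t)
    (fun t => K * (2 * (1 + cos t) ^ p - (1 + cos t) ^ S p))%R).
  + intros t Ht.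
    replace (kern (s + INR p) mu t + - Cexp (s * ln 2) * kern (INR p) 0 t) with
      (RtoC ((1 + cos t) ^ p) * (kern s mu t - Cexp (s * ln 2))).
    2: { unfold kern. rewrite pw_plus, pw_INR by assumption.
      replace (0 * t) with (RtoC 0) by ring. rewrite Ccos_RtoC, cos_0. ring. }
    assert (Hp1 := one_plus_cos_pos t Ht).
    assert (Hpp : 0 < (1 + cos t) ^ p) by (apply pow_lt; assumption).
    rewrite Cmod_mult, Cmod_R, Rabs_pos_eq by lra.
    replace (K * (2 * (1 + cos t) ^ p - (1 + cos t) ^ S p))%R with
      ((1 + cos t) ^ p * (K * (1 - cos t)))%R by (simpl; ring).
    apply Rmult_le_compat_l; [lra|]. apply HB, Ht.
  + apply imp_int_plus; [|apply imp_int_scal].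
    * apply Beta_int. change (- (1 / 2) < Re s + INR p). lra.
    * rewrite <- Beta_wallis. apply Beta_int. rewrite Re_INR. lra.
  + assert (X : forall q, imp_int (kern (INR q) 0) (RtoC (wallis q))).
    { intros q. rewrite <- Beta_wallis. apply Beta_int. rewrite Re_INR. generalize (pos_INR q). lra. }
    replace (RtoC (K * (2 * wallis p - wallis (S p)))) with
      (RtoC (2 * K) * RtoC (wallis p) + RtoC (- K) * RtoC (wallis (S p))).
    2: { rewrite <- !RtoC_mult, <- RtoC_plus. f_equal. ring. }
    apply imp_int_ext with (fun t => RtoC (2 * K) * kern (INR p) 0 t + RtoC (- K) * kern (INR (S p)) 0 t).
    * intros t Ht. unfold kern. rewrite !pw_INR by lra.
      replace (0 * t) with (RtoC 0) by ring. rewrite Ccos_RtoC, cos_0.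
      rewrite !Cmult_1_r, <- !RtoC_mult, <- RtoC_plus. f_equal. ring.
    * apply imp_int_plus; apply imp_int_scal, X.
- apply tends_ext with (fun p => RtoC K * / RtoC (INR (S p))).
  + intros p. rewrite RtoC_mult, RtoC_inv by (apply not_0_INR; lia). reflexivity.
  + replace (RtoC 0) with (RtoC K * 0) by ring. apply tends_scal.
    apply (proj2 (tends_S (fun n => / RtoC (INR n)) 0)), tends_inv_INR.
Qed.

Lemma tends_Cexp {T : Type} (F : (T -> Prop) -> Prop) {FF : Filter F} (f : T -> C) (l : C) :
  tends F f l -> tends F (fun x => Cexp (f x)) (Cexp l).
Proof.
intros H.
apply tends_ext with (fun x => Cexp l + Cexp l * (Cexp (f x - l) - 1)).
{ intros x. rewrite Cexp_minus. field. apply Cexp_neq_0. }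
apply (tends_eq _ (Cexp l + Cexp l * 0)); [ring|].
apply tends_plus; [apply tends_const|]. apply tends_scal.
assert (H0 : tends F (fun x => f x - l) 0).
{ replace (RtoC 0) with (l - l) by ring. apply tends_minus; [assumption|apply tends_const]. }
apply (tends_0_le F _ (fun x => exp 1 * Cmod (f x - l))%R).
- generalize (H 1%R Rlt_0_1). apply filter_imp. intros x Hx.
  eapply Rle_trans; [apply Cexp_m1_bound|]. rewrite Rmult_comm.
  apply Rmult_le_compat_r; [apply Cmod_ge_0|]. apply exp_le_compat. lra.
- apply tends_ext with (fun x => RtoC (exp 1) * RtoC (Cmod (f x - l))).
  { intros x. symmetry. apply RtoC_mult. }
  replace (RtoC 0) with (RtoC (exp 1) * 0) by ring. apply tends_scal.
  intros eps He. generalize (H eps He). apply filter_imp. intros x Hx.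
  replace (RtoC (Cmod (f x - l)) - 0) with (RtoC (Cmod (f x - l))) by ring.
  rewrite Cmod_R, Rabs_pos_eq by apply Cmod_ge_0. exact Hx.
Qed.

(** The product from x + 1 to x + 2q + 2 cut in the middle. It expresses the falling factorials of
    [Beta_shift] as quotients of rising products, whose asymptotics Gauss's limit gives. *)
Lemma rising_ffact (x : C) (q : nat) :
  rising (x + 1) (2 * q + 1) = rising (x + 1) q * ffact (x + 2 * INR (S q)) (S q).
Proof.
assert (H : forall m, rising (x + 1) (q + m) = rising (x + 1) q * ffact (x + 1 + INR q + INR m) m).
{ induction m as [|m IH].
  - rewrite Nat.add_0_r. simpl. ring.
  - rewrite Nat.add_succ_r. cbn [rising]. rewrite IH.
    assert (E : forall y n, ffact (y + 1) (S n) = (y + 1) * ffact y n).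
    { intros y n. induction n as [|n IHn]; [simpl; ring|].
      change (ffact (y + 1) (S (S n))) with (ffact (y + 1) (S n) * (y + 1 - INR (S n))).
      rewrite IHn. simpl ffact. rewrite S_INR, RtoC_plus. ring. }
    replace (x + 1 + INR q + INR (S m)) with (x + 1 + INR q + INR m + 1) by (rewrite S_INR, RtoC_plus; ring).
    rewrite E. replace (INR (S (q + m))) with (INR q + INR m + 1)%R by (rewrite S_INR, plus_INR; ring).
    rewrite !RtoC_plus. ring. }
replace (2 * q + 1)%nat with (q + S q)%nat by lia. rewrite H.
f_equal. f_equal. rewrite S_INR, RtoC_plus. ring.
Qed.

(** * The diagonal values and the duplication formula *)

Lemma rising_neq_0 (z : C) (n : nat) : 0 < Re z -> rising z n <> 0.
Proof.
intros Hz. induction n as [|n IH].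
- simpl. apply Re_neq_0, Rgt_not_eq, Hz.
- cbn [rising]. apply Cmult_neq_0; [exact IH|]. apply Re_neq_0, Rgt_not_eq.
  change (Re z + INR (S n) > 0). generalize (pos_INR (S n)). lra.
Qed.

Lemma rising_gauss (z : C) (n : nat) : n <> 0%nat ->
  rising z n = gauss z n * (INR (fact n) * Cexp (z * ln (INR n))).
Proof.
intros Hn. unfold gauss. rewrite Cpower_pos by (apply INR_pos, Hn). field.
split; [apply Cexp_neq_0|apply Cfact_neq_0].
Qed.

Lemma gauss_neq_0 (z : C) (n : nat) : n <> 0%nat -> 0 < Re z -> gauss z n <> 0.
Proof.
intros Hn Hz E. apply (rising_neq_0 z n Hz). rewrite rising_gauss, E by assumption. ring.
Qed.

Lemma rGamma_neq_0_Re (z : C) : 0 < Re z -> rGamma z <> 0.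
Proof.
intros Hz. apply rGamma_neq_0. intros n E. rewrite E in Hz.
change (0 < - INR n) in Hz. generalize (pos_INR n). lra.
Qed.

Lemma tends_log_double :
  tends eventually (fun q => RtoC (ln (INR (2 * q + 1)) - ln (INR q))) (RtoC (ln 2)).
Proof.
apply tends_le with (fun q => / INR q)%R.
- exists 1%nat. intros q Hq. assert (Hp : 0 < INR q) by (apply INR_pos; lia).
  assert (E : INR (2 * q + 1) = (2 * INR q * (1 + / (2 * INR q)))%R).
  { rewrite plus_INR, mult_INR. simpl. field. lra. }
  assert (Hi : 0 < / (2 * INR q)) by (apply Rinv_0_lt_compat; lra).
  rewrite <- RtoC_minus, Cmod_R, E, ln_mult, ln_mult by lra.
  replace (ln 2 + ln (INR q) + ln (1 + / (2 * INR q)) - ln (INR q) - ln 2)%R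
    with (ln (1 + / (2 * INR q))) by ring.
  assert (H0 : 0 <= ln (1 + / (2 * INR q))) by (rewrite <- ln_1; apply ln_le_compat; lra).
  rewrite Rabs_pos_eq by assumption.
  assert (H1 := exp_ge_1p (ln (1 + / (2 * INR q)))). rewrite exp_ln in H1 by lra.
  rewrite Rinv_mult in *. assert (0 < / INR q) by (apply Rinv_0_lt_compat; assumption). lra.
- apply tends_ext_loc with (fun q => / RtoC (INR q)).
  + exists 1%nat. intros q Hq. symmetry. apply RtoC_inv, not_0_INR. lia.
  + apply tends_inv_INR.
Qed.

Lemma gauss_tends_double (z : C) :
  tends eventually (fun q => gauss z (2 * q + 1)) (rGamma z).
Proof.
apply (tends_comp eventually eventually (fun q => (2 * q + 1)%nat)); [|apply gauss_tends].
apply eventually_incr. intros; lia.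
Qed.

(** In terms of Gauss approximants the four values of 1/Gamma cancel in the limit; what survives is
    the power ((2q + 1)/q)^x, which tends to 2^x. *)
Lemma ffact_ratio_tends (x : C) : 0 <= Re x ->
  tends eventually (fun q => ffact (x + 2 * INR (S q)) (S q) / ffact (0 + 2 * INR (S q)) (S q))
    (Cexp (x * ln 2)).
Proof.
intros Hx.
assert (Hx1 : 0 < Re (x + 1)) by (rewrite Re_plus_1; lra).
assert (H01 : 0 < Re (0 + 1)) by (simpl; lra).
assert (HG1 := rGamma_neq_0_Re _ Hx1). assert (HG0 := rGamma_neq_0_Re _ H01).
apply tends_ext_loc with (fun q =>
  gauss (x + 1) (2 * q + 1) * / gauss (x + 1) q * (gauss (0 + 1) q * / gauss (0 + 1) (2 * q + 1))
  * Cexp (x * RtoC (ln (INR (2 * q + 1)) - ln (INR q)))).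
- exists 1%nat. intros q Hq.
  assert (R1 := rising_neq_0 (x + 1) q Hx1). assert (R0 := rising_neq_0 (0 + 1) q H01).
  assert (E1 := rising_ffact x q). assert (E0 := rising_ffact 0 q).
  assert (R0' := rising_neq_0 (0 + 1) (2 * q + 1) H01).
  replace (ffact (x + 2 * INR (S q)) (S q)) with (rising (x + 1) (2 * q + 1) / rising (x + 1) q)
    by (rewrite E1; field; assumption).
  replace (ffact (0 + 2 * INR (S q)) (S q)) with (rising (0 + 1) (2 * q + 1) / rising (0 + 1) q)
    by (rewrite E0; field; assumption).
  assert (G1 := gauss_neq_0 (x + 1) q ltac:(lia) Hx1).
  assert (G0 := gauss_neq_0 (0 + 1) q ltac:(lia) H01).
  assert (G0' := gauss_neq_0 (0 + 1) (2 * q + 1) ltac:(lia) H01).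
  rewrite !rising_gauss by lia.
  rewrite RtoC_minus.
  replace (x * (ln (INR (2 * q + 1)) - ln (INR q))) with (x * ln (INR (2 * q + 1)) - x * ln (INR q)) by ring.
  rewrite Cexp_minus.
  replace ((x + 1) * ln (INR (2 * q + 1))) with (x * ln (INR (2 * q + 1)) + (0 + 1) * ln (INR (2 * q + 1))) by ring.
  replace ((x + 1) * ln (INR q)) with (x * ln (INR q) + (0 + 1) * ln (INR q)) by ring.
  rewrite !Cexp_plus. field.
  repeat split; try assumption; try apply Cexp_neq_0; apply Cfact_neq_0.
- apply (tends_eq _ (rGamma (x + 1) * / rGamma (x + 1) * (rGamma (0 + 1) * / rGamma (0 + 1)) * Cexp (x * ln 2))).
  { field. split; assumption. }
  apply tends_mult; [apply tends_mult; apply tends_mult|].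
  + apply gauss_tends_double.
  + apply tends_inv; [assumption|apply gauss_tends].
  + apply gauss_tends.
  + apply tends_inv; [assumption|apply gauss_tends_double].
  + apply tends_Cexp; [typeclasses eauto|]. apply tends_scal, tends_log_double.
Qed.

Lemma Beta_diag_shift (s : C) (p : nat) : - (1 / 2) < Re s ->
  Beta (s + INR p) (s + INR p) = (/ 2) ^ p * Beta s s.
Proof.
intros Hs. induction p as [|p IH].
- simpl. replace (s + 0) with s by ring. ring.
- rewrite S_INR, RtoC_plus. replace (s + (INR p + 1)) with (s + INR p + 1) by ring.
  rewrite Beta_diag_S, IH.
  + rewrite Cpow_S. ring.
  + change (- (1 / 2) < Re s + INR p). generalize (pos_INR p). lra.
Qed.

Lemma Beta_shift (s : C) (p : nat) : - (1 / 2) < Re s ->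
  Beta (s + INR p) s = ffact (2 * s + 2 * INR p) p / INR (fact p) * ((/ 2) ^ p * Beta s s).
Proof.
intros Hs. rewrite <- (Beta_diag_shift s p Hs).
assert (H := Beta_below (s + INR p) p). replace (s + INR p - INR p) with s in H by ring.
replace (2 * (s + INR p)) with (2 * s + 2 * INR p) in H by ring.
apply H. change (- (1 / 2) < Re s + INR p). generalize (pos_INR p). lra.
Qed.

Lemma CPI_neq_0 : RtoC PI <> 0.
Proof. intros E. apply RtoC_inj in E. generalize PI_RGT_0. lra. Qed.

Lemma half_pow_neq_0 (p : nat) : (/ 2) ^ p <> 0.
Proof.
apply Cpow_nz. intros E. apply C2_neq_0.
replace (RtoC 2) with (/ 2 * (2 * 2)) by field. rewrite E. ring.
Qed.

(** Beta(s + p, s)/Beta(p, 0) has two expressions for its limit: 2^s by Laplace's method, and 4^s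
    Beta(s, s)/pi through [Beta_shift], where powers of 1/2 and factorials cancel. *)
Lemma Beta_diag_nonneg (s : C) : 0 <= Re s -> Beta s s = PI * Cexp (- (s * ln 2)).
Proof.
intros Hs.
assert (H1 := proj2 (tends_S _ _) (Beta_laplace s s Hs)). cbn beta in H1.
assert (H2 : tends eventually (fun q => ffact (2 * s + 2 * INR (S q)) (S q) / ffact (0 + 2 * INR (S q)) (S q)
   * (Beta s s / PI)) (Cexp (2 * s * ln 2) * (Beta s s / PI))).
{ apply tends_mult; [|apply tends_const]. apply ffact_ratio_tends.
  replace (Re (2 * s)) with (2 * Re s)%R; [lra|]. unfold Re, Cmult, RtoC. simpl. ring. }
assert (E : Cexp (s * ln 2) = Cexp (2 * s * ln 2) * (Beta s s / PI)).
{ apply (tends_unique (F := eventually) _ _ _ H1).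
  apply tends_ext with (2 := H2). intros q. symmetry.
  assert (EW := Beta_shift 0 (S q) ltac:(simpl; lra)).
  rewrite Cplus_0_l, Beta_wallis, Beta_0_0 in EW. replace (2 * 0) with (RtoC 0) in EW by ring.
  assert (HW : RtoC (wallis (S q)) <> 0).
  { intros X. apply RtoC_inj in X. generalize (wallis_pos (S q)). lra. }
  rewrite (Beta_shift s (S q)), EW by lra. rewrite EW in HW.
  field. repeat split; try apply half_pow_neq_0; try apply Cfact_neq_0; try apply CPI_neq_0.
  intros X. apply HW. rewrite X. unfold Cdiv. ring. }
replace (2 * s * ln 2) with (s * ln 2 + s * ln 2) in E by ring.
rewrite Cexp_plus in E. rewrite Cexp_opp.
assert (HE := Cexp_neq_0 (s * ln 2)). assert (HP := CPI_neq_0).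
replace (Beta s s) with (/ Cexp (s * ln 2) * PI * / Cexp (s * ln 2) *
  (Cexp (s * ln 2) * Cexp (s * ln 2) * (Beta s s / PI))) by (field; split; assumption).
rewrite <- E. field. assumption.
Qed.

(** One step of [Beta_diag_S] brings the strip -1/2 < Re s < 0 into the half-plane where Laplace's
    method was applied. *)
Lemma Beta_diag (s : C) : - (1 / 2) < Re s -> Beta s s = PI * Cexp (- (s * ln 2)).
Proof.
intros Hs. assert (E := Beta_diag_S s Hs).
rewrite Beta_diag_nonneg in E by (rewrite Re_plus_1; lra).
replace (Beta s s) with (2 * (/ 2 * Beta s s)) by field. rewrite <- E.
replace (- ((s + 1) * ln 2)) with (- (s * ln 2) + RtoC (- ln 2)) by (rewrite RtoC_opp; ring).
rewrite Cexp_plus, (Cexp_RtoC (- ln 2)), exp_Ropp, exp_ln, RtoC_inv by lra. field.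
Qed.

Lemma Beta_value (s : C) (p : nat) : - (1 / 2) < Re s ->
  Beta s (s - INR p) = PI * Cexp (- (s * ln 2)) * (ffact (2 * s) p / INR (fact p)).
Proof. intros Hs. rewrite Beta_below, Beta_diag by assumption. ring. Qed.

(* 1 + cos t = 2 cos^2 (t/2) makes this integral elementary. *)
Lemma Beta_half_0 : Beta (/ 2) 0 = RtoC (2 * sqrt 2).
Proof.
assert (HR : Re (/ 2) = (1 / 2)%R).
{ unfold Re, Cinv, RtoC. simpl. field. }
apply (imp_int_unique (kern (/ 2) 0)); [apply Beta_int; rewrite HR; lra|].
apply imp_int_ext with (fun t : R => RtoC (sqrt 2 * cos (t / 2))).
- intros t Ht. unfold kern. replace (0 * t) with (RtoC 0) by ring.
  rewrite Ccos_RtoC, cos_0, Cmult_1_r. unfold pw.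
  replace (/ 2 * ln (1 + cos t)) with (RtoC (/ 2 * ln (1 + cos t))) by (rewrite RtoC_mult, RtoC_inv by lra; reflexivity).
  rewrite Cexp_RtoC. f_equal.
  assert (Hp := one_plus_cos_pos t ltac:(lra)). assert (Hc := cos_half_pos t ltac:(lra)).
  change (exp (/ 2 * ln (1 + cos t))) with (Rpower (1 + cos t) (/ 2)).
  rewrite Rpower_sqrt by assumption. rewrite one_plus_cos, sqrt_mult by nra.
  rewrite <- Rsqr_pow2, sqrt_Rsqr by lra. reflexivity.
- exists (fun b => RtoC (2 * sqrt 2 * sin (b / 2))). split.
  + intros b Hb.
    replace (RtoC (2 * sqrt 2 * sin (b / 2))) with
      (RtoC (2 * sqrt 2 * sin (b / 2)) - RtoC (2 * sqrt 2 * sin (0 / 2))).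
    2: { replace (0 / 2)%R with 0%R by field. rewrite sin_0, Rmult_0_r. ring. }
    apply (CR_int_FTC (fun t => RtoC (2 * sqrt 2 * sin (t / 2))) (fun t => RtoC (sqrt 2 * cos (t / 2)))); [lra| |].
    * intros x _. apply (CR_derive_RtoC (fun t => 2 * sqrt 2 * sin (t / 2))%R).
      auto_derive; [exact I|]. unfold Rdiv. field.
    * intros x _. exists (RtoC (sqrt 2 * (- sin (x / 2) / 2))).
      apply (CR_derive_RtoC (fun t => sqrt 2 * cos (t / 2))%R).
      auto_derive; [exact I|]. unfold Rdiv. field.
  + apply tends_RtoC; [typeclasses eauto|].
    assert (HC : continuous (fun b => 2 * sqrt 2 * sin (b / 2))%R PI).
    { apply (ex_derive_continuous (K := R_AbsRing) (V := R_NormedModule)). auto_derive. exact I. }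
    unfold continuous in HC. rewrite sin_PI2, Rmult_1_r in HC.
    intros P HP. destruct (HC P HP) as [e He]. exists e. intros y Hy _. apply He, Hy.
Qed.

(** Divided by p wallis(p), the left side is the squared Gauss approximant of 1/Gamma(1/2) times the
    ratio studied in [Beta_laplace]. The exact value follows from the recurrences in p of Beta and
    wallis, started at [Beta_half_0]. *)
Lemma rising_half_beta (p : nat) :
  (rising (/ 2) p / INR (fact p)) ^ 2 * Beta (/ 2 + INR p) 0 =
  RtoC (sqrt 2 / PI) * (INR p + / 2) * RtoC (wallis p).
Proof.
assert (HPI := PI_RGT_0).
assert (HR : Re (/ 2) = (1 / 2)%R) by (unfold Re, Cinv, RtoC; simpl; field).
induction p as [|p IH].
- simpl (INR 0). replace (/ 2 + 0) with (/ 2) by ring. rewrite Beta_half_0. simpl.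
  rewrite RtoC_div, RtoC_mult by lra. field. apply CPI_neq_0.
- assert (E := Beta_mu_0 (/ 2 + INR p) ltac:(change (- (1 / 2) < Re (/ 2) + INR p); rewrite HR;
    generalize (pos_INR p); lra)).
  assert (HP := pos_INR p).
  assert (N1 : RtoC (INR p) + 1 <> 0) by (rewrite <- RtoC_plus; intros X; apply RtoC_inj in X; lra).
  assert (N3 : / 2 + RtoC (INR p) + 1 <> 0).
  { apply Re_neq_0, Rgt_not_eq. change (Re (/ 2) + INR p + 1 > 0). rewrite HR. lra. }
  assert (N4 : 2 * RtoC (INR p) + 3 <> 0).
  { rewrite <- RtoC_mult, <- RtoC_plus. intros X. apply RtoC_inj in X. lra. }
  assert (N5 : 2 * RtoC (INR p) + 1 <> 0).
  { rewrite <- RtoC_mult, <- RtoC_plus. intros X. apply RtoC_inj in X. lra. }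
  set (c := RtoC (sqrt 2 / PI)) in *. clearbody c.
  cbn [rising wallis]. rewrite fact_simpl, mult_INR, S_INR, !RtoC_mult, RtoC_div, !RtoC_plus, RtoC_mult by lra.
  assert (HF := Cfact_neq_0 p).
  replace (/ 2 + (INR p + 1)) with (/ 2 + INR p + 1) by ring.
  set (n := RtoC (INR p)) in *. set (B0 := Beta (/ 2 + n) 0) in *.
  set (B1 := Beta (/ 2 + n + 1) 0) in *. set (w := RtoC (wallis p)) in *.
  replace (rising (/ 2) p * (/ 2 + n + 1) / ((n + 1) * INR (fact p))) with
    (rising (/ 2) p / INR (fact p) * ((/ 2 + n + 1) / (n + 1))) by (field; split; assumption).
  set (A := rising (/ 2) p / INR (fact p)) in *.
  transitivity ((A ^ 2 * B0) * (2 * (/ 2 + n + 1) / (n + 1))).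
  + transitivity (A ^ 2 * ((/ 2 + n + 1) / (n + 1)) * / (n + 1) * ((/ 2 + n + 1) * B1)).
    * simpl. unfold Cdiv. ring.
    * rewrite E. field. assumption.
  + rewrite IH. field. assumption.
Qed.

Lemma rGamma_half : rGamma (/ 2) = RtoC (/ sqrt PI).
Proof.
assert (HPI := PI_RGT_0). assert (Hs2 : 0 < sqrt 2) by (apply sqrt_lt_R0; lra).
assert (Hs2' : RtoC (sqrt 2) <> 0) by (intros X; apply RtoC_inj in X; lra).
assert (HR : Re (/ 2) = (1 / 2)%R) by (unfold Re, Cinv, RtoC; simpl; field).
(* The approximants are non-negative reals, which selects the square root once the square of the
   limit is known. *)
assert (Hgauss : forall n, (1 <= n)%nat -> exists g : R, 0 <= g /\ gauss (/ 2) n = RtoC g).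
{ intros n Hn.
  assert (Hr : forall m, exists r : R, 0 <= r /\ rising (/ 2) m = RtoC r).
  { intros m. induction m as [|m [r [Hr Er]]].
    - exists (/ 2)%R. split; [lra|]. simpl. rewrite RtoC_inv by lra. reflexivity.
    - exists (r * (/ 2 + INR (S m)))%R. split.
      + apply Rmult_le_pos; [assumption|]. generalize (pos_INR (S m)). lra.
      + cbn [rising]. rewrite Er, RtoC_mult, RtoC_plus, RtoC_inv by lra. reflexivity. }
  destruct (Hr n) as [r [Hr0 Er]].
  exists (r / (INR (fact n) * exp (/ 2 * ln (INR n))))%R. split.
  - apply Rmult_le_pos; [assumption|]. left. apply Rinv_0_lt_compat, Rmult_lt_0_compat.
    + apply INR_fact_lt_0.
    + apply exp_pos.
  - unfold gauss. rewrite Er, Cpower_pos by (apply INR_pos; lia).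
    replace (/ 2 * ln (INR n)) with (RtoC (/ 2 * ln (INR n))) by (rewrite RtoC_mult, RtoC_inv by lra; reflexivity).
    rewrite Cexp_RtoC, RtoC_div, RtoC_mult; [reflexivity|].
    apply Rmult_integral_contrapositive_currified; [apply INR_fact_neq_0|].
    apply Rgt_not_eq, exp_pos. }
(* The squared approximant times Beta(1/2 + p, 0)/wallis(p) tends to rGamma(1/2)^2 sqrt 2 by
   Laplace's method, and to (sqrt 2)/pi by the exact formula. *)
assert (Hsq : rGamma (/ 2) * rGamma (/ 2) = RtoC (/ PI)).
{ assert (HL := Beta_laplace (/ 2) 0 ltac:(rewrite HR; lra)).
  assert (Hln : Cexp (/ 2 * ln 2) = RtoC (sqrt 2)).
  { replace (/ 2 * ln 2) with (RtoC (/ 2 * ln 2)) by (rewrite RtoC_mult, RtoC_inv by lra; reflexivity).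
    rewrite Cexp_RtoC. f_equal. apply Rpower_sqrt. lra. }
  rewrite Hln in HL.
  assert (H1 := tends_mult _ _ _ _ (gauss_tends (/ 2)) (gauss_tends (/ 2))).
  assert (H2 := tends_mult _ _ _ _ H1 HL).
  assert (H3 : tends eventually (fun p => RtoC (sqrt 2 / PI) * (1 + / 2 * / RtoC (INR p))) (RtoC (sqrt 2 / PI))).
  { apply (tends_eq _ (RtoC (sqrt 2 / PI) * (1 + / 2 * 0))); [ring|].
    apply tends_scal, tends_plus; [apply tends_const|apply tends_scal, tends_inv_INR]. }
  assert (E : rGamma (/ 2) * rGamma (/ 2) * sqrt 2 = RtoC (sqrt 2 / PI)).
  { apply (tends_unique (F := eventually) _ _ _ H2). apply tends_ext_loc with (2 := H3).
    exists 1%nat. intros p Hp.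
    assert (HN : RtoC (INR p) <> 0) by (apply RtoC_INR_neq_0; lia).
    assert (HW : RtoC (wallis p) <> 0).
    { intros X. apply RtoC_inj in X. generalize (wallis_pos p). lra. }
    assert (EB := rising_half_beta p).
    transitivity ((rising (/ 2) p / INR (fact p)) ^ 2 * Beta (/ 2 + INR p) 0 / (INR p * wallis p)).
    - rewrite EB. field. split; assumption.
    - unfold gauss. rewrite Cpower_pos by (apply INR_pos; lia).
      assert (EE : RtoC (INR p) = Cexp (/ 2 * ln (INR p)) * Cexp (/ 2 * ln (INR p))).
      { rewrite <- Cexp_plus. replace (/ 2 * ln (INR p) + / 2 * ln (INR p)) with (RtoC (ln (INR p))) by field.
        rewrite Cexp_RtoC, exp_ln by (apply INR_pos; lia). reflexivity. }
      assert (HE := Cexp_neq_0 (/ 2 * ln (INR p))). assert (HF := Cfact_neq_0 p).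
      set (e := Cexp (/ 2 * ln (INR p))) in *. set (B := Beta (/ 2 + INR p) 0).
      rewrite EE. simpl. field. repeat split; assumption. }
  replace (rGamma (/ 2) * rGamma (/ 2)) with (rGamma (/ 2) * rGamma (/ 2) * sqrt 2 / sqrt 2) by (field; assumption).
  rewrite E, RtoC_div, RtoC_inv by lra. field. split; [apply CPI_neq_0|assumption]. }
assert (HRe : rGamma (/ 2) = RtoC (Re (rGamma (/ 2))) /\ 0 <= Re (rGamma (/ 2))).
{ assert (H := gauss_tends (/ 2)). split.
  - apply (tends_unique (F := eventually) (gauss (/ 2))); [exact H|].
    apply tends_Re in H; [|typeclasses eauto]. apply tends_RtoC in H; [|typeclasses eauto].
    apply tends_ext_loc with (2 := H). exists 1%nat. intros n Hn.
    destruct (Hgauss n Hn) as [g [_ Hg]]. rewrite Hg. reflexivity.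
  - apply Rnot_lt_le. intros N. assert (He : 0 < - Re (rGamma (/ 2))) by lra.
    destruct (H _ He) as [n0 Hn0]. specialize (Hn0 (S n0) ltac:(lia)).
    destruct (Hgauss (S n0) ltac:(lia)) as [g [Hg0 Hg]]. rewrite Hg in Hn0.
    assert (X := re_le_Cmod (RtoC g - rGamma (/ 2))).
    change (Re (RtoC g - rGamma (/ 2))) with (g - Re (rGamma (/ 2)))%R in X.
    generalize (Rle_abs (g - Re (rGamma (/ 2)))). lra. }
destruct HRe as [E Hpos]. rewrite E in Hsq |- *. set (g := Re (rGamma (/ 2))) in *.
rewrite <- RtoC_mult in Hsq. apply RtoC_inj in Hsq. f_equal.
rewrite <- sqrt_inv, <- Hsq. symmetry. apply sqrt_square. assumption.
Qed.

(** Halved, the 2n + 2 factors on the right are alternately those of the two rising products, whence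
    4^(n+1). *)
Lemma rising_duplication (w : C) (n : nat) :
  rising w n * rising (w + / 2) n * 4 ^ (S n) = rising (2 * w) (2 * n + 1).
Proof.
induction n as [|n IH].
- simpl. field.
- replace (2 * S n + 1)%nat with (S (S (2 * n + 1))) by lia.
  change (4 ^ S (S n)) with (4 * 4 ^ (S n)).
  cbn [rising]. rewrite <- IH.
  replace (S (S (2 * n + 1))) with (2 * n + 3)%nat by lia.
  replace (S (2 * n + 1)) with (2 * n + 2)%nat by lia.
  rewrite !plus_INR, !mult_INR, S_INR, !RtoC_plus, !RtoC_mult.
  change (INR 2) with 2%R. replace (INR 3) with 3%R by (simpl; ring). field.
Qed.

(** The last factor does not depend on w, which is what allows its limit to be read off at a single
    point. *)
Lemma gauss_duplication (w : C) (n : nat) : n <> 0%nat ->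
  gauss w n * gauss (w + / 2) n =
  gauss (2 * w) (2 * n + 1) * Cexp (2 * w * RtoC (ln (INR (2 * n + 1)) - ln (INR n)))
  * (INR (fact (2 * n + 1)) / (INR (fact n) * INR (fact n) * 4 ^ (S n) * Cexp (/ 2 * ln (INR n)))).
Proof.
intros Hn. unfold gauss. rewrite !Cpower_pos by (apply INR_pos; lia).
rewrite <- rising_duplication.
rewrite RtoC_minus.
replace (2 * w * (ln (INR (2 * n + 1)) - ln (INR n))) with
  (2 * w * ln (INR (2 * n + 1)) - (w * ln (INR n) + w * ln (INR n))) by ring.
replace ((w + / 2) * ln (INR n)) with (w * ln (INR n) + / 2 * ln (INR n)) by ring.
rewrite Cexp_minus, !Cexp_plus. field.
assert (H4 : (RtoC 4) <> 0) by (intros X; apply RtoC_inj in X; lra).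
repeat split; try apply Cexp_neq_0; try apply Cfact_neq_0; apply Cpow_nz; assumption.
Qed.

(* The constant in the limit is found by specialising to w = 1/2. *)
Lemma rGamma_duplication (w : C) :
  rGamma w * rGamma (w + / 2) = rGamma (2 * w) * Cexp (2 * w * ln 2) * RtoC (/ (2 * sqrt PI)).
Proof.
set (kappa := fun n => RtoC (INR (fact (2 * n + 1))) / (INR (fact n) * INR (fact n) * 4 ^ (S n) * Cexp (/ 2 * ln (INR n)))).
assert (HE : forall x, tends eventually (fun n => Cexp (2 * x * RtoC (ln (INR (2 * n + 1)) - ln (INR n)))) (Cexp (2 * x * ln 2))).
{ intros x. apply tends_Cexp; [typeclasses eauto|]. apply tends_scal, tends_log_double. }
assert (Hk : tends eventually kappa (RtoC (/ (2 * sqrt PI)))).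
{ assert (H1 := tends_mult _ _ _ _ (gauss_tends (/ 2)) (gauss_tends (/ 2 + / 2))).
  assert (H2 := tends_mult _ _ _ _ (gauss_tends_double (2 * / 2)) (HE (/ 2))).
  assert (E1 : 2 * / 2 = 1) by field. assert (E2 : / 2 + / 2 = 1) by field.
  assert (E3 : Cexp (2 * / 2 * ln 2) = 2).
  { rewrite E1. replace (1 * ln 2) with (RtoC (ln 2)) by ring. rewrite Cexp_RtoC, exp_ln by lra. reflexivity. }
  assert (HR1 : rGamma (2 * / 2) * Cexp (2 * / 2 * ln 2) = 2) by (rewrite E3, E1, rGamma_1; ring).
  assert (HN : rGamma (2 * / 2) * Cexp (2 * / 2 * ln 2) <> 0) by (rewrite HR1; apply C2_neq_0).
  assert (H3 := tends_mult _ _ _ _ H1 (tends_inv _ _ HN H2)).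
  rewrite HR1, E2, rGamma_1, rGamma_half in H3.
  assert (Hsq : sqrt PI <> 0%R) by (apply Rgt_not_eq, sqrt_lt_R0, PI_RGT_0).
  assert (Hsq' : RtoC (sqrt PI) <> 0) by (intros X; apply RtoC_inj in X; contradiction).
  apply (tends_eq _ (/ sqrt PI * 1 * / 2)).
  { rewrite !RtoC_inv, RtoC_mult; [field; assumption|apply Rmult_integral_contrapositive_currified; [lra|assumption]]. }
  rewrite RtoC_inv in H3 by assumption.
  apply tends_ext_loc with (2 := H3). exists 1%nat. intros n Hn.
  rewrite <- E2 at 1. rewrite gauss_duplication by lia. unfold kappa.
  assert (HG := gauss_neq_0 (2 * / 2) (2 * n + 1) ltac:(lia) ltac:(rewrite E1; simpl; lra)).
  field. assert (H4 : (RtoC 4) <> 0) by (intros X; apply RtoC_inj in X; lra).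
  repeat split; try assumption; try apply Cexp_neq_0; try apply Cfact_neq_0; apply Cpow_nz; assumption. }
assert (H1 := tends_mult _ _ _ _ (gauss_tends w) (gauss_tends (w + / 2))).
apply (tends_unique (F := eventually) _ _ _ H1).
assert (H2 := tends_mult _ _ _ _ (tends_mult _ _ _ _ (gauss_tends_double (2 * w)) (HE w)) Hk).
apply tends_ext_loc with (2 := H2). exists 1%nat. intros n Hn.
rewrite gauss_duplication by lia. reflexivity.
Qed.

(** * Kummer's series for J and termwise integration of B *)

(** The coefficients in x of M(mu + 1/2, 2 mu + 1, 4x)/Gamma(mu + 1). The falling factorial removes
    the denominators (2 mu + 1)_l, so that they are entire in mu. *)
Definition kummer_coef (mu : C) (l : nat) : C :=
  ffact (2 * (mu + INR l)) l / INR (fact l) * rGamma (mu + INR l + 1).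

(** Coefficients of the series of J_mu in x = -iz/2: since x^2 = -(z/2)^2, the alternating sign is
    absorbed and odd powers are absent. *)
Definition bessel_coef (mu : C) (j : nat) : C :=
  if Nat.even j then rGamma (mu + INR (Nat.div2 j) + 1) / INR (fact (Nat.div2 j)) else 0.

Lemma ffact_S_l (y : C) (n : nat) : ffact y (S n) = y * ffact (y - 1) n.
Proof.
induction n as [|n IH]; [simpl; ring|].
change (ffact y (S (S n))) with (ffact y (S n) * (y - INR (S n))).
rewrite IH. simpl ffact. rewrite S_INR, RtoC_plus. ring.
Qed.

Lemma kummer_coef_0 (mu : C) : kummer_coef mu 0 = rGamma (mu + 1).
Proof. unfold kummer_coef. simpl. replace (mu + 0 + 1) with (mu + 1) by ring. field. Qed.

Lemma kummer_coef_1 (mu : C) : kummer_coef mu 1 = 2 * rGamma (mu + 1).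
Proof.
unfold kummer_coef. simpl. rewrite (rGamma_S (mu + 1)). field.
Qed.

(** For generating functions this reads F_mu' = 2 F_mu + 2 x F_(mu+1), the equation also satisfied
    by e^(2x) times the series with coefficients [bessel_coef mu]. *)
Lemma kummer_coef_rec (mu : C) (j : nat) :
  RtoC (INR (S (S j))) * kummer_coef mu (S (S j)) = 2 * kummer_coef mu (S j) + 2 * kummer_coef (mu + 1) j.
Proof.
unfold kummer_coef.
replace (mu + INR (S (S j)) + 1) with (mu + INR (S j) + 1 + 1) by (rewrite (S_INR (S j)), RtoC_plus; ring).
rewrite (rGamma_S (mu + INR (S j) + 1)).
replace (mu + 1 + INR j + 1) with (mu + INR (S j) + 1) by (rewrite S_INR, RtoC_plus; ring).
rewrite (rGamma_S (mu + INR (S j) + 1)).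
rewrite (ffact_S_l _ (S j)), (ffact_S_l _ j).
replace (2 * (mu + INR (S (S j))) - 1 - 1) with (2 * (mu + INR (S j)))
  by (rewrite (S_INR (S j)), RtoC_plus; ring).
replace (2 * (mu + 1 + INR j)) with (2 * (mu + INR (S j))) by (rewrite S_INR, RtoC_plus; ring).
cbn [ffact]. rewrite !fact_simpl, !mult_INR, !RtoC_mult.
assert (HF := Cfact_neq_0 j).
assert (H1 : RtoC (INR (S j)) <> 0) by (apply RtoC_INR_neq_0; lia).
assert (H2 : RtoC (INR (S (S j))) <> 0) by (apply RtoC_INR_neq_0; lia).
rewrite (S_INR (S j)), (S_INR j), !RtoC_plus in *. field.
repeat split; assumption.
Qed.

(** Multiplication of a power series by its variable. *)
Definition shift0 (b : nat -> C) (j : nat) : C := match j with O => 0 | S i => b i end.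

Lemma conv_shift0 (a b : nat -> C) (n : nat) : conv a (shift0 b) (S n) = conv a b n.
Proof.
unfold conv. cbn [psum]. rewrite Nat.sub_diag. simpl (shift0 b 0).
match goal with |- ?X + ?Y + _ = ?X' + ?Y' => assert (X = X') as -> end.
- apply psum_ext. intros k Hk. replace (S n - k)%nat with (S (n - k)) by lia. reflexivity.
- replace (S n - n)%nat with (S (n - n)) by lia. simpl (shift0 b (S (n - n))). ring.
Qed.

(** The coefficient form of the classical relation between the derivative of z^(-mu) J_mu and
    z^(-mu) J_(mu+1). *)
Lemma bessel_coef_deriv (mu : C) (j : nat) :
  RtoC (INR (S j)) * bessel_coef mu (S j) = 2 * shift0 (bessel_coef (mu + 1)) j.
Proof.
destruct (Nat.Even_or_Odd j) as [[i ->]|[i ->]].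
- destruct i as [|i].
  + replace (2 * 0)%nat with 0%nat by lia. unfold bessel_coef. cbn [Nat.even shift0]. ring.
  + replace (2 * S i)%nat with (S (S (2 * i))) by lia. cbn [shift0]. unfold bessel_coef.
    replace (Nat.even (S (S (S (2 * i))))) with false.
    2: { symmetry. rewrite <- Nat.negb_odd. apply Bool.negb_false_iff.
      apply Nat.odd_spec. exists (S i). lia. }
    replace (Nat.even (S (2 * i))) with false.
    2: { symmetry. rewrite <- Nat.negb_odd. apply Bool.negb_false_iff.
      apply Nat.odd_spec. exists i. lia. }
    cbv beta iota. ring.
- replace (2 * i + 1)%nat with (S (2 * i)) by lia. cbn [shift0]. unfold bessel_coef.
  replace (S (S (2 * i))) with (2 * S i)%nat by lia.
  rewrite !Nat.even_mul. simpl (Nat.even 2). cbn [orb].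
  rewrite !Nat.div2_double.
  replace (mu + 1 + INR i + 1) with (mu + INR (S i) + 1) by (rewrite S_INR, RtoC_plus; ring).
  rewrite fact_simpl, !mult_INR, !RtoC_mult. change (INR 2) with 2%R. field.
  split; [apply Cfact_neq_0|apply RtoC_INR_neq_0; lia].
Qed.

Definition ecoef (k : nat) : C := expterm 2 k.

(* Kummer's relation between the power series of J_mu and a confluent
   hypergeometric series, at the level of coefficients. *)
Lemma conv_ecoef_bessel_coef (l : nat) : forall mu, conv ecoef (bessel_coef mu) l = kummer_coef mu l.
Proof.
assert (Hrec : forall mu n, RtoC (INR (S n)) * conv ecoef (bessel_coef mu) (S n) =
  2 * conv ecoef (bessel_coef mu) n + 2 * conv ecoef (shift0 (bessel_coef (mu + 1))) n).
{ intros mu n. rewrite conv_deriv.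
  rewrite (conv_ext _ (fun k => 2 * ecoef k) (bessel_coef mu) (bessel_coef mu)) by (intros; try apply expterm_S; reflexivity).
  rewrite (conv_ext ecoef ecoef _ (fun k => 2 * shift0 (bessel_coef (mu + 1)) k)) by (intros; try apply bessel_coef_deriv; reflexivity).
  rewrite conv_scal_l, conv_scal_r. reflexivity. }
(* Two consecutive indices are carried, for all mu at once: the recurrence reaches back two steps
   and moves mu to mu + 1. *)
assert (H : forall n, (forall mu, conv ecoef (bessel_coef mu) n = kummer_coef mu n) /\
  (forall mu, conv ecoef (bessel_coef mu) (S n) = kummer_coef mu (S n))).
{ assert (H0 : forall mu, conv ecoef (bessel_coef mu) 0 = kummer_coef mu 0).
  { intros mu. rewrite kummer_coef_0. unfold conv, ecoef, expterm, bessel_coef. simpl.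
    replace (mu + 0 + 1) with (mu + 1) by ring. field. }
  induction n as [|n [IH0 IH1]].
  - split; [exact H0|]. intros mu. specialize (Hrec mu 0%nat).
    rewrite H0, kummer_coef_0 in Hrec.
    replace (conv ecoef (shift0 (bessel_coef (mu + 1))) 0) with (RtoC 0) in Hrec
      by (unfold conv; simpl; ring).
    rewrite kummer_coef_1. simpl (INR 1) in Hrec. rewrite Cmult_1_l in Hrec. rewrite Hrec. ring.
  - split; [exact IH1|]. intros mu. specialize (Hrec mu (S n)).
    rewrite conv_shift0, IH0, IH1, <- kummer_coef_rec in Hrec.
    assert (HN : RtoC (INR (S (S n))) <> 0) by (apply RtoC_INR_neq_0; lia).
    replace (conv ecoef (bessel_coef mu) (S (S n))) with
      (RtoC (INR (S (S n))) * conv ecoef (bessel_coef mu) (S (S n)) / RtoC (INR (S (S n)))) by (field; assumption).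
    rewrite Hrec. field. assumption. }
apply H.
Qed.

Lemma rsum_even (M : nat -> R) (n : nat) :
  rsum (fun j => if Nat.even j then M (Nat.div2 j) else 0%R) (2 * n) = rsum M n.
Proof.
induction n as [|n IH]; [reflexivity|].
replace (2 * S n)%nat with (S (S (2 * n))) by lia. cbn [rsum]. rewrite IH.
replace (Nat.even (S (2 * n))) with false.
2: { symmetry. rewrite <- Nat.negb_odd. apply Bool.negb_false_iff. apply Nat.odd_spec. exists n. lia. }
rewrite Nat.even_mul. simpl (Nat.even 2). cbn [orb]. rewrite Nat.div2_double. ring.
Qed.

Lemma psum_even (a : nat -> C) (n : nat) :
  psum (fun j => if Nat.even j then a (Nat.div2 j) else 0) (2 * n) = psum a n.
Proof.
induction n as [|n IH]; [reflexivity|].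
replace (2 * S n)%nat with (S (S (2 * n))) by lia. cbn [psum]. rewrite IH.
replace (Nat.even (S (2 * n))) with false.
2: { symmetry. rewrite <- Nat.negb_odd. apply Bool.negb_false_iff. apply Nat.odd_spec. exists n. lia. }
rewrite Nat.even_mul. simpl (Nat.even 2). cbn [orb]. rewrite Nat.div2_double. ring.
Qed.

Lemma summable_even (M : nat -> R) : summable M ->
  summable (fun j => if Nat.even j then M (Nat.div2 j) else 0%R).
Proof.
intros HM. destruct (summable_bounded M HM) as [B [_ HB]].
assert (H0 : forall j, 0 <= (if Nat.even j then M (Nat.div2 j) else 0%R)).
{ intros j. destruct (Nat.even j); [apply HM|lra]. }
apply summable_of_bounded with B; [exact H0|].
intros n. apply Rle_trans with (rsum (fun j => if Nat.even j then M (Nat.div2 j) else 0%R) (2 * n)).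
- apply rsum_mono; [exact H0|lia].
- rewrite rsum_even. apply HB.
Qed.

Definition Jterm (mu z : C) (k : nat) : C :=
  (- (1)) ^ k * (z / 2) ^ (2 * k) / INR (fact k) * rGamma (mu + INR k + 1).

Lemma inv_fact_le_1 (k : nat) : 0 < / INR (fact k) <= 1.
Proof.
split; [apply Rinv_0_lt_compat, INR_fact_lt_0|].
rewrite <- Rinv_1. apply Rinv_le_contravar; [lra|].
change 1%R with (INR 1). apply le_INR. generalize (lt_O_fact k). lia.
Qed.

Lemma Jterm_bound (mu z : C) : exists C0, 0 <= C0 /\
  forall k, Cmod (Jterm mu z k) <= C0 * ((2 * Cmod (z / 2) ^ 2) ^ k / INR (fact k)).
Proof.
destruct (rGamma_growth mu) as [C0 [HC0 HG]]. exists C0. split; [assumption|].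
intros k. unfold Jterm. rewrite Cmod_mult, Cmod_div, Cmod_mult, !Cmod_pow by apply Cfact_neq_0.
rewrite Cmod_opp, Cmod_1, pow1, Rmult_1_l, Cmod_R, Rabs_pos_eq by apply pos_INR.
rewrite pow_mult, Rpow_mult_distr.
assert (HA : 0 <= (Cmod (z / 2) ^ 2) ^ k) by (apply pow_le, pow_le, Cmod_ge_0).
assert (Hi := inv_fact_le_1 k).
apply Rle_trans with ((Cmod (z / 2) ^ 2) ^ k * (C0 * (2 ^ k / INR (fact k))))%R.
- apply Rmult_le_compat.
  + apply Rmult_le_pos; lra.
  + apply Cmod_ge_0.
  + rewrite <- (Rmult_1_r ((Cmod (z / 2) ^ 2) ^ k)) at 2. apply Rmult_le_compat_l; lra.
  + apply HG.
- right. unfold Rdiv. ring.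
Qed.

Lemma Jterm_majorant_summable (C0 : R) (z : C) : 0 <= C0 ->
  summable (fun k => C0 * ((2 * Cmod (z / 2) ^ 2) ^ k / INR (fact k)))%R.
Proof.
intros H. apply summable_scal; [assumption|]. apply summable_exp.
apply Rmult_le_pos; [lra|apply pow_le, Cmod_ge_0].
Qed.

Lemma csums_Jterm (mu z : C) : exists V, csums (Jterm mu z) V /\ BesselJ mu z = Cpower (z / 2) mu * V.
Proof.
destruct (Jterm_bound mu z) as [C0 [HC0 HB]].
destruct (csums_ex _ _ HB (Jterm_majorant_summable C0 z HC0)) as [V HV].
exists V. split; [exact HV|]. unfold BesselJ. f_equal. apply csums_CSeries. exact HV.
Qed.

Lemma conv_pow (a b : nat -> C) (x : C) (n : nat) :
  conv (fun k => x ^ k * a k) (fun k => x ^ k * b k) n = x ^ n * conv a b n.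
Proof.
unfold conv. rewrite <- psum_scal. apply psum_ext. intros k Hk.
replace (x ^ n) with (x ^ k * x ^ (n - k)).
- ring.
- rewrite <- Cpow_add_r. f_equal. lia.
Qed.

(** With x = -iz/2 the factor e^(-iz) is e^(2x), so the Cauchy product of the two absolutely
    convergent series has the coefficients found in [conv_ecoef_bessel_coef]. *)
Lemma csums_kummer (mu z V : C) : csums (Jterm mu z) V ->
  csums (fun l => (- (Ci * z / 2)) ^ l * kummer_coef mu l) (Cexp (- (Ci * z)) * V).
Proof.
intros HV. set (x := - (Ci * z / 2)).
destruct (Jterm_bound mu z) as [C0 [HC0 HB]].
set (M := fun k => (C0 * ((2 * Cmod (z / 2) ^ 2) ^ k / INR (fact k)))%R).
assert (Hx2 : x ^ 2 = - (1) * (z / 2) ^ 2).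
{ unfold x. replace ((- (Ci * z / 2)) ^ 2) with ((Ci * Ci) * (z / 2) ^ 2) by (simpl; field).
  rewrite Ci2. reflexivity. }
assert (HU : forall j, x ^ j * bessel_coef mu j = if Nat.even j then Jterm mu z (Nat.div2 j) else 0).
{ intros j. unfold bessel_coef. destruct (Nat.even j) eqn:Ej; [|ring].
  apply Nat.even_spec in Ej. destruct Ej as [i ->]. rewrite Nat.div2_double.
  unfold Jterm. rewrite !Cpow_mult_r, Hx2, Cpow_mult_l. field. apply Cfact_neq_0. }
assert (HUb : forall j, Cmod (x ^ j * bessel_coef mu j) <= (if Nat.even j then M (Nat.div2 j) else 0%R)).
{ intros j. rewrite HU. destruct (Nat.even j); [apply HB|]. rewrite Cmod_0. lra. }
assert (HMs : summable (fun j => if Nat.even j then M (Nat.div2 j) else 0%R)).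
{ apply (summable_even M), Jterm_majorant_summable, HC0. }
destruct (csums_ex _ _ HUb HMs) as [V' HV'].
(* Padding with zero odd terms keeps the sum: the limits are compared along even partial sums. *)
replace V' with V in HV'.
2: { apply (tends_unique (F := eventually) (psum (Jterm mu z))); [exact HV|].
  apply tends_ext with (fun n => psum (fun j => x ^ j * bessel_coef mu j) (2 * n)).
  - intros n. rewrite <- (psum_even (Jterm mu z) n). apply psum_ext. intros k _. apply HU.
  - apply (tends_comp eventually eventually (fun n => (2 * n)%nat)); [|exact HV'].
    apply eventually_incr. intros; lia. }
assert (HE : csums (fun k => x ^ k * ecoef k) (Cexp (- (Ci * z)))).
{ replace (- (Ci * z)) with (2 * x) by (unfold x; field).
  apply csums_ext with (expterm (2 * x)); [|apply csums_exp].
  intros k. unfold ecoef, expterm. rewrite Cpow_mult_l. field. apply Cfact_neq_0. }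
apply csums_ext with (conv (fun k => x ^ k * ecoef k) (fun k => x ^ k * bessel_coef mu k)).
- intros k. rewrite conv_pow, conv_ecoef_bessel_coef. reflexivity.
- refine (csums_mult _ _ _ _ (fun k => (Cmod (2 * x)) ^ k / INR (fact k))%R _ _ _ HUb HMs HE HV').
  + intros k. right. rewrite <- Cmod_expterm. f_equal. unfold ecoef, expterm.
    rewrite Cpow_mult_l. field. apply Cfact_neq_0.
  + apply summable_exp, Cmod_ge_0.
Qed.

Definition kummer_term (mu z : C) (l : nat) : C :=
  Cpower (z / 2) mu * Cexp (Ci * z) * ((- (Ci * z / 2)) ^ l * kummer_coef mu l).

Lemma csums_kummer_term (mu z : C) : csums (kummer_term mu z) (BesselJ mu z).
Proof.
destruct (csums_Jterm mu z) as [V [HV ->]].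
replace (Cpower (z / 2) mu * V) with
  (Cpower (z / 2) mu * Cexp (Ci * z) * (Cexp (- (Ci * z)) * V)).
- apply csums_scal, csums_kummer, HV.
- rewrite Cexp_opp. field. apply Cexp_neq_0.
Qed.

(** * Powers of -iz and termwise integration of B *)

Lemma Cexp_half_pi : Cexp (- (Ci * PI / 2)) = - Ci.
Proof.
replace (- (Ci * PI / 2)) with (- (Ci * RtoC (PI / 2))) by (rewrite RtoC_div by lra; field).
rewrite Cexp_Ci_RtoC_opp, cos_PI2, sin_PI2. ring.
Qed.

(** Clog z - i pi/2 is the logarithm of -iz that matches the convention of [mic_power]; it need not
    be the principal one. *)
Lemma mic_eq_Cexp (z : C) : z <> 0 -> - (Ci * z) = Cexp (Clog z - Ci * PI / 2).
Proof.
intros Hz. unfold Cminus. rewrite Cexp_plus, Cexp_Clog, Cexp_half_pi by assumption. ring.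
Qed.

Lemma mic_half_eq_Cexp (z : C) : z <> 0 -> - (Ci * z / 2) = Cexp (Clog z - Ci * PI / 2 - ln 2).
Proof.
intros Hz. rewrite Cexp_minus, <- mic_eq_Cexp, Cexp_RtoC, exp_ln by (assumption || lra). field.
Qed.

Lemma Cpower_half (z mu : C) : z <> 0 -> Cpower (z / 2) mu = Cexp (mu * (Clog z - ln 2)).
Proof. intros Hz. unfold Cpower. rewrite Clog_div_pos by (assumption || lra). reflexivity. Qed.

Lemma mic_power_pos (c : R) (z a : C) : 0 < c ->
  mic_power c z a = Cexp (- (Ci * PI * a / 2) + a * ln c + a * Clog z).
Proof. intros Hc. unfold mic_power. rewrite Cpower_pos, !Cexp_plus by assumption. reflexivity. Qed.

(** The factor of B that does not depend on t: e^(-iz cos t) times the factor e^(iz (1 + cos t)) of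
    gamma* is the constant e^(iz), and of the power of -iz (1 + cos t) only (1 + cos t)^{mu} stays
    under the integral. *)
Definition Bcoef (mu z : C) : C :=
  ipow mu / PI * (Cexp (Ci * z) * Cexp (- (Ci * PI * frac mu / 2) + frac mu * Clog z)).

(** [Beta_value] supplies the coefficient. Once the powers of 2, i and z are exponentials of
    multiples of ln 2, i pi/2 and Clog z, the rest is a linear identity between exponents. *)
Lemma Bterm_eq (mu z : C) (k l : nat) : z <> 0 -> - (1 / 2) < Re (frac mu) ->
  frac mu + INR k = mu + INR l ->
  Bcoef mu z * ((- (Ci * z)) ^ k * rGamma (frac mu + INR k + 1) * Beta (frac mu + INR k) mu) = kummer_term mu z l.
Proof.
intros Hz Ha E. set (a := frac mu) in *.
assert (HRe : - (1 / 2) < Re (a + INR k)).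
{ change (- (1 / 2) < Re a + INR k). generalize (pos_INR k). lra. }
assert (HB := Beta_value (a + INR k) l HRe).
replace (a + INR k - INR l) with mu in HB by (rewrite E; ring).
rewrite HB. unfold kummer_term, kummer_coef, Bcoef. fold a. rewrite E.
rewrite Cpower_half, mic_half_eq_Cexp, mic_eq_Cexp by assumption.
unfold ipow. rewrite <- !Cexp_pow.
set (F := ffact (2 * (mu + INR l)) l). set (G := rGamma (mu + INR l + 1)).
assert (HP := CPI_neq_0). assert (HF := Cfact_neq_0 l).
transitivity (Cexp (Ci * PI * mu / 2) * Cexp (- (Ci * PI * a / 2) + a * Clog z) *
  Cexp (INR k * (Clog z - Ci * PI / 2)) * Cexp (- ((mu + INR l) * ln 2)) *
  (Cexp (Ci * z) * (F / INR (fact l) * G))); [field; split; assumption|].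
transitivity (Cexp (mu * (Clog z - ln 2)) * Cexp (INR l * (Clog z - Ci * PI / 2 - ln 2)) *
  (Cexp (Ci * z) * (F / INR (fact l) * G))); [|ring].
f_equal. rewrite <- !Cexp_plus. f_equal.
replace a with (mu + INR l - INR k) by (rewrite <- E; ring). field.
Qed.

Lemma B_integral (mu z : C) : z <> 0 ->
  exists l, imp_int (B_integrand mu z) l /\
    csums (fun k => Bcoef mu z * ((- (Ci * z)) ^ k * rGamma (frac mu + INR k + 1) * Beta (frac mu + INR k) mu))
      (ipow mu / PI * l).
Proof.
intros Hz. set (a := frac mu).
assert (Ha : - (1 / 2) < Re a).
{ unfold a, frac. destruct (nearest_spec (Re mu)) as [H _].
  change (- (1 / 2) < Re mu + - IZR (nearest (Re mu))). lra. }
destruct (rGamma_growth a) as [C0 [HC0 HG]].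
set (c := fun k => (- (Ci * z)) ^ k * rGamma (a + INR k + 1)).
set (K := (exp (Rabs (Re a) * ln 18) * exp (Cmod mu * PI))%R).
assert (HK : 0 < K) by (apply Rmult_lt_0_compat; apply exp_pos).
assert (Hc : forall k, Cmod (c k) <= C0 * ((2 * Cmod z) ^ k / INR (fact k))).
{ intros k. unfold c. rewrite Cmod_mult, Cmod_pow, Cmod_opp, Cmod_Ci_mult, Rpow_mult_distr.
  apply Rle_trans with (Cmod z ^ k * (C0 * (2 ^ k / INR (fact k))))%R.
  - apply Rmult_le_compat_l; [apply pow_le, Cmod_ge_0|apply HG].
  - right. unfold Rdiv. ring. }
assert (Hpw : forall k t, 0 <= t < PI -> pw (a + INR k) t = RtoC ((1 + cos t) ^ k) * pw a t).
{ intros k t Ht. rewrite pw_plus, pw_INR by assumption. ring. }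
(* The 4 combines a factor 2^k from the growth of 1/Gamma with another from 1 + cos t <= 2. *)
set (M := fun k => (C0 * K * ((4 * Cmod z) ^ k / INR (fact k)))%R).
destruct (imp_int_series (fun k t => c k * kern (a + INR k) mu t)
  (fun t => pw a t * Ccos (mu * t) * CSeries (fun k => (- (Ci * RtoC (1 + cos t) * z)) ^ k * rGamma (a + INR k + 1)))
  (fun k => c k * Beta (a + INR k) mu) M (2 * Re a)%R) as [l [Hl1 Hl2]].
- lra.
- apply summable_scal; [apply Rmult_le_pos; lra|]. apply summable_exp.
  generalize (Cmod_ge_0 z). lra.
- intros k t Ht. assert (Hp := one_plus_cos_pos t Ht). assert (Hcb := COS_bound t).
  unfold kern. rewrite Hpw by assumption.
  replace (c k * (RtoC ((1 + cos t) ^ k) * pw a t * Ccos (mu * t))) with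
    (c k * RtoC ((1 + cos t) ^ k) * kern a mu t) by (unfold kern; ring).
  rewrite !Cmod_mult, Cmod_R, Rabs_pos_eq by (apply pow_le; lra).
  assert (H1 := Cmod_kern_majorant a mu t Ht). fold K in H1.
  assert (H2 : (1 + cos t) ^ k <= 2 ^ k) by (apply pow_incr; lra).
  assert (H3 : Cmod (c k) * (1 + cos t) ^ k <= C0 * ((2 * Cmod z) ^ k / INR (fact k)) * 2 ^ k).
  { apply Rmult_le_compat; [apply Cmod_ge_0|apply pow_le; lra|apply Hc|exact H2]. }
  assert (H4 := Rmult_le_compat _ _ _ _
    (Rmult_le_pos _ _ (Cmod_ge_0 (c k)) (pow_le _ k (Rlt_le _ _ Hp))) (Cmod_ge_0 _) H3 H1).
  eapply Rle_trans; [exact H4|]. right. unfold M.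
  replace (4 * Cmod z)%R with (2 * Cmod z * 2)%R by ring. rewrite (Rpow_mult_distr _ 2). unfold Rdiv. ring.
- intros k. apply imp_int_scal, Beta_int.
  change (- (1 / 2) < Re a + INR k). generalize (pos_INR k). lra.
- intros t Ht.
  assert (Hs : exists v, csums (fun k => (- (Ci * RtoC (1 + cos t) * z)) ^ k * rGamma (a + INR k + 1)) v).
  { apply csums_ex with (fun k => C0 * ((2 * Cmod (- (Ci * RtoC (1 + cos t) * z))) ^ k / INR (fact k)))%R.
    - intros k. rewrite Cmod_mult, Cmod_pow, Rpow_mult_distr.
      apply Rle_trans with (Cmod (- (Ci * RtoC (1 + cos t) * z)) ^ k * (C0 * (2 ^ k / INR (fact k))))%R.
      + apply Rmult_le_compat_l; [apply pow_le, Cmod_ge_0|apply HG].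
      + right. unfold Rdiv. ring.
    - apply summable_scal; [assumption|]. apply summable_exp.
      apply Rmult_le_pos; [lra|apply Cmod_ge_0]. }
  destruct Hs as [v Hv]. rewrite (csums_CSeries _ _ Hv).
  apply csums_ext with (2 := csums_scal (pw a t * Ccos (mu * t)) _ _ Hv).
  intros k. unfold c, kern. rewrite Hpw by assumption.
  replace (- (Ci * RtoC (1 + cos t) * z)) with (RtoC (1 + cos t) * - (Ci * z)) by ring.
  rewrite Cpow_mult_l, <- RtoC_pow. ring.
- exists (Cexp (Ci * z) * Cexp (- (Ci * PI * a / 2) + a * Clog z) * l). split.
  + apply imp_int_ext with (2 := imp_int_scal (Cexp (Ci * z) * Cexp (- (Ci * PI * a / 2) + a * Clog z)) _ _ Hl2).
    intros t Ht. assert (Hp := one_plus_cos_pos t ltac:(lra)).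
    unfold B_integrand, P_mic, gamma_star. fold a.
    rewrite mic_power_pos by assumption.
    replace (- - (Ci * RtoC (1 + cos t) * z)) with (Ci * z + Ci * z * cos t) by (rewrite RtoC_plus; ring).
    rewrite Cexp_opp, !Cexp_plus. unfold pw. field. apply Cexp_neq_0.
  + replace (ipow mu / PI * (Cexp (Ci * z) * Cexp (- (Ci * PI * a / 2) + a * Clog z) * l)) with
      (Bcoef mu z * l) by (unfold Bcoef; fold a; unfold Cdiv; ring).
    apply csums_scal. exact Hl1.
Qed.

Lemma Re_frac (mu : C) : - (1 / 2) < Re (frac mu) <= 1 / 2.
Proof.
unfold frac. destruct (nearest_spec (Re mu)) as [H1 H2].
change (- (1 / 2) < Re mu + - IZR (nearest (Re mu)) <= 1 / 2). lra.
Qed.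

(* Let n = nearest (Re mu). If n >= 0, the terms of B with k < n vanish; if
   n < 0, the first -n terms of J are missing from B. *)
Lemma BesselJ_B (mu z : C) : z <> 0 ->
  BesselJ mu z = psum (kummer_term mu z) (Z.to_nat (- nearest (Re mu))) + B mu z.
Proof.
intros Hz. assert (Ha := Re_frac mu).
destruct (B_integral mu z Hz) as [l [Hl1 Hl2]].
replace (ipow mu / PI * l) with (B mu z) in Hl2 by (unfold B; rewrite (imp_int_eq _ _ Hl1); reflexivity).
assert (HJ := csums_kummer_term mu z).
assert (Efr : frac mu = mu - IZR (nearest (Re mu))) by reflexivity.
destruct (Z_lt_le_dec (nearest (Re mu)) 0) as [Hn|Hn].
- set (N := Z.to_nat (- nearest (Re mu))).
  assert (EN : IZR (nearest (Re mu)) = (- INR N)%R).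
  { unfold N. rewrite INR_IZR_INZ, Z2Nat.id, opp_IZR by lia. ring. }
  apply (csums_unique (kummer_term mu z)); [exact HJ|].
  apply csums_shift. apply csums_ext with (2 := Hl2).
  intros k. apply Bterm_eq; [assumption|apply Ha|].
  rewrite Efr, EN, plus_INR, RtoC_plus, RtoC_opp. ring.
- replace (Z.to_nat (- nearest (Re mu))) with 0%nat by lia. simpl psum. rewrite Cplus_0_l.
  set (N := Z.to_nat (nearest (Re mu))).
  assert (EN : IZR (nearest (Re mu)) = INR N).
  { unfold N. rewrite INR_IZR_INZ, Z2Nat.id by lia. reflexivity. }
  apply (csums_unique (kummer_term mu z)); [exact HJ|].
  apply csums_ext with (fun l => Bcoef mu z * ((- (Ci * z)) ^ (N + l) *
     rGamma (frac mu + INR (N + l) + 1) * Beta (frac mu + INR (N + l)) mu)).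
  + intros k. apply Bterm_eq; [assumption|apply Ha|].
    rewrite Efr, EN, plus_INR, RtoC_plus. ring.
  + apply (csums_shift (fun k => Bcoef mu z * ((- (Ci * z)) ^ k *
     rGamma (frac mu + INR k + 1) * Beta (frac mu + INR k) mu))).
    rewrite psum_0, Cplus_0_l; [exact Hl2|].
    intros k Hk.
    (* Here mu exceeds {mu} + k by the positive integer N - k, split as 1 + (N - k - 1) to fit
       [Beta_above]. *)
    replace (Beta (frac mu + INR k) mu) with
      (Beta (frac mu + INR k) (frac mu + INR k + 1 + INR (N - k - 1))).
    * rewrite Beta_above; [ring|]. change (- (1 / 2) < Re (frac mu) + INR k). generalize (pos_INR k). lra.
    * f_equal. assert (E1 : INR N = (INR k + 1 + INR (N - k - 1))%R).
      { replace N with (k + 1 + (N - k - 1))%nat at 1 by lia. rewrite !plus_INR. reflexivity. }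
      rewrite Efr, EN, E1, !RtoC_plus. ring.
Qed.

(** * The remainder chi *)

Lemma nearest_unique (x : R) (m : Z) : - (1 / 2) < x - IZR m <= 1 / 2 -> nearest x = m.
Proof.
intros H. destruct (nearest_spec x) as [H1 H2].
assert (Hd : -1 < IZR (nearest x - m) < 1) by (rewrite minus_IZR; lra).
destruct Hd as [Hd1 Hd2]. apply lt_IZR in Hd1. apply lt_IZR in Hd2. lia.
Qed.

Lemma rGamma_ffact (y : C) (l : nat) : rGamma (y + 1 - INR l) = ffact y l * rGamma (y + 1).
Proof.
induction l as [|l IH].
- simpl. replace (y + 1 - 0) with (y + 1) by ring. ring.
- rewrite rGamma_S. replace (y + 1 - INR (S l) + 1) with (y + 1 - INR l) by (rewrite S_INR, RtoC_plus; ring).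
  rewrite IH. cbn [ffact]. rewrite S_INR, RtoC_plus. ring.
Qed.

Lemma Csqrt_PI_neq_0 : RtoC (sqrt PI) <> 0.
Proof.
intros X. apply RtoC_inj in X. generalize (sqrt_lt_R0 PI PI_RGT_0). lra.
Qed.

Lemma Gamma_INR (n : nat) : Gamma (INR (S n)) = INR (fact n).
Proof.
unfold Gamma. replace (RtoC (INR (S n))) with (INR n + 1) by (rewrite S_INR, RtoC_plus; ring).
rewrite rGamma_INR. field. apply Cfact_neq_0.
Qed.

(** Evaluates 1/Gamma at 1/2 - q, for the half-integer orders where the quotient in chi is given by
    its limit. *)
Lemma rGamma_half_sub (q : nat) :
  rGamma (/ 2 - INR q) * (4 ^ q * INR (fact q) * sqrt PI) = (- (1)) ^ q * INR (fact (2 * q)).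
Proof.
assert (HS := Csqrt_PI_neq_0).
induction q as [|q IH].
- simpl. replace (/ 2 - 0) with (/ 2) by ring. rewrite rGamma_half, RtoC_inv.
  + field. exact HS.
  + intros X. apply HS. rewrite X. reflexivity.
- rewrite rGamma_S. replace (/ 2 - INR (S q) + 1) with (/ 2 - INR q) by (rewrite S_INR, RtoC_plus; ring).
  replace (2 * S q)%nat with (S (S (2 * q))) by lia.
  rewrite !fact_simpl, !mult_INR, !RtoC_mult, !Cpow_S.
  transitivity ((rGamma (/ 2 - INR q) * (4 ^ q * INR (fact q) * sqrt PI)) * ((/ 2 - INR (S q)) * 4 * INR (S q))).
  { ring. }
  rewrite IH.
  replace (INR (S (S (2 * q)))) with (2 * INR q + 2)%R by (rewrite !S_INR, mult_INR; simpl; ring).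
  replace (INR (S (2 * q))) with (2 * INR q + 1)%R by (rewrite !S_INR, mult_INR; simpl; ring).
  rewrite S_INR, !RtoC_plus, !RtoC_mult. field.
Qed.

Lemma ffact_neg (n l : nat) :
  ffact (- INR (S n)) l * INR (fact n) = (- (1)) ^ l * INR (fact (n + l)).
Proof.
induction l as [|l IH].
- simpl. rewrite Nat.add_0_r. ring.
- rewrite Nat.add_succ_r, fact_simpl, mult_INR, RtoC_mult, Cpow_S. cbn [ffact].
  transitivity ((ffact (- INR (S n)) l * INR (fact n)) * (- INR (S n) - INR l)); [ring|].
  rewrite IH. rewrite !S_INR, plus_INR, !RtoC_plus. ring.
Qed.

Lemma Cpow4 (q : nat) : RtoC 4 ^ q = 2 ^ (2 * q).
Proof. rewrite Cpow_mult_r. f_equal. simpl. ring. Qed.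

Lemma powerRZ_m1_neg (k : nat) (m : Z) : m = (- Z.of_nat k)%Z -> RtoC (powerRZ (-1) m) = (- (1)) ^ k.
Proof.
intros ->.
assert (E : powerRZ (-1) (- Z.of_nat k) = ((-1) ^ k)%R).
{ rewrite powerRZ_neg', <- pow_powerRZ.
  assert (X : ((-1) ^ k * (-1) ^ k = 1)%R).
  { rewrite <- Rpow_mult_distr. replace (-1 * -1)%R with 1%R by ring. apply pow1. }
  apply Rmult_eq_reg_l with ((-1) ^ k)%R; [|apply pow_nonzero; lra].
  rewrite X. apply Rinv_r, pow_nonzero. lra. }
rewrite E, RtoC_pow. f_equal. replace (-1)%R with (- (1))%R by ring. apply RtoC_opp.
Qed.

(** In general this is the duplication formula at w = mu + l + 1/2, divided by 1/Gamma(w). At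
    half-integers that divisor is zero, and both sides are evaluated as factorials. *)
Lemma Gamma_ratio_value (mu : C) (l : nat) : (l < Z.to_nat (- nearest (Re mu)))%nat ->
  Gamma_ratio mu (S l) * Cexp (2 * (mu + INR l) * ln 2) / sqrt PI =
  ffact (2 * (mu + INR l)) l * rGamma (mu + INR l + 1).
Proof.
intros Hl. assert (HS := Csqrt_PI_neq_0).
unfold Gamma_ratio. set (m := nearest (Re mu)) in *.
destruct (Ceq_dec mu (IZR m + 1 / 2)) as [E|E].
(* q is chosen so that mu + l = -q - 1/2; it does not truncate because l < -m. *)
- set (q := (Z.to_nat (- m) - 1 - l)%nat).
  assert (Em : m = (- Z.of_nat (l + 1 + q))%Z) by lia.
  assert (Emu : mu + INR l = - INR q - / 2).
  { rewrite E, Em, opp_IZR, <- INR_IZR_INZ, !plus_INR, RtoC_opp, !RtoC_plus. simpl. field. }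
  assert (E1 : IZR (- Z.of_nat (S l) - 2 * m) = INR (S (2 * q + l))).
  { rewrite INR_IZR_INZ. f_equal. lia. }
  assert (E2 : IZR (- Z.of_nat (S l) - m + 1) = INR (S q)).
  { rewrite INR_IZR_INZ. f_equal. lia. }
  rewrite E1, E2, !Gamma_INR, (powerRZ_m1_neg (l + q)) by lia.
  rewrite Emu.
  replace (- INR q - / 2 + 1) with (/ 2 - INR q) by field.
  replace (2 * (- INR q - / 2)) with (- INR (S (2 * q))).
  2: { rewrite S_INR, mult_INR, RtoC_plus, RtoC_mult. change (INR 2) with 2%R. field. }
  replace (- INR (S (2 * q)) * ln 2) with (- (INR (S (2 * q)) * ln 2)) by ring.
  rewrite Cexp_opp, Cexp_pow, Cexp_RtoC, exp_ln by lra.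
  assert (F1 := ffact_neg (2 * q) l). assert (F2 := rGamma_half_sub q).
  assert (N1 := Cfact_neq_0 q). assert (N2 := Cfact_neq_0 (2 * q)).
  assert (N3 : RtoC 2 ^ (2 * q) <> 0) by apply Cpow_nz, C2_neq_0.
  rewrite Cpow4 in F2.
  rewrite (Cpow_add_r (- (1))), Cpow_S.
  set (p2 := RtoC 2 ^ (2 * q)) in *. set (fq := RtoC (INR (fact q))) in *.
  set (f2q := RtoC (INR (fact (2 * q)))) in *. set (sp := RtoC (sqrt PI)) in *.
  replace (ffact (- INR (S (2 * q))) l) with (ffact (- INR (S (2 * q))) l * f2q / f2q) by (field; assumption).
  replace (rGamma (/ 2 - INR q)) with (rGamma (/ 2 - INR q) * (p2 * fq * sp) / (p2 * fq * sp))
    by (field; repeat split; assumption).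
  rewrite F1, F2. field. repeat split; assumption.
- assert (E2mu : INR (S l) + 2 * mu = 2 * (mu + INR l) + 1 - INR l) by (rewrite S_INR, RtoC_plus; ring).
  rewrite E2mu, rGamma_ffact.
  set (w := INR (S l) + mu - 1 / 2).
  assert (Ew : w = mu + INR l + / 2) by (unfold w; rewrite S_INR, RtoC_plus; field).
  (* A pole w = -n would give mu = -(n + l + 1) + 1/2; halves being rounded down, its nearest
     integer is -(n + l + 1), and this is the excluded case. *)
  assert (Hw : rGamma w <> 0).
  { apply rGamma_neq_0. intros n Hn. apply E.
    assert (Emu : mu = RtoC (IZR (- Z.of_nat (n + l + 1))) + 1 / 2).
    { rewrite opp_IZR, <- INR_IZR_INZ, !plus_INR, RtoC_opp, !RtoC_plus. simpl.
      replace mu with (w - INR l - / 2) by (rewrite Ew; ring). rewrite Hn. field. }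
    replace m with (- Z.of_nat (n + l + 1))%Z; [exact Emu|].
    symmetry. apply nearest_unique.
    assert (ER : Re mu = (IZR (- Z.of_nat (n + l + 1)) + 1 / 2)%R).
    { rewrite Emu at 1. unfold Re, Cplus, Cdiv, Cmult, Cinv, RtoC. simpl fst. simpl snd. field. }
    rewrite ER. lra. }
  assert (D := rGamma_duplication w).
  replace (w + / 2) with (mu + INR l + 1) in D by (rewrite Ew; field).
  replace (2 * w) with (2 * (mu + INR l) + 1) in D by (rewrite Ew; field).
  replace ((2 * (mu + INR l) + 1) * ln 2) with (2 * (mu + INR l) * ln 2 + ln 2) in D by ring.
  rewrite Cexp_plus, (Cexp_RtoC (ln 2)), exp_ln in D by lra.
  rewrite RtoC_inv, RtoC_mult in D.
  2: { apply Rmult_integral_contrapositive_currified; [lra|]. apply Rgt_not_eq, sqrt_lt_R0, PI_RGT_0. }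
  unfold Gamma.
  replace (rGamma (mu + INR l + 1)) with (rGamma w * rGamma (mu + INR l + 1) / rGamma w) by (field; assumption).
  rewrite D. field. split; assumption.
Qed.

Lemma sum_n_m_psum (a : nat -> C) (N : nat) : sum_n_m a 1 N = psum (fun l => a (S l)) N.
Proof.
induction N as [|N IH].
- rewrite sum_n_m_zero by lia. reflexivity.
- rewrite sum_n_Sm, IH by lia. reflexivity.
Qed.

Lemma nearest_nonneg (x : R) : - (1 / 2) < x -> (0 <= nearest x)%Z.
Proof.
intros H. destruct (nearest_spec x) as [H1 H2].
assert (-1 < nearest x)%Z by (apply lt_IZR; lra). lia.
Qed.

(** The index of chi is j = l + 1. [Gamma_ratio_value] turns the Gamma quotient into the Kummer
    coefficient, and the remaining powers agree as exponents. *)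
Lemma chi_eq (mu z : C) : z <> 0 ->
  chi mu z = psum (kummer_term mu z) (Z.to_nat (- nearest (Re mu))).
Proof.
intros Hz. unfold chi. destruct (Rle_dec (Re mu) (- (1 / 2))) as [H|H].
2: { assert (Hn := nearest_nonneg (Re mu) ltac:(lra)).
  replace (Z.to_nat (- nearest (Re mu))) with 0%nat by lia. reflexivity. }
rewrite sum_n_m_psum, <- psum_scal. apply psum_ext. intros l Hl.
assert (HV := Gamma_ratio_value mu l Hl). assert (HS := Csqrt_PI_neq_0).
rewrite mic_power_pos by lra. rewrite Gamma_INR.
replace (INR (S l) + mu - 1) with (mu + INR l) by (rewrite S_INR, RtoC_plus; ring).
unfold kummer_term, kummer_coef. rewrite Cpower_half, mic_half_eq_Cexp by assumption.
assert (HF := Cfact_neq_0 l).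
transitivity (Cexp (Ci * z) * Cexp (mu * (Clog z - ln 2)) * Cexp (INR l * (Clog z - Ci * PI / 2 - ln 2)) *
  (ffact (2 * (mu + INR l)) l * rGamma (mu + INR l + 1)) / INR (fact l)).
2: { rewrite Cexp_pow. field. assumption. }
rewrite <- HV. unfold ipow.
transitivity (Cexp (Ci * z) * (Cexp (Ci * PI * mu / 2) *
  Cexp (- (Ci * PI * (mu + INR l) / 2) + (mu + INR l) * ln 2 + (mu + INR l) * Clog z)) *
  (Gamma_ratio mu (S l) / sqrt PI / INR (fact l))).
{ field. split; assumption. }
transitivity (Cexp (Ci * z) * (Cexp (mu * (Clog z - ln 2)) * Cexp (INR l * (Clog z - Ci * PI / 2 - ln 2)) *
  Cexp (2 * (mu + INR l) * ln 2)) * (Gamma_ratio mu (S l) / sqrt PI / INR (fact l))).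
2: { field. split; assumption. }
f_equal. f_equal. rewrite <- !Cexp_plus. f_equal. field.
Qed.

Theorem BesselJ_eq (mu z : C) : z <> 0 -> BesselJ mu z = B mu z + chi mu z.
Proof. intros Hz. rewrite BesselJ_B, chi_eq by assumption. ring. Qed.

Lemma chi_0 (mu z : C) : - (1 / 2) < Re mu -> chi mu z = 0.
Proof. intros H. unfold chi. destruct (Rle_dec (Re mu) (- (1 / 2))); [lra|reflexivity]. Qed.

(** * Differentiability in the order at integers *)

Definition punctured_0 : (C -> Prop) -> Prop := locally' (RtoC 0).

#[export] Instance punctured_0_proper : ProperFilter punctured_0.
Proof. exact (locally'_C_proper (RtoC 0)). Qed.

(** Differentiability at one point only, as a limit of difference quotients in e near 0;
    differentiating a series termwise then becomes an instance of [tannery]. *)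
Definition Cderiv (f : C -> C) (m d : C) : Prop :=
  tends punctured_0 (fun e => (f (m + e) - f m) / e) d.

Lemma punctured_nz : punctured_0 (fun e : C => e <> 0).
Proof. apply locally'_C. exists 1%R. split; [lra|auto]. Qed.

Lemma punctured_small (r : R) : 0 < r -> punctured_0 (fun e : C => Cmod e < r).
Proof.
intros Hr. apply locally'_C. exists r. split; [assumption|].
intros y _ H. replace (y - 0) with y in H by ring. exact H.
Qed.

Lemma tends_punctured_id : tends punctured_0 (fun e : C => e) 0.
Proof.
intros eps He. generalize (punctured_small eps He). apply filter_imp. intros x Hx.
replace (x - 0) with x by ring. exact Hx.
Qed.

Lemma tends_linear_0 (K : R) : tends punctured_0 (fun e => RtoC (K * Cmod e)) 0.
Proof.
apply tends_ext with (fun e => RtoC K * RtoC (Cmod e)).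
{ intros e. symmetry. apply RtoC_mult. }
apply (tends_eq _ (RtoC K * 0)); [ring|]. apply tends_scal.
intros eps He. generalize (punctured_small eps He). apply filter_imp. intros e H.
replace (RtoC (Cmod e) - 0) with (RtoC (Cmod e)) by ring.
rewrite Cmod_R, Rabs_pos_eq by apply Cmod_ge_0. exact H.
Qed.

Lemma Cderiv_continuous (f : C -> C) (m d : C) :
  Cderiv f m d -> tends punctured_0 (fun e => f (m + e)) (f m).
Proof.
intros H. apply (tends_eq _ (f m + 0 * d)); [ring|].
apply tends_ext_loc with (fun e => f m + e * ((f (m + e) - f m) / e)).
- generalize punctured_nz. apply filter_imp. intros e He. field. exact He.
- apply tends_plus; [apply tends_const|]. apply tends_mult; [apply tends_punctured_id|exact H].
Qed.

Lemma Cderiv_plus (f g : C -> C) (m df dg : C) :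
  Cderiv f m df -> Cderiv g m dg -> Cderiv (fun x => f x + g x) m (df + dg).
Proof.
intros Hf Hg. eapply tends_ext; [|apply (tends_plus _ _ _ _ Hf Hg)].
intros e. cbn beta. unfold Cdiv. ring.
Qed.

Lemma Cderiv_const (c m : C) : Cderiv (fun _ => c) m 0.
Proof.
apply tends_ext with (fun _ => RtoC 0); [|apply tends_const].
intros e. unfold Cdiv. ring.
Qed.

Lemma Cderiv_mult (f g : C -> C) (m df dg : C) :
  Cderiv f m df -> Cderiv g m dg -> Cderiv (fun x => f x * g x) m (df * g m + f m * dg).
Proof.
intros Hf Hg. assert (Hc := Cderiv_continuous _ _ _ Hg).
eapply tends_ext; [|apply (tends_plus _ _ _ _ (tends_mult _ _ _ _ Hf Hc) (tends_scal (f m) _ _ Hg))].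
intros e. cbn beta. unfold Cdiv. ring.
Qed.

Lemma Cderiv_scal (c : C) (f : C -> C) (m df : C) : Cderiv f m df -> Cderiv (fun x => c * f x) m (c * df).
Proof.
intros Hf. eapply tends_ext; [|apply (tends_scal c _ _ Hf)].
intros e. cbn beta. unfold Cdiv. ring.
Qed.

Lemma Cderiv_id (m : C) : Cderiv (fun x => x) m 1.
Proof.
apply tends_ext_loc with (fun _ => RtoC 1); [|apply tends_const].
generalize punctured_nz. apply filter_imp. intros e He. field. exact He.
Qed.

Lemma Cderiv_inv (m : C) : m <> 0 -> Cderiv (fun x => / x) m (- (/ m * / m)).
Proof.
intros Hm.
assert (Hc : tends punctured_0 (fun e => / (m + e)) (/ m)).
{ apply tends_inv; [assumption|].
  apply (Cderiv_continuous (fun x => x) m 1), Cderiv_id. }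
assert (Hnz : punctured_0 (fun e : C => m + e <> 0)).
{ generalize (punctured_small (Cmod m) ltac:(apply Cmod_gt_0, Hm)). apply filter_imp.
  intros e He E. replace e with (- m) in He.
  - rewrite Cmod_opp in He. lra.
  - replace (- m) with (- m + (m + e)) by (rewrite E; ring). ring. }
apply tends_ext_loc with (fun e => - (/ (m + e) * / m)).
- generalize (filter_and _ _ punctured_nz Hnz). apply filter_imp. intros e [He Hme]. field.
  repeat split; assumption.
- apply tends_opp, tends_mult; [exact Hc|apply tends_const].
Qed.

Lemma Cderiv_comp_opp (f : C -> C) (m d : C) :
  Cderiv f (- m) d -> Cderiv (fun x => f (- x)) m (- d).
Proof.
intros H.
assert (HF : filterlim Copp punctured_0 punctured_0).
{ intros P HP. apply locally'_C in HP. destruct HP as [r [Hr HP]].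
  apply locally'_C. exists r. split; [assumption|]. intros y Hy Hyr. apply HP.
  - intros E. apply Hy. replace y with (- - y) by ring. rewrite E. ring.
  - replace (- y - 0) with (- (y - 0)) by ring. rewrite Cmod_opp. exact Hyr. }
apply tends_ext_loc with (fun e => - ((f (- m + - e) - f (- m)) / - e)).
- generalize punctured_nz. apply filter_imp. intros e He.
  replace (- (m + e)) with (- m + - e) by ring. field. exact He.
- apply tends_opp. apply (tends_comp _ _ Copp _ d HF H).
Qed.

Lemma Cderiv_eq (f : C -> C) (m d d' : C) : d = d' -> Cderiv f m d -> Cderiv f m d'.
Proof. intros ->. auto. Qed.

Lemma Cderiv_ext (f g : C -> C) (m d : C) : (forall x, f x = g x) -> Cderiv f m d -> Cderiv g m d.
Proof. intros E. apply tends_ext. intros e. rewrite !E. reflexivity. Qed.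

Lemma Cderiv_translate (f : C -> C) (c m d : C) :
  Cderiv f (m + c) d -> Cderiv (fun x => f (x + c)) m d.
Proof. apply tends_ext. intros e. replace (m + e + c) with (m + c + e) by ring. reflexivity. Qed.

Lemma Cderiv_Cexp (c m : C) : Cderiv (fun x => Cexp (x * c)) m (c * Cexp (m * c)).
Proof.
apply tends_ext_loc with (fun e => Cexp (m * c) * ((Cexp (e * c) - 1) / e)).
- generalize punctured_nz. apply filter_imp. intros e He.
  replace ((m + e) * c) with (m * c + e * c) by ring. rewrite Cexp_plus. field. exact He.
- apply (tends_eq _ (Cexp (m * c) * c)); [ring|]. apply tends_scal.
  apply tends_le with (fun e => Cmod c ^ 2 * exp (Cmod c) * Cmod e)%R.
  + generalize (filter_and _ _ punctured_nz (punctured_small 1%R Rlt_0_1)). apply filter_imp.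
    intros e [He H1].
    assert (He0 : 0 < Cmod e) by (apply Cmod_gt_0, He).
    replace ((Cexp (e * c) - 1) / e - c) with ((Cexp (e * c) - 1 - e * c) / e) by (field; assumption).
    rewrite Cmod_div by assumption.
    apply Rmult_le_reg_r with (Cmod e); [assumption|].
    replace (Cmod (Cexp (e * c) - 1 - e * c) / Cmod e * Cmod e)%R
      with (Cmod (Cexp (e * c) - 1 - e * c)) by (field; lra).
    eapply Rle_trans; [apply Cexp_m1_m_bound|]. rewrite Cmod_mult, Rpow_mult_distr.
    assert (Hc := Cmod_ge_0 c).
    assert (HE : exp (Cmod e * Cmod c) <= exp (Cmod c)) by (apply exp_le_compat; nra).
    replace (Cmod c ^ 2 * exp (Cmod c) * Cmod e * Cmod e)%R with
      (Cmod e ^ 2 * Cmod c ^ 2 * exp (Cmod c))%R by ring.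
    apply Rmult_le_compat_l; [|exact HE]. apply Rmult_le_pos; apply pow2_ge_0.
  + apply tends_linear_0.
Qed.

Lemma exp_quad_bound (r : R) : 0 <= r -> exp r - 1 - r <= r ^ 2 * exp r.
Proof.
intros Hr. assert (H := Cexp_m1_m_bound (RtoC r)).
rewrite Cexp_RtoC, <- !RtoC_minus, !Cmod_R, (Rabs_pos_eq r) in H by assumption.
generalize (Rle_abs (exp r - 1 - r)). lra.
Qed.

(** 1/Gamma(1 + e) = (1 + e) L(e), where L(e) is the product of the 1 + [gauss_factor e k], each
    linear in e up to a summable O(e^2). Hence L(e) = 1 + e D + O(e^2) and the derivative is 1 + D,
    that is, Euler's constant. *)
Lemma rGamma_1_derivable : exists d, Cderiv rGamma 1 d.
Proof.
destruct (gauss_factor_bound 1 ltac:(lra)) as [K [HK HB]].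
set (K2 := (1 + (1 + 1) * exp 1)%R).
assert (HK2 : 0 <= K2) by (generalize (exp_pos 1); unfold K2; lra).
destruct (csums_ex (fun k => RtoC (gauss_slope k)) sq_majorant) as [D HD].
{ intros k. rewrite Cmod_R. apply gauss_slope_bound. }
{ apply summable_sq_majorant. }
(* The first summand bounds the nonlinear part of the product, the second that of its factors; the
   factors 2 beside K and K2 bound the partial sums of [sq_majorant]. *)
set (Q := ((2 * K) ^ 2 * exp (2 * K) + 2 * K2)%R).
assert (HQ : 0 <= Q).
{ unfold Q. apply Rplus_le_le_0_compat; [|lra].
  apply Rmult_le_pos; [apply pow2_ge_0|left; apply exp_pos]. }
assert (HL : forall e, Cmod e <= 1 -> exists L, rGamma e = e * (e + 1) * L /\
   Cmod (L - 1 - e * D) <= Q * Cmod e ^ 2).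
{ intros e He. destruct (gauss_prod_tends e) as [L [HL _]]. exists L.
  split; [apply rGamma_cprod, HL|].
  assert (He0 := Cmod_ge_0 e).
  apply (tends_Cmod_le (F := eventually)
    (fun n => cprod (gauss_factor e) n - 1 - e * psum (fun k => RtoC (gauss_slope k)) n)).
  2: { apply tends_minus; [apply tends_minus; [exact HL|apply tends_const]|apply tends_scal, HD]. }
  exists 0%nat. intros n _.
  set (U := fun k => (K * Cmod e * sq_majorant k)%R).
  assert (HU : forall k, Cmod (gauss_factor e k) <= U k) by (intros k; apply HB, He).
  assert (HR : forall j c, rsum (fun k => c * sq_majorant k)%R j = (c * rsum sq_majorant j)%R).
  { intros j c. induction j as [|j IH]; simpl; [ring|]. rewrite IH. ring. }
  assert (Hq0 : 0 <= rsum sq_majorant n) by (apply rsum_nonneg, sq_majorant_pos).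
  assert (Hq2 := rsum_sq_majorant_le n).
  assert (H1 := Cmod_cprod_m1_m_sum (gauss_factor e) U HU n).
  assert (HUr : rsum U n = (K * Cmod e * rsum sq_majorant n)%R) by apply HR.
  assert (HU0 : 0 <= rsum U n <= 2 * K * Cmod e).
  { rewrite HUr. split; [apply Rmult_le_pos; [apply Rmult_le_pos|]; assumption|].
    replace (2 * K * Cmod e)%R with (K * Cmod e * 2)%R by ring.
    apply Rmult_le_compat_l; [apply Rmult_le_pos; assumption|assumption]. }
  assert (H2 : exp (rsum U n) - 1 - rsum U n <= (2 * K) ^ 2 * exp (2 * K) * Cmod e ^ 2).
  { eapply Rle_trans; [apply exp_quad_bound, HU0|].
    replace ((2 * K) ^ 2 * exp (2 * K) * Cmod e ^ 2)%R with ((2 * K * Cmod e) ^ 2 * exp (2 * K))%R by ring.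
    apply Rmult_le_compat; [apply pow2_ge_0|left; apply exp_pos| |].
    - apply pow_incr. exact HU0.
    - apply exp_le_compat. nra. }
  assert (H3 : Cmod (psum (gauss_factor e) n - e * psum (fun k => RtoC (gauss_slope k)) n) <= 2 * K2 * Cmod e ^ 2).
  { replace (psum (gauss_factor e) n - e * psum (fun k => RtoC (gauss_slope k)) n) with
      (psum (fun k => gauss_factor e k - e * gauss_slope k) n).
    2: { rewrite <- psum_scal. induction n as [|n IH]; simpl; [ring|].
      rewrite (psum_ext _ (fun k => gauss_factor e k + - (e * gauss_slope k))) by (intros; ring).
      rewrite psum_plus.
      assert (EN : forall j, psum (fun k => - (e * gauss_slope k)) j = - psum (fun k => e * gauss_slope k) j).
      { intros j. induction j as [|j IHj]; simpl; [ring|]. rewrite IHj. ring. }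
      rewrite EN. ring. }
    eapply Rle_trans; [apply (Cmod_psum _ (fun k => K2 * Cmod e ^ 2 * sq_majorant k)%R)|].
    - intros k. apply gauss_factor_quad, He.
    - rewrite HR. replace (2 * K2 * Cmod e ^ 2)%R with (K2 * Cmod e ^ 2 * 2)%R by ring.
      apply Rmult_le_compat_l; [|assumption]. apply Rmult_le_pos; [assumption|apply pow2_ge_0]. }
  replace (cprod (gauss_factor e) n - 1 - e * psum (fun k => RtoC (gauss_slope k)) n) with
    ((cprod (gauss_factor e) n - 1 - psum (gauss_factor e) n) +
     (psum (gauss_factor e) n - e * psum (fun k => RtoC (gauss_slope k)) n)) by ring.
  eapply Rle_trans; [apply Cmod_triangle|]. unfold Q. lra. }
exists (1 + D).
apply tends_le with (fun e => (Q + (1 + Cmod D)) * 2 * Cmod e)%R.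
2: apply tends_linear_0.
generalize (filter_and _ _ punctured_nz (punctured_small 1%R Rlt_0_1)). apply filter_imp.
intros e [He H1]. destruct (HL e ltac:(lra)) as [L [E HLb]].
assert (He0 : 0 < Cmod e) by (apply Cmod_gt_0, He).
rewrite rGamma_1.
replace (rGamma (1 + e)) with ((1 + e) * L).
2: { rewrite rGamma_S in E. replace (e + 1) with (1 + e) in E by ring.
  replace (rGamma (1 + e)) with (e * rGamma (1 + e) / e) by (field; assumption).
  rewrite E. field. assumption. }
replace (((1 + e) * L - 1) / e - (1 + D)) with ((1 + e) * ((L - 1 - e * D) / e) + e * D) by (field; assumption).
eapply Rle_trans; [apply Cmod_triangle|]. rewrite !Cmod_mult, Cmod_div by assumption.
assert (T1 : Cmod (1 + e) <= 2).
{ eapply Rle_trans; [apply Cmod_triangle|]. rewrite Cmod_1. lra. }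
assert (T2 : Cmod (L - 1 - e * D) / Cmod e <= Q * Cmod e).
{ apply Rmult_le_reg_r with (Cmod e); [assumption|].
  replace (Cmod (L - 1 - e * D) / Cmod e * Cmod e)%R with (Cmod (L - 1 - e * D)) by (field; lra).
  replace (Q * Cmod e * Cmod e)%R with (Q * Cmod e ^ 2)%R by ring. exact HLb. }
assert (T3 : Cmod (1 + e) * (Cmod (L - 1 - e * D) / Cmod e) <= 2 * (Q * Cmod e)).
{ apply Rmult_le_compat; try assumption; [apply Cmod_ge_0|].
  apply Rmult_le_pos; [apply Cmod_ge_0|left; apply Rinv_0_lt_compat; assumption]. }
assert (HD0 := Cmod_ge_0 D). nra.
Qed.

Lemma rGamma_derivable_pos (n : nat) : exists d, Cderiv rGamma (INR n + 1) d.
Proof.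
induction n as [|n [d IH]].
- simpl. replace (0 + 1) with (RtoC 1) by ring. apply rGamma_1_derivable.
- assert (HN : INR n + 1 <> 0).
  { rewrite <- RtoC_plus. intros E. apply RtoC_inj in E. generalize (pos_INR n). lra. }
  assert (H := Cderiv_mult _ _ _ _ _ IH (Cderiv_inv _ HN)).
  eexists. rewrite S_INR, RtoC_plus.
  assert (Hnz : punctured_0 (fun e : C => INR n + 1 + e <> 0)).
  { generalize (punctured_small 1%R Rlt_0_1). apply filter_imp. intros e He E.
    replace e with (- RtoC (INR n + 1)) in He.
    - rewrite Cmod_opp, Cmod_R, Rabs_pos_eq in He; generalize (pos_INR n); lra.
    - rewrite RtoC_plus. replace (- (INR n + 1)) with (- (INR n + 1) + (INR n + 1 + e)) by (rewrite E; ring). ring. }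
  apply tends_ext_loc with (2 := H).
  generalize Hnz. apply filter_imp. intros e He.
  rewrite (rGamma_S (INR n + 1)), (rGamma_S (INR n + 1 + e)).
  replace (INR n + 1 + 1 + e) with (INR n + 1 + e + 1) by ring.
  assert (X : forall u v w : C, u <> 0 -> v <> 0 -> forall G H : C,
    (u * G * / u - v * H * / v) / w = (G - H) / w).
  { intros u v w Hu Hv G0 H0. replace (u * G0 * / u) with G0 by (field; assumption).
    replace (v * H0 * / v) with H0 by (field; assumption). reflexivity. }
  apply X; assumption.
Qed.

(** Downwards the functional equation multiplies by x, so the step also passes through the poles of
    Gamma. *)
Lemma rGamma_derivable_step (c : C) : (exists d, Cderiv rGamma (c + 1) d) -> exists d, Cderiv rGamma c d.
Proof.
intros [d Hd]. eexists. apply Cderiv_ext with (fun x => x * rGamma (x + 1)).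
- intros x. symmetry. apply rGamma_S.
- apply (Cderiv_mult (fun x => x) (fun x => rGamma (x + 1))).
  + apply Cderiv_id.
  + apply Cderiv_translate, Hd.
Qed.

Lemma rGamma_derivable (m : Z) : exists d, Cderiv rGamma (IZR m) d.
Proof.
destruct (Z_lt_le_dec 0 m) as [H|H].
- destruct (rGamma_derivable_pos (Z.to_nat (m - 1))) as [d Hd]. exists d.
  replace (RtoC (IZR m)) with (INR (Z.to_nat (m - 1)) + 1); [exact Hd|].
  rewrite INR_IZR_INZ, Z2Nat.id, minus_IZR, RtoC_minus by lia. ring.
- assert (X : forall n : nat, exists d, Cderiv rGamma (1 - INR n) d).
  { induction n as [|n IH].
    - simpl. replace (1 - 0) with (RtoC 1) by ring. apply rGamma_1_derivable.
    - apply rGamma_derivable_step. replace (1 - INR (S n) + 1) with (1 - INR n); [exact IH|].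
      rewrite S_INR, RtoC_plus. ring. }
  replace (RtoC (IZR m)) with (1 - INR (Z.to_nat (1 - m))); [apply X|].
  rewrite INR_IZR_INZ, Z2Nat.id, minus_IZR, RtoC_minus by lia. ring.
Qed.

(** Each term of the series of J has a derivative in mu; summing them requires difference quotients
    bounded uniformly in e with at most geometric growth in k. Finitely many k are handled by their
    limits, the rest by the functional equation. *)
Lemma rGamma_quotient_bound (M : Z) : exists C0, 0 <= C0 /\
  punctured_0 (fun e => forall k : nat,
    Cmod ((rGamma (IZR M + INR k + e) - rGamma (IZR M + INR k)) / e) <= C0 * 3 ^ k).
Proof.
set (Dq := fun (k : nat) (e : C) => (rGamma (IZR M + INR k + e) - rGamma (IZR M + INR k)) / e).
assert (HD : forall k, exists B, 0 <= B /\ punctured_0 (fun e => Cmod (Dq k e) <= B * 3 ^ k)).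
{ intros k. destruct (rGamma_derivable (M + Z.of_nat k)) as [d Hd].
  exists ((Cmod d + 1) / 3 ^ k)%R. assert (H3 : 0 < 3 ^ k) by (apply pow_lt; lra).
  assert (Hd0 := Cmod_ge_0 d). split.
  - apply Rmult_le_pos; [lra|left; apply Rinv_0_lt_compat; assumption].
  - generalize (tends_Cmod_near _ _ Hd). apply filter_imp. intros e He.
    replace ((Cmod d + 1) / 3 ^ k * 3 ^ k)%R with (Cmod d + 1)%R by (field; lra).
    rewrite plus_IZR, <- INR_IZR_INZ, RtoC_plus in He. exact He. }
destruct (rGamma_growth (IZR M - 1)) as [G [HG0 HG]].
assert (HG' : forall k, Cmod (rGamma (IZR M + INR k)) <= G * 2 ^ k).
{ intros k. specialize (HG k). replace (IZR M - 1 + INR k + 1) with (IZR M + INR k) in HG by ring.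
  eapply Rle_trans; [exact HG|]. apply Rmult_le_compat_l; [assumption|].
  unfold Rdiv. rewrite <- (Rmult_1_r (2 ^ k)) at 2.
  apply Rmult_le_compat_l; [apply pow_le; lra|apply inv_fact_le_1]. }
(* From k0 on M + k >= 1, so for |e| < 1/2 the recursion divides by numbers of modulus at least
   1/2. *)
set (k0 := Z.to_nat (Z.abs M + 1)).
assert (Hfin : forall n, exists B, 0 <= B /\
  punctured_0 (fun e => forall k, (k <= n)%nat -> Cmod (Dq k e) <= B * 3 ^ k)).
{ induction n as [|n [B [HB0 HB]]].
  - destruct (HD 0%nat) as [B [HB0 HB]]. exists B. split; [assumption|].
    generalize HB. apply filter_imp. intros e He k Hk. replace k with 0%nat by lia. exact He.
  - destruct (HD (S n)) as [B' [HB0' HB']]. exists (Rmax B B').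
    split; [apply Rle_trans with B; [assumption|apply Rmax_l]|].
    generalize (filter_and _ _ HB HB'). apply filter_imp. intros e [H1 H2] k Hk.
    assert (H3 : 0 < 3 ^ k) by (apply pow_lt; lra).
    destruct (Nat.eq_dec k (S n)) as [->|Hne].
    + eapply Rle_trans; [exact H2|]. apply Rmult_le_compat_r; [lra|apply Rmax_r].
    + eapply Rle_trans; [apply H1; lia|]. apply Rmult_le_compat_r; [lra|apply Rmax_l]. }
destruct (Hfin k0) as [B [HB0 HB]].
(* The recursion at most doubles the bound and adds 2 G 2^k; passing from 3^k to 3^(k+1) leaves room
   for (B + 2 G) 3^k more, which covers it. *)
exists (B + 2 * G)%R. split; [lra|].
generalize (filter_and _ _ HB (filter_and _ _ punctured_nz (punctured_small (1 / 2)%R ltac:(lra)))).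
apply filter_imp. intros e [H1 [He He2]] k. change (Cmod (Dq k e) <= (B + 2 * G) * 3 ^ k).
destruct (le_lt_dec k k0) as [Hk|Hk].
- eapply Rle_trans; [apply H1, Hk|]. apply Rmult_le_compat_r; [apply pow_le; lra|lra].
- assert (Hbase : Cmod (Dq k0 e) <= (B + 2 * G) * 3 ^ k0).
  { eapply Rle_trans; [apply H1; lia|]. apply Rmult_le_compat_r; [apply pow_le; lra|lra]. }
  apply Nat.lt_le_incl in Hk. induction Hk as [|k Hk IH]; [exact Hbase|].
  assert (Hpos : 1 <= IZR M + INR k).
  { rewrite INR_IZR_INZ, <- plus_IZR. apply IZR_le. lia. }
  set (u := IZR M + INR k) in *.
  assert (Eu : u = RtoC (IZR M + INR k)) by (unfold u; rewrite RtoC_plus; reflexivity).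
  assert (Hu1 : 1 <= Cmod u) by (rewrite Eu, Cmod_R, Rabs_pos_eq; lra).
  assert (Hue : 1 / 2 <= Cmod (u + e)).
  { assert (T := Cmod_triangle (u + e) (- e)). rewrite Cmod_opp in T.
    replace (u + e + - e) with u in T by ring. lra. }
  assert (Hu0 : u <> 0) by (intros E; rewrite E, Cmod_0 in Hu1; lra).
  assert (Hue0 : u + e <> 0) by (intros E; rewrite E, Cmod_0 in Hue; lra).
  assert (Rec : Dq (S k) e = Dq k e / (u + e) - rGamma u / (u * (u + e))).
  { unfold Dq. rewrite S_INR, RtoC_plus.
    replace (IZR M + (INR k + 1)) with (u + 1) by (unfold u; ring).
    fold u. rewrite (rGamma_S u), (rGamma_S (u + e)).
    replace (u + 1 + e) with (u + e + 1) by ring. field. repeat split; assumption. }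
  rewrite Rec. unfold Cminus. eapply Rle_trans; [apply Cmod_triangle|].
  rewrite Cmod_opp, !Cmod_div, Cmod_mult by (try assumption; apply Cmult_neq_0; assumption).
  assert (Hi1 : / Cmod (u + e) <= 2).
  { replace 2%R with (/ (1 / 2))%R by field. apply Rinv_le_contravar; lra. }
  assert (Hi2 : / (Cmod u * Cmod (u + e)) <= 2).
  { replace 2%R with (/ (1 / 2))%R by field. apply Rinv_le_contravar; [lra|]. nra. }
  assert (S1 : Cmod (Dq k e) / Cmod (u + e) <= (B + 2 * G) * 3 ^ k * 2).
  { apply Rmult_le_compat; [apply Cmod_ge_0|left; apply Rinv_0_lt_compat; lra|exact IH|exact Hi1]. }
  assert (S2 : Cmod (rGamma u) / (Cmod u * Cmod (u + e)) <= G * 2 ^ k * 2).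
  { apply Rmult_le_compat; [apply Cmod_ge_0|left; apply Rinv_0_lt_compat; nra|apply HG'|exact Hi2]. }
  assert (P : 2 ^ k <= 3 ^ k) by (apply pow_incr; lra).
  assert (P2 : G * 2 ^ k <= G * 3 ^ k) by (apply Rmult_le_compat_l; assumption).
  assert (P3 : 0 <= B * 3 ^ k) by (apply Rmult_le_pos; [assumption|apply pow_le; lra]).
  simpl (3 ^ S k)%R. lra.
Qed.

Definition Jsum (z mu : C) : C := CSeries (Jterm mu z).

Lemma csums_Jsum (z mu : C) : csums (Jterm mu z) (Jsum z mu).
Proof.
destruct (csums_Jterm mu z) as [V [HV _]]. unfold Jsum. rewrite (csums_CSeries _ _ HV). exact HV.
Qed.

Lemma Jsum_derivable (z : C) (m : Z) : exists d, Cderiv (Jsum z) (IZR m) d.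
Proof.
set (c := fun k : nat => (- (1)) ^ k * (z / 2) ^ (2 * k) / INR (fact k)).
destruct (rGamma_quotient_bound (m + 1)) as [C0 [HC0 HB]].
set (Dq := fun (e : C) (k : nat) => (rGamma (IZR (m + 1) + INR k + e) - rGamma (IZR (m + 1) + INR k)) / e).
set (M := fun k => (C0 * ((3 * Cmod (z / 2) ^ 2) ^ k / INR (fact k)))%R).
assert (HM : summable M).
{ apply summable_scal; [assumption|]. apply summable_exp.
  apply Rmult_le_pos; [lra|apply pow_le, Cmod_ge_0]. }
assert (Hc : forall k v, Cmod v <= C0 * 3 ^ k -> Cmod (c k * v) <= M k).
{ intros k v Hv. unfold c. rewrite Cmod_mult, Cmod_div, Cmod_mult, !Cmod_pow by apply Cfact_neq_0.
  rewrite Cmod_opp, Cmod_1, pow1, Rmult_1_l, Cmod_R, Rabs_pos_eq by apply pos_INR.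
  rewrite pow_mult. unfold M. rewrite Rpow_mult_distr.
  assert (HA : 0 <= (Cmod (z / 2) ^ 2) ^ k / INR (fact k)).
  { apply Rmult_le_pos; [apply pow_le, pow_le, Cmod_ge_0|]. generalize (inv_fact_le_1 k). lra. }
  eapply Rle_trans; [apply Rmult_le_compat_l; [exact HA|exact Hv]|]. right. unfold Rdiv. ring. }
assert (Hd : forall k, exists d, tends punctured_0 (fun e => Dq e k) d).
{ intros k. destruct (rGamma_derivable (m + 1 + Z.of_nat k)) as [d Hd]. exists d.
  rewrite plus_IZR, <- INR_IZR_INZ, RtoC_plus in Hd. exact Hd. }
(* [Clim] provides the whole sequence of derivatives at once. *)
assert (Hd' : exists d : nat -> C, forall k, tends punctured_0 (fun e => Dq e k) (d k)).
{ exists (fun k => Clim punctured_0 (fun e => Dq e k)). intros k.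
  destruct (Hd k) as [v Hv]. rewrite (Clim_eq _ _ Hv). exact Hv. }
destruct Hd' as [d Hdk].
assert (Hdb : forall k, Cmod (c k * d k) <= M k).
{ intros k. apply Hc. apply (tends_Cmod_le (F := punctured_0) (fun e => Dq e k)); [|apply Hdk].
  generalize HB. apply filter_imp. intros e He. apply He. }
destruct (csums_ex _ _ Hdb HM) as [L HL]. exists L.
apply (tannery punctured_0 (fun e k => c k * Dq e k) _ (fun k => c k * d k) L M HM); try assumption.
- generalize HB. apply filter_imp. intros e He. split.
  + intros k. apply Hc, He.
  + assert (H := csums_scal (/ e) _ _ (csums_plus _ _ _ _ (csums_Jsum z (IZR m + e))
      (csums_scal (- (1)) _ _ (csums_Jsum z (IZR m))))).
    replace ((Jsum z (IZR m + e) - Jsum z (IZR m)) / e) with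
      (/ e * (Jsum z (IZR m + e) + - (1) * Jsum z (IZR m))) by (unfold Cdiv; ring).
    apply csums_ext with (2 := H). intros k. unfold Jterm, Dq, c.
    rewrite plus_IZR, RtoC_plus.
    replace (IZR m + 1 + INR k + e) with (IZR m + e + INR k + 1) by ring.
    replace (IZR m + 1 + INR k) with (IZR m + INR k + 1) by ring. unfold Cdiv. ring.
- intros k. apply tends_scal, Hdk.
Qed.

Lemma BesselJ_derivable (z : C) (m : Z) : exists d, Cderiv (fun mu => BesselJ mu z) (IZR m) d.
Proof.
destruct (Jsum_derivable z m) as [d Hd].
eexists. apply (Cderiv_mult (fun mu => Cexp (mu * Clog (z / 2))) (Jsum z)).
- apply Cderiv_Cexp.
- exact Hd.
Qed.

Lemma ffact_derivable (c m : C) (n : nat) : exists d, Cderiv (fun mu => ffact (2 * (mu + c)) n) m d.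
Proof.
induction n as [|n [d IH]].
- exists 0. apply (Cderiv_const 1).
- eexists. apply (Cderiv_mult (fun mu => ffact (2 * (mu + c)) n) (fun mu => 2 * (mu + c) - INR n)); [exact IH|].
  apply Cderiv_ext with (fun mu => 2 * mu + (2 * c - INR n)); [intros; ring|].
  apply Cderiv_plus; [apply Cderiv_scal, Cderiv_id|apply Cderiv_const].
Qed.

Lemma kummer_term_derivable (z : C) (l : nat) (m : Z) : exists d, Cderiv (fun mu => kummer_term mu z l) (IZR m) d.
Proof.
destruct (ffact_derivable (INR l) (IZR m) l) as [d1 H1].
destruct (rGamma_derivable (m + Z.of_nat l + 1)) as [d2 H2].
rewrite !plus_IZR, <- INR_IZR_INZ, !RtoC_plus in H2.
eexists.
apply Cderiv_ext with (fun mu => (Cexp (Ci * z) * (- (Ci * z / 2)) ^ l * / INR (fact l)) *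
  (Cexp (mu * Clog (z / 2)) * (ffact (2 * (mu + INR l)) l * rGamma (mu + (INR l + 1))))).
{ intros mu. unfold kummer_term, kummer_coef, Cpower. replace (mu + (INR l + 1)) with (mu + INR l + 1) by ring.
  unfold Cdiv. ring. }
apply Cderiv_scal. apply (Cderiv_mult (fun mu => Cexp (mu * Clog (z / 2)))); [apply Cderiv_Cexp|].
apply (Cderiv_mult (fun mu => ffact (2 * (mu + INR l)) l)); [exact H1|].
apply (Cderiv_translate rGamma). rewrite Cplus_assoc. exact H2.
Qed.

Lemma psum_kummer_term_derivable (z : C) (N : nat) (m : Z) :
  exists d, Cderiv (fun mu => psum (kummer_term mu z) N) (IZR m) d.
Proof.
induction N as [|N [d IH]].
- exists 0. apply (Cderiv_const 0).
- destruct (kummer_term_derivable z N m) as [d' H]. eexists. apply (Cderiv_plus _ _ _ _ _ IH H).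
Qed.

(** For l < N the argument -N + l + 1 of 1/Gamma is a non-positive integer: the terms missing from B
    vanish at the integer order, which compensates the zero of the sine under chi. *)
Lemma psum_kummer_term_neg (z : C) (N : nat) : psum (kummer_term (- INR N) z) N = 0.
Proof.
apply psum_0. intros l Hl. unfold kummer_term, kummer_coef.
replace (- INR N + INR l + 1) with (- RtoC (INR (N - l - 1))).
- rewrite rGamma_opp_INR. ring.
- replace N with (N - l - 1 + l + 1)%nat at 2 by lia. rewrite !plus_INR, !RtoC_plus. simpl. ring.
Qed.

Lemma Ccos_derivable (c m : C) : exists d, Cderiv (fun mu => Ccos (mu * c)) m d.
Proof.
eexists. apply Cderiv_ext with (fun mu => / 2 * (Cexp (mu * (Ci * c)) + Cexp (mu * (- (Ci * c))))).
- intros mu. unfold Ccos. replace (mu * (Ci * c)) with (Ci * (mu * c)) by ring.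
  replace (mu * - (Ci * c)) with (- (Ci * (mu * c))) by ring. unfold Cdiv. ring.
- apply Cderiv_scal, Cderiv_plus; apply Cderiv_Cexp.
Qed.

Lemma Csin_deriv (c m : C) : Cderiv (fun mu => Csin (mu * c)) m (c * Ccos (m * c)).
Proof.
apply Cderiv_ext with (fun mu => / (2 * Ci) * (Cexp (mu * (Ci * c)) + - (1) * Cexp (mu * (- (Ci * c))))).
- intros mu. unfold Csin. replace (mu * (Ci * c)) with (Ci * (mu * c)) by ring.
  replace (mu * - (Ci * c)) with (- (Ci * (mu * c))) by ring. unfold Cdiv. ring.
- eapply Cderiv_eq.
  2: { apply Cderiv_scal, Cderiv_plus; [|apply Cderiv_scal]; apply Cderiv_Cexp. }
  unfold Ccos. replace (m * (Ci * c)) with (Ci * (m * c)) by ring.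
  replace (m * - (Ci * c)) with (- (Ci * (m * c))) by ring. field. apply Ci_neq_0.
Qed.

Lemma Csin_int (m : Z) : Csin (IZR m * PI) = 0.
Proof.
rewrite <- RtoC_mult, Csin_RtoC. f_equal. apply sin_eq_0_1. exists m. reflexivity.
Qed.

Lemma Ccos_INR (n : nat) : Ccos (INR n * PI) = (- (1)) ^ n.
Proof.
rewrite <- RtoC_mult, Ccos_RtoC. induction n as [|n IH].
- simpl. rewrite Rmult_0_l, cos_0. reflexivity.
- rewrite S_INR. replace ((INR n + 1) * PI)%R with (INR n * PI + PI)%R by ring.
  rewrite neg_cos, RtoC_opp, IH, Cpow_S. ring.
Qed.

Lemma m1_pow_sq (n : nat) : (- (1)) ^ n * (- (1)) ^ n = RtoC 1.
Proof.
rewrite <- Cpow_mult_l. replace (- (1) * - (1)) with (RtoC 1) by ring. apply Cpow_1_l.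
Qed.

Lemma Z_cases (m : Z) : exists n : nat, IZR m = INR n \/ IZR m = (- INR n)%R.
Proof.
exists (Z.to_nat (Z.abs m)). rewrite INR_IZR_INZ, Z2Nat.id, <- opp_IZR by lia.
destruct (Z_le_gt_dec 0 m); [left|right]; f_equal; lia.
Qed.

Lemma Ccos_int_neq_0 (m : Z) : Ccos (IZR m * PI) <> 0.
Proof.
assert (X : forall n, (- (1)) ^ n <> RtoC 0).
{ intros n E. assert (H := m1_pow_sq n). rewrite E, Cmult_0_l in H. apply RtoC_inj in H. lra. }
destruct (Z_cases m) as [n [E|E]]; rewrite E.
- rewrite Ccos_INR. apply X.
- rewrite RtoC_opp. replace (- INR n * PI) with (- (INR n * PI)) by ring.
  rewrite Ccos_opp, Ccos_INR. apply X.
Qed.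

(** * Removable singularities at integers *)

Lemma Cinv_0 : / (RtoC 0) = 0.
Proof. unfold Cinv, RtoC. simpl. unfold Rdiv. f_equal; ring. Qed.

(** L'Hopital's rule at a simple zero of the sine: divided by e, numerator and denominator become
    difference quotients at m. *)
Lemma quotient_limit (N : C -> C) (m : Z) (d : C) : N (IZR m) = 0 -> Cderiv N (IZR m) d ->
  tends (locally' (RtoC (IZR m))) (fun mu => N mu / Csin (mu * PI)) (d * / (PI * Ccos (IZR m * PI))).
Proof.
intros H0 HN.
assert (HS := Csin_deriv PI (IZR m)).
assert (Hnz : PI * Ccos (IZR m * PI) <> 0).
{ apply Cmult_neq_0; [apply CPI_neq_0|apply Ccos_int_neq_0]. }
assert (H := tends_mult _ _ _ _ HN (tends_inv _ _ Hnz HS)).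
intros eps He. apply locally'_0_of.
generalize (filter_and _ _ punctured_nz (H eps He)). apply filter_imp. intros e [Hnze Hb].
replace (N (IZR m + e) / Csin ((IZR m + e) * PI)) with
  ((N (IZR m + e) - N (IZR m)) / e * / ((Csin ((IZR m + e) * PI) - Csin (IZR m * PI)) / e)); [exact Hb|].
rewrite H0, Csin_int.
(* Should the sine vanish at this nearby point, both quotients are 0 by the convention on division,
   and the equality persists. *)
destruct (Ceq_dec (Csin ((IZR m + e) * PI)) 0) as [E|E].
- rewrite E. replace ((0 - 0) / e) with (RtoC 0) by (unfold Cdiv; ring).
  unfold Cdiv. rewrite Cinv_0. ring.
- field. split; assumption.
Qed.

(** The first n terms of the series of J_(-n) vanish through 1/Gamma, and the others are those of
    J_n moved by n. This gives a factor (z/2)^(2n), which the integer power (z/2)^(-n) turns into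
    (z/2)^n. *)
Lemma BesselJ_opp_INR (z : C) (n : nat) : z <> 0 ->
  BesselJ (- INR n) z = (- (1)) ^ n * BesselJ (INR n) z.
Proof.
intros Hz.
assert (Hz2 : z / 2 <> 0).
{ intros E. apply Hz. replace z with (z / 2 * 2) by field. rewrite E. ring. }
assert (HJ := csums_Jsum z (INR n)).
assert (HJ' := csums_Jsum z (- INR n)).
assert (E : Jsum z (- INR n) = (- (1)) ^ n * (z / 2) ^ (2 * n) * Jsum z (INR n)).
{ apply (csums_unique (Jterm (- INR n) z)); [exact HJ'|].
  replace ((- (1)) ^ n * (z / 2) ^ (2 * n) * Jsum z (INR n)) with
    (psum (Jterm (- INR n) z) n + (- (1)) ^ n * (z / 2) ^ (2 * n) * Jsum z (INR n)).
  - apply csums_shift. apply csums_ext with (2 := csums_scal ((- (1)) ^ n * (z / 2) ^ (2 * n)) _ _ HJ).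
    intros k. unfold Jterm.
    replace (- INR n + INR (n + k) + 1) with (INR k + 1) by (rewrite plus_INR, RtoC_plus; ring).
    replace (INR n + INR k + 1) with (RtoC (INR (n + k)) + 1) by (rewrite plus_INR, RtoC_plus; ring).
    rewrite !rGamma_INR.
    replace (2 * (n + k))%nat with (2 * n + 2 * k)%nat by lia. rewrite !Cpow_add_r. field.
    split; apply Cfact_neq_0.
  - rewrite psum_0; [ring|]. intros k Hk. unfold Jterm.
    replace (- INR n + INR k + 1) with (- RtoC (INR (n - k - 1))).
    + rewrite rGamma_opp_INR. ring.
    + replace n with (n - k - 1 + k + 1)%nat at 2 by lia. rewrite !plus_INR, !RtoC_plus. simpl. ring. }
unfold BesselJ. fold (Jterm (- INR n) z). fold (Jterm (INR n) z).
change (Cpower (z / 2) (- INR n) * Jsum z (- INR n) = (- (1)) ^ n * (Cpower (z / 2) (INR n) * Jsum z (INR n))).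
rewrite E. unfold Cpower.
replace (- INR n * Clog (z / 2)) with (- (INR n * Clog (z / 2))) by ring.
rewrite Cexp_opp, Cexp_pow, Cexp_Clog by assumption.
replace (2 * n)%nat with (n + n)%nat by lia. rewrite Cpow_add_r. field. apply Cpow_nz, Hz2.
Qed.

(** * Limits at integers and the representation of Y *)

Lemma chi_index_pos (mu : C) : 0 < Re mu -> chi_index mu = - mu.
Proof.
intros H. unfold chi_index. rewrite sign_eq_1 by assumption. ring.
Qed.

Lemma chi_index_neg (mu : C) : Re mu < 0 -> chi_index mu = mu.
Proof.
intros H. unfold chi_index. rewrite sign_eq_m1 by assumption.
replace (-1)%R with (- (1))%R by ring. rewrite RtoC_opp. ring.
Qed.

Lemma chi_index_0 (mu : C) : Re mu = 0%R -> chi_index mu = 0.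
Proof. intros H. unfold chi_index. rewrite H, sign_0. ring. Qed.

Lemma chi_small (mu z : C) : Rabs (Re mu) < 1 / 2 -> chi (chi_index mu) z = 0.
Proof.
intros H. apply Rabs_def2 in H. apply chi_0.
destruct (Rtotal_order (Re mu) 0) as [Hm|[Hm|Hm]].
- rewrite chi_index_neg by assumption. lra.
- rewrite chi_index_0 by assumption. change (- (1 / 2) < 0). lra.
- rewrite chi_index_pos by assumption. change (- (1 / 2) < - Re mu). lra.
Qed.

(** In J_mu cos(mu pi) - J_(-mu) at most one of chi_mu and chi_(-mu) is nonzero, according to the
    sign of Re mu; S(mu) is the coefficient of the one that remains. On the imaginary axis both
    vanish. *)
Lemma BesselY_quotient_eq (z mu : C) : z <> 0 ->
  BesselY_quotient z mu = calY_quotient z mu + chi_term z mu.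
Proof.
intros Hz. unfold BesselY_quotient, calY_quotient, chi_term, S_coef.
rewrite !BesselJ_eq by assumption.
destruct (Rlt_dec (Re mu) 0) as [H|H].
- rewrite chi_index_neg by assumption.
  rewrite (chi_0 (- mu)) by (change (- (1 / 2) < - Re mu); lra). unfold Cdiv. ring.
- rewrite (chi_0 mu) by lra.
  destruct (Req_dec (Re mu) 0) as [H0|H0].
  + rewrite chi_index_0 by assumption.
    rewrite (chi_0 (- mu)) by (change (- (1 / 2) < - Re mu); lra).
    rewrite (chi_0 0) by (change (- (1 / 2) < 0); lra). unfold Cdiv. ring.
  + rewrite chi_index_pos by lra. unfold Cdiv. ring.
Qed.

Lemma B_imp_int (mu z : C) : z <> 0 -> imp_int (B_integrand mu z) (Cint_0_pi (B_integrand mu z)).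
Proof.
intros Hz. destruct (B_integral mu z Hz) as [l [Hl _]].
rewrite (imp_int_eq _ _ Hl). exact Hl.
Qed.

(** cos (mu t) is even in mu, so the integrals of B_mu and B_(-mu) merge, and i^(-mu) = i^mu e^(-i
    pi mu) yields the second coefficient. *)
Lemma calY_integral_eq (z mu : C) : z <> 0 ->
  calY_integral (fun nu => frac (- nu)) z mu = calY_quotient z mu.
Proof.
intros Hz. unfold calY_integral, calY_quotient, B.
assert (H1 := B_imp_int mu z Hz). assert (H2 := B_imp_int (- mu) z Hz).
assert (H3 := imp_int_plus _ _ _ _ (imp_int_scal (Ccos (mu * PI)) _ _ H1)
  (imp_int_scal (- Cexp (- (Ci * mu * PI))) _ _ H2)).
match goal with |- _ * Cint_0_pi ?g = _ => assert (E : Cint_0_pi g =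
   Ccos (mu * PI) * Cint_0_pi (B_integrand mu z) + - Cexp (- (Ci * mu * PI)) * Cint_0_pi (B_integrand (- mu) z)) end.
{ apply imp_int_eq. apply imp_int_ext with (2 := H3). intros t _.
  unfold B_integrand. replace (- mu * t) with (- (mu * t)) by ring. rewrite Ccos_opp. ring. }
rewrite E.
assert (Ei : ipow (- mu) = ipow mu * Cexp (- (Ci * mu * PI))).
{ unfold ipow. rewrite <- Cexp_plus. f_equal. field. }
rewrite Ei. assert (HP := CPI_neq_0).
(* Where the sine vanishes both sides are 0 by the convention on division, so the identity holds at
   every mu. *)
destruct (Ceq_dec (Csin (mu * PI)) 0) as [E0|E0].
- rewrite E0, Cmult_0_r. unfold Cdiv. rewrite Cinv_0. ring.
- field. split; assumption.
Qed.

(** Halves are rounded down on both sides of 0, so oddness fails exactly at ties: there -{mu} and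
    {-mu} differ. *)
Lemma nearest_opp (x : R) : (x - IZR (nearest x) <> 1 / 2)%R -> nearest (- x) = (- nearest x)%Z.
Proof.
intros H. destruct (nearest_spec x) as [H1 [H2|H2]]; [|contradiction].
apply nearest_unique. rewrite opp_IZR. lra.
Qed.

Lemma frac_opp (mu : C) : Re (frac mu) <> (1 / 2)%R -> frac (- mu) = - frac mu.
Proof.
intros H. unfold frac. change (Re (- mu)) with (- Re mu)%R.
rewrite nearest_opp, opp_IZR, RtoC_opp; [ring|exact H].
Qed.

Lemma calY_integral_opp_frac (z mu : C) : z <> 0 -> Re (frac mu) <> (1 / 2)%R ->
  calY_integral (fun nu => - frac nu) z mu = calY_quotient z mu.
Proof.
intros Hz H. rewrite <- calY_integral_eq by assumption. unfold calY_integral. rewrite frac_opp by exact H.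
reflexivity.
Qed.

Lemma near_int (m : Z) (P : C -> Prop) :
  (forall mu : C, Rabs (Re mu - IZR m) < 1 / 2 -> P mu) -> locally' (RtoC (IZR m)) P.
Proof.
intros H. apply locally'_C. exists (1 / 2)%R. split; [lra|]. intros y _ Hy. apply H.
eapply Rle_lt_trans; [|exact Hy]. apply (re_le_Cmod (y - IZR m)).
Qed.

Lemma nearest_near (m : Z) (x : R) : Rabs (x - IZR m) < 1 / 2 -> nearest x = m.
Proof. intros H. apply Rabs_def2 in H. apply nearest_unique. lra. Qed.

(** Half-integers stay at distance 1/2 from the integers, so both readings of the second parameter
    agree near m and give the same limit. *)
Lemma frac_near_int (m : Z) : locally' (RtoC (IZR m)) (fun mu : C => Re (frac mu) <> (1 / 2)%R).
Proof.
apply near_int. intros mu H. unfold frac. rewrite (nearest_near m) by exact H.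
apply Rabs_def2 in H. apply Rlt_not_eq. change (Re mu + - IZR m < 1 / 2)%R. lra.
Qed.

Lemma BesselY_quotient_limit (z : C) (m : Z) : z <> 0 ->
  exists l, tends (locally' (RtoC (IZR m))) (BesselY_quotient z) l.
Proof.
intros Hz.
destruct (BesselJ_derivable z m) as [d1 H1].
destruct (BesselJ_derivable z (- m)) as [d2 H2]. rewrite opp_IZR, RtoC_opp in H2.
destruct (Ccos_derivable PI (IZR m)) as [d3 H3].
eexists. apply (quotient_limit (fun mu => BesselJ mu z * Ccos (mu * PI) - BesselJ (- mu) z)).
(* The numerator vanishes at m because J_(-n) = (-1)^n J_n and cos (n pi) = (-1)^n. *)
- destruct (Z_cases m) as [n [E|E]]; rewrite E.
  + rewrite BesselJ_opp_INR, Ccos_INR by assumption. ring.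
  + rewrite RtoC_opp. replace (- INR n * PI) with (- (INR n * PI)) by ring.
    rewrite Ccos_opp, Ccos_INR, BesselJ_opp_INR by assumption.
    replace (- - INR n) with (RtoC (INR n)) by ring.
    transitivity (((- (1)) ^ n * (- (1)) ^ n) * BesselJ (INR n) z - BesselJ (INR n) z); [ring|].
    rewrite m1_pow_sq. ring.
- apply Cderiv_ext with (fun mu => BesselJ mu z * Ccos (mu * PI) + - (1) * BesselJ (- mu) z); [intros; ring|].
  exact (Cderiv_plus _ _ _ _ _ (Cderiv_mult _ _ _ _ _ H1 H3)
    (Cderiv_scal (- (1)) _ _ _ (Cderiv_comp_opp (fun mu => BesselJ mu z) _ _ H2))).
Qed.

(** For |Re mu - m| < 1/2 the nearest integer is constant, and so is the sign of Re mu when m is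
    nonzero: chi is a fixed finite sum, differentiable at m and zero there. Around m = 0 the term is
    identically 0. *)
Lemma chi_term_limit (z : C) (m : Z) : z <> 0 ->
  exists l, tends (locally' (RtoC (IZR m))) (chi_term z) l.
Proof.
intros Hz. destruct (Z.lt_trichotomy m 0) as [Hm|[Hm|Hm]].
- set (N := Z.to_nat (- m)).
  assert (EN : IZR m = (- INR N)%R).
  { unfold N. rewrite INR_IZR_INZ, Z2Nat.id, opp_IZR by lia. ring. }
  destruct (psum_kummer_term_derivable z N m) as [d1 H1].
  destruct (Ccos_derivable PI (IZR m)) as [d2 H2].
  eexists. eapply tends_ext_loc.
  2: { apply (quotient_limit (fun mu => Ccos (mu * PI) * psum (kummer_term mu z) N)).
    - rewrite EN, RtoC_opp, psum_kummer_term_neg. ring.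
    - exact (Cderiv_mult _ _ _ _ _ H2 H1). }
  apply near_int. intros mu Hmu. assert (Hm1 : IZR m <= -1) by (apply IZR_le; lia).
  assert (Hmu' := Rabs_def2 _ _ Hmu).
  unfold chi_term, S_coef. destruct (Rlt_dec (Re mu) 0) as [H|H]; [|lra].
  rewrite chi_index_neg, chi_eq, (nearest_near m) by assumption. fold N. unfold Cdiv. ring.
- subst m. exists 0. apply tends_ext_loc with (fun _ => RtoC 0); [|apply tends_const].
  apply near_int. intros mu Hmu. rewrite Rminus_0_r in Hmu.
  unfold chi_term. rewrite chi_small by assumption. unfold Cdiv. ring.
- set (N := Z.to_nat m).
  assert (EN : IZR m = INR N).
  { unfold N. rewrite INR_IZR_INZ, Z2Nat.id by lia. reflexivity. }
  destruct (psum_kummer_term_derivable z N (- m)) as [d1 H1]. rewrite opp_IZR, RtoC_opp in H1.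
  eexists. eapply tends_ext_loc.
  2: { apply (quotient_limit (fun mu => - (1) * psum (kummer_term (- mu) z) N)).
    - rewrite EN, psum_kummer_term_neg. ring.
    - exact (Cderiv_scal (- (1)) _ _ _ (Cderiv_comp_opp (fun mu => psum (kummer_term mu z) N) _ _ H1)). }
  apply near_int. intros mu Hmu. assert (Hm1 : 1 <= IZR m) by (apply IZR_le; lia).
  assert (Hmu' := Rabs_def2 _ _ Hmu).
  unfold chi_term, S_coef. destruct (Rlt_dec (Re mu) 0) as [H|H]; [lra|].
  rewrite chi_index_pos, chi_eq by (assumption || lra).
  rewrite (nearest_near (- m)).
  + rewrite Z.opp_involutive. fold N. unfold Cdiv. ring.
  + rewrite opp_IZR. change (Re (- mu)) with (- Re mu)%R.
    replace (- Re mu - - IZR m)%R with (- (Re mu - IZR m))%R by ring. rewrite Rabs_Ropp. exact Hmu.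
Qed.

(** Taken as the difference of the limits for Y and chi, which avoids differentiating the integrals
    in B with respect to mu. *)
Lemma calY_quotient_limit (z : C) (m : Z) : z <> 0 ->
  exists l, tends (locally' (RtoC (IZR m))) (calY_quotient z) l.
Proof.
intros Hz. destruct (BesselY_quotient_limit z m Hz) as [l1 H1].
destruct (chi_term_limit z m Hz) as [l2 H2]. exists (l1 - l2).
eapply tends_ext; [|apply (tends_minus _ _ _ _ H1 H2)].
intros mu. cbn beta. rewrite BesselY_quotient_eq by assumption. ring.
Qed.

Lemma calY_integral_limit (z : C) (m : Z) (l : C) : z <> 0 ->
  tends (locally' (RtoC (IZR m))) (calY_quotient z) l ->
  tends (locally' (RtoC (IZR m))) (calY_integral (fun nu => - frac nu) z) l.
Proof.
intros Hz. apply tends_ext_loc.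
generalize (frac_near_int m). apply filter_imp. intros mu Hmu.
symmetry. apply calY_integral_opp_frac; assumption.
Qed.

Lemma limit_at_integers_int (f : C -> C) (m : Z) (l : C) :
  tends (locally' (RtoC (IZR m))) f l -> limit_at_integers f (IZR m) = l.
Proof.
intros H. unfold limit_at_integers.
destruct (ClassicalEpsilon.excluded_middle_informative (is_integer (IZR m))) as [_|N].
- apply Clim_eq, H.
- destruct N. exists m. reflexivity.
Qed.

Lemma limit_at_integers_non_int (f : C -> C) (mu : C) :
  ~ is_integer mu -> limit_at_integers f mu = f mu.
Proof.
intros N. unfold limit_at_integers.
destruct (ClassicalEpsilon.excluded_middle_informative (is_integer mu)); [contradiction|reflexivity].
Qed.

Lemma ex_limit_at_integers_of (f : C -> C) (mu : C) :
  (forall m : Z, exists l, tends (locally' (RtoC (IZR m))) f l) -> ex_limit_at_integers f mu.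
Proof.
intros H [m ->]. apply ex_Clim_tends. apply H.
Qed.

Theorem mainTheorem3 (mu z : C) (Hz : ~ (Im z = 0%R /\ (Re z <= 0)%R)) :
  BesselY mu z = calY mu z + limit_at_integers (chi_term z) mu
  /\ calY mu z =
     limit_at_integers (calY_integral (fun nu => frac (- nu)) z) mu
  /\ (Re (frac mu) <> (1 / 2)%R ->
      calY mu z = limit_at_integers (calY_integral (fun nu => - frac nu) z) mu)
  /\ ((Rabs (Re mu) < 1 / 2)%R -> chi (chi_index mu) z = 0)
  (* existence of the integrals and limits above *)
  /\ ex_Cint_0_pi (B_integrand mu z)
  /\ ex_limit_at_integers (BesselY_quotient z) mu
  /\ ex_limit_at_integers (calY_quotient z) mu
  /\ ex_limit_at_integers (chi_term z) mu
  /\ ex_limit_at_integers (calY_integral (fun nu => - frac nu) z) mu.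
Proof.
assert (Hz0 : z <> 0).
{ intros E. apply Hz. rewrite E. simpl. split; [reflexivity|lra]. }
assert (HY : forall m, exists l, tends (locally' (RtoC (IZR m))) (calY_quotient z) l)
  by (intros m; apply calY_quotient_limit, Hz0).
assert (Hchi : forall m, exists l, tends (locally' (RtoC (IZR m))) (chi_term z) l)
  by (intros m; apply chi_term_limit, Hz0).
split; [|split; [|split; [|split; [|split; [|split; [|split; [|split]]]]]]].
- unfold BesselY, calY.
  destruct (ClassicalEpsilon.excluded_middle_informative (is_integer mu)) as [[m ->]|N].
  + destruct (HY m) as [l1 H1]. destruct (Hchi m) as [l2 H2].
    rewrite (limit_at_integers_int _ _ _ H1), (limit_at_integers_int _ _ _ H2).
    apply limit_at_integers_int. eapply tends_ext; [|apply (tends_plus _ _ _ _ H1 H2)].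
    intros nu. symmetry. apply BesselY_quotient_eq, Hz0.
  + rewrite !limit_at_integers_non_int by assumption. apply BesselY_quotient_eq, Hz0.
(* The two functions of nu agree at every point, integers included, so equality holds before any
   limit is taken. *)
- unfold calY. f_equal. apply functional_extensionality. intros nu.
  symmetry. apply calY_integral_eq, Hz0.
- intros Hfr. unfold calY.
  destruct (ClassicalEpsilon.excluded_middle_informative (is_integer mu)) as [[m ->]|N].
  + destruct (HY m) as [l H]. rewrite (limit_at_integers_int _ _ _ H). symmetry.
    apply limit_at_integers_int, calY_integral_limit; assumption.
  + rewrite !limit_at_integers_non_int by assumption.
    symmetry. apply calY_integral_opp_frac; assumption.
- apply chi_small.
- apply (imp_int_ex _ _ (B_imp_int mu z Hz0)).
- apply ex_limit_at_integers_of. intros m. apply BesselY_quotient_limit, Hz0.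
- apply ex_limit_at_integers_of, HY.
- apply ex_limit_at_integers_of, Hchi.
- apply ex_limit_at_integers_of. intros m. destruct (HY m) as [l H].
  exists l. apply calY_integral_limit; assumption.
Qed.
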